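(* Let $g>1$. Then $$\sum_{d=1}^\infty N_{d,g}^{\operatorname{trop}}\,q^{2d}=\sum_\Gamma \frac{1}{|\operatorname{Aut}(\Gamma)|}\,I_\Gamma(q),$$ where $N_{d,g}^{\operatorname{trop}}$ are the tropical Hurwitz numbers of a tropical elliptic curve, $I_\Gamma(q)$ is the Feynman integral of $\Gamma$, and the sum goes over all trivalent connected graphs $\Gamma$ of genus $g$ (up to isomorphism).
   Context: **Tropical covers.** A tropical curve $C$ is a connected, finite, trivalent metric graph (multiple edges and loops allowed); its genus is its first Betti number. A curve of genus $g\ge2$ has $2g-2$ vertices and $3g-3$ edges. An isomorphism of tropical curves is an isometry of metric graphs. A tropical elliptic curve $E$ is a circle of fixed length (e.g. $1$). A map $\pi:C\to E$ is a tropical cover if it is continuous, non-constant, integer affine on each edge, and balanced at every vertex $P$ of $C$: writing $w_e$ (weight of $e$) for the absolute value of the slope of $\pi_{|e}$, and letting $r_1,r_2$ be the two rays of a small neighbourhood $U$ of $\pi(P)$, among the three rays $R$ adjacent to $P$ in the component of $\pi^{-1}(U)$ containing $P$ one has $\sum_{R\mapsto r_1}w_R=\sum_{R\mapsto r_2}w_R$ (rays inherit weights from their edges). The degree of $\pi$ is $\sum_{P:\pi(P)=p}w_{e_P}$ for any $p\in E$ having no vertex as preimage, $e_P$ being the edge containing $P$. The branch points of $\pi$ are the images of the vertices of $C$. Covers $\pi:C\to E$ and $\pi':C'\to E$ are isomorphic if there is an isomorphism of curves $\phi:C\to C'$ with $\pi'\circ\phi=\pi$. The multiplicity is $\operatorname{mult}(\pi)=\frac{1}{|\operatorname{Aut}(\pi)|}\prod_e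 w_e$, the product over all edges of $C$. Fix $2g-2$ pairwise distinct points $p_1,\dots,p_{2g-2}\in E$. $N_{d,g}^{\operatorname{trop}}:=\sum_\pi\operatorname{mult}(\pi)$, the sum over isomorphism classes of degree $d$ tropical covers $\pi:C\to E$, with $C$ of genus $g$, whose branch points are exactly $p_1,\dots,p_{2g-2}$. **Propagator.** $P(z,q):=\frac{1}{4\pi^2}\wp(z,q)+\frac1{12}E_2(q^2)$, where $q=e^{i\pi\tau}$ with $\tau$ in the upper half plane, $\wp(z,q)$ is the Weierstrass $\wp$-function in $z$ of the lattice $\mathbb{Z}+\mathbb{Z}\tau$, and $E_2(q)=1-24\sum_{d\ge1}\sigma(d)q^d$ with $\sigma(d)=\sum_{m\mid d}m$. **Feynman graphs and integrals.** A Feynman graph $\Gamma$ of genus $g$ is a trivalent connected graph (multiple edges and loops allowed) with first Betti number $g$, equipped with a fixed reference labeling $x_1,\dots,x_{2g-2}$ of its vertices and $q_1,\dots,q_{3g-3}$ of its edges. Automorphisms of $\Gamma$ (not required to respect labels) act on vertices and edges preserving incidence. For an edge $q_k$ connecting $x_i$ and $x_j$ put $P_k:=P(z_i-z_j,q)$ (the sign of $z_i-z_j$ is irrelevant). For a total ordering $\Omega$ of the vertices choose pairwise different small real numbers $y_1,\dots,y_{2g-2}$ whose order equals $\Omega$, and paths $\gamma_j:[0,1]\to\mathbb{C}$, $t\mapsto iy_j+t$ (small means $|y_i-y_j|<\operatorname{Im}\tau$ for all $i,j$). Set $$I_{\Gamma,\Omega}(q):=\int_{z_j\in\gamma_j}\prod_{k=1}^{3g-3}(-P_k)\,dz_1\cdots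 dz_{2g-2},\qquad I_\Gamma(q):=\sum_\Omega I_{\Gamma,\Omega}(q),$$ the sum over all $(2g-2)!$ orders of the vertices. If $\Gamma$ has an edge which is a loop (so the integrand is not defined), set $I_{\Gamma,\Omega}=0$. *)

(* Defs.v *)
Set Warnings "-all".
From HB Require Import structures.
From mathcomp Require Import all_boot all_order all_algebra all_fingroup.
From mathcomp Require Import complex.
From mathcomp Require Import all_classical all_reals all_analysis.
From mathcomp Require Import zify.

Set Implicit Arguments.
Unset Strict Implicit.
Unset Printing Implicit Defensive.

Import Order.TTheory GRing.Theory Num.Theory numFieldNormedType.Exports.

Local Open Scope classical_set_scope.
Local Open Scope ring_scope.
Local Open Scope complex_scope.

(* A finite multigraph, loops allowed. The pair (e, b) is one of the two flags
   (half-edges) of e and [G (e, b)] the vertex it is attached to. The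
   distinction between (e, false) and (e, true) is an auxiliary orientation:
   isomorphisms are not required to respect it. *)
Definition graph (V E : finType) := {ffun E * bool -> V}.

Definition adjacent (V E : finType) (G : graph V E) : rel V :=
  fun u v => [exists e, exists b, (G (e, b) == u) && (G (e, ~~ b) == v)].

Definition num_components (V E : finType) (G : graph V E) : nat :=
  n_comp (adjacent G) V.

Definition connected_graph (V E : finType) (G : graph V E) : bool :=
  num_components G == 1%N.

(* Counting flags rather than edges lets a loop contribute 2 to the valence. *)
Definition trivalent (V E : finType) (G : graph V E) : bool :=
  [forall v, #|[pred h | G h == v]| == 3%N].

(* The first Betti number; the subtraction never truncates. *)
Definition genus (V E : finType) (G : graph V E) : nat :=
  (#|E| + num_components G - #|V|)%N.

Definition has_loop (V E : finType) (G : graph V E) : bool :=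
  [exists e, G (e, false) == G (e, true)].

(* This is why curves and graphs of genus g are taken below on the vertex set
   'I_(2g-2) and the edge set 'I_(3g-3). *)
Lemma trivalent_card (V E : finType) (G : graph V E) (g : nat) :
  (1 < g)%N -> trivalent G -> connected_graph G -> genus G = g ->
  #|V| = (2 * g - 2)%N /\ #|E| = (3 * g - 3)%N.
Proof.
move=> g1 /forallP triG /eqP conG; rewrite /genus conG => genG.
have flags : (#|E| * 2 = #|V| * 3)%N.
  rewrite -[X in (_ * X)%N = _]card_bool -card_prod -sum1_card (partition_big G predT) //=.
  rewrite -sum_nat_const; apply: eq_bigr => v _.
  rewrite sum1_card; apply/eqP; exact: triG.
by lia.
Qed.

(* Points of the circle R/LZ of circumference L are represented by real
   numbers, and equality of points by [circle_eq L]. *)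
Definition circle_eq (R : realType) (L x y : R) : Prop :=
  exists k : int, x - y = k%:~R * L.

Record tropical_curve (R : realType) (V E : finType) := TropicalCurve {
  curve_graph : graph V E;
  edge_length : E -> R;
  edge_length_gt0 : forall e, 0 < edge_length e;
  curve_trivalent : trivalent curve_graph;
  curve_connected : connected_graph curve_graph }.

(* The closed edge e of C is identified with the interval [0, edge_length C e],
   0 being the end carrying the flag (e, false). *)
Definition on_edge (R : realType) (V E : finType) (C : tropical_curve R V E)
    (e : E) (t : R) : Prop :=
  0 <= t <= edge_length C e.

(* A continuous map C -> R/LZ that is integer affine on each edge is given by
   the images of the vertices and by an integer slope on each edge, the slope
   of e being taken from (e, false) to (e, true). Such data define a map,
   [affine_value] below, exactly when [affine_closing] holds, i.e. when the
   value reached at the end of an edge is the image of the vertex there; the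
   map is then continuous. *)
Record affine_map (R : realType) (L : R) (V E : finType)
    (C : tropical_curve R V E) := AffineMap {
  vertex_image : V -> R;
  slope : E -> int;
  affine_closing : forall e, circle_eq L
    (vertex_image (curve_graph C (e, false)) + (slope e)%:~R * edge_length C e)
    (vertex_image (curve_graph C (e, true))) }.

Definition affine_value (R : realType) (L : R) (V E : finType)
    (C : tropical_curve R V E) (f : affine_map L C) (e : E) (t : R) : R :=
  vertex_image f (curve_graph C (e, false)) + (slope f e)%:~R * t.

Definition weight (R : realType) (L : R) (V E : finType)
    (C : tropical_curve R V E) (f : affine_map L C) (e : E) : nat :=
  absz (slope f e).

Definition outgoing_slope (R : realType) (L : R) (V E : finType)
    (C : tropical_curve R V E) (f : affine_map L C) (h : E * bool) : int :=
  if h.2 then - slope f h.1 else slope f h.1.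

Definition nonconstant (R : realType) (L : R) (V E : finType)
    (C : tropical_curve R V E) (f : affine_map L C) : Prop :=
  exists e t e' t', [/\ on_edge C e t, on_edge C e' t' &
    ~ circle_eq L (affine_value f e t) (affine_value f e' t')].

(* A ray at v is mapped to one or the other of the two rays at the image of v
   according to the sign of its outgoing slope. *)
Definition balanced_at (R : realType) (L : R) (V E : finType)
    (C : tropical_curve R V E) (f : affine_map L C) (v : V) : Prop :=
  (\sum_(h | (curve_graph C h == v) && (0 < outgoing_slope f h)%R) weight f h.1 =
   \sum_(h | (curve_graph C h == v) && (outgoing_slope f h < 0)%R) weight f h.1)%N.

Record tropical_cover (R : realType) (L : R) (V E : finType) :=
  TropicalCover {
    cover_curve : tropical_curve R V E;
    cover_map : affine_map L cover_curve;
    cover_nonconstant : nonconstant cover_map;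
    cover_balanced : forall v, balanced_at cover_map v }.

(* The points interior to an edge that lie over x. *)
Definition fibre (R : realType) (L : R) (V E : finType)
    (c : tropical_cover L V E) (x : R) : set (E * R) :=
  [set P | 0 < P.2 < edge_length (cover_curve c) P.1 /\
           circle_eq L (affine_value (cover_map c) P.1 P.2) x].

Definition has_degree (R : realType) (L : R) (V E : finType)
    (c : tropical_cover L V E) (d : nat) : Prop :=
  forall x : R,
    (forall v, ~ circle_eq L (vertex_image (cover_map c) v) x) ->
    (\sum_(P \in fibre c x) weight (cover_map c) P.1)%N = d.

Definition branch_points (R : realType) (L : R) (V E : finType)
    (c : tropical_cover L V E) : set R :=
  [set x | exists v, circle_eq L (vertex_image (cover_map c) v) x].

(* An isometry of metric graphs, given by its effect on vertices and on edges;
   the boolean at e tells whether the edge e is reversed with respect to the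
   auxiliary orientations (for a loop, both values give an isometry). *)
Definition iso_data (V E : finType) : finType :=
  ({perm V} * {perm E} * {ffun E -> bool})%type.

Definition curve_iso (R : realType) (V E : finType)
    (C C' : tropical_curve R V E) (phi : iso_data V E) : Prop :=
  (forall e b, curve_graph C' (phi.1.2 e, b (+) phi.2 e) = phi.1.1 (curve_graph C (e, b))) /\
  (forall e, edge_length C' (phi.1.2 e) = edge_length C e).

Definition iso_coord (R : realType) (V E : finType)
    (C : tropical_curve R V E) (phi : iso_data V E) (e : E) (t : R) : R :=
  if phi.2 e then edge_length C e - t else t.

Definition cover_iso (R : realType) (L : R) (V E : finType)
    (c c' : tropical_cover L V E) (phi : iso_data V E) : Prop :=
  curve_iso (cover_curve c) (cover_curve c') phi /\
  forall e t, on_edge (cover_curve c) e t ->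
    circle_eq L
      (affine_value (cover_map c') (phi.1.2 e)
         (iso_coord (cover_curve c) phi e t))
      (affine_value (cover_map c) e t).

Definition cover_isomorphic (R : realType) (L : R) (V E : finType)
    (c c' : tropical_cover L V E) : Prop :=
  exists phi, cover_iso c c' phi.

Definition card_cover_aut (R : realType) (L : R) (V E : finType)
    (c : tropical_cover L V E) : nat :=
  #|[pred phi : iso_data V E | `[< cover_iso c c phi >]]|.

Definition multiplicity (R : realType) (L : R) (V E : finType)
    (c : tropical_cover L V E) : R :=
  (\prod_e weight (cover_map c) e)%N%:R / (card_cover_aut c)%:R.

Definition hurwitz_covers (R : realType) (L : R) (g : nat)
    (p : 'I_(2 * g - 2) -> R) (d : nat) :
    set (tropical_cover L 'I_(2 * g - 2) 'I_(3 * g - 3)) :=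
  [set c | [/\ genus (curve_graph (cover_curve c)) = g, has_degree c d &
    branch_points c = [set x | exists i, circle_eq L (p i) x]]].
Arguments hurwitz_covers {R} L {g} p d.

Definition hurwitz_classes (R : realType) (L : R) (g : nat)
    (p : 'I_(2 * g - 2) -> R) (d : nat) :
    set (set (tropical_cover L 'I_(2 * g - 2) 'I_(3 * g - 3))) :=
  [set [set c' | cover_isomorphic c c'] | c in hurwitz_covers L p d].
Arguments hurwitz_classes {R} L {g} p d.

(* N_{d,g}^trop. The multiplicity is constant on an isomorphism class K, and
   [get] extracts its value. *)
Definition tropical_hurwitz (R : realType) (L : R) (g : nat)
    (p : 'I_(2 * g - 2) -> R) (d : nat) : R :=
  \sum_(K \in hurwitz_classes L p d) get [set multiplicity c | c in K].

Definition cexp (R : realType) (z : R[i]) : R[i] :=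
  (expR (complex.Re z))%:C *
  (cos (complex.Im z) +i* sin (complex.Im z)).

Definition nome (R : realType) (tau : R[i]) : R[i] :=
  cexp ('i%C * (pi : R)%:C * tau).

Definition wp_term (R : realType) (tau z : R[i]) (m n : int) : R[i] :=
  if (m == 0) && (n == 0) then 0
  else (z - (m%:~R + n%:~R * tau)) ^- 2 - (m%:~R + n%:~R * tau) ^- 2.

(* The sum over the nonzero lattice points converges absolutely; it is taken
   along the boxes -N <= m, n <= N. *)
Definition weierstrass_p (R : realType) (tau z : R[i]) : R[i] :=
  z ^- 2 + (limn (fun N : nat =>
    (\sum_(m < (2 * N).+1) \sum_(n < (2 * N).+1)
       wp_term tau z (m%:Z - N%:Z) (n%:Z - N%:Z)) : R[i]^o) : R[i]).

Definition sigma1 (d : nat) : nat := (\sum_(m <- divisors d) m)%N.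

Definition eisenstein2 (R : realType) (q : R[i]) : R[i] :=
  1 - 24 * (limn (fun n : nat =>
    (\sum_(1 <= d < n) (sigma1 d)%:R * q ^+ d) : R[i]^o) : R[i]).

Definition propagator (R : realType) (tau z : R[i]) : R[i] :=
  (4 * ((pi : R)%:C) ^+ 2)^-1 * weierstrass_p tau z +
  12^-1 * eisenstein2 (nome tau ^+ 2).

Definition unit_integral (R : realType) (f : R -> R[i]) : R[i] :=
  (\int[lebesgue_measure]_(t in `[0, 1]) complex.Re (f t)) +i*
  (\int[lebesgue_measure]_(t in `[0, 1]) complex.Im (f t)).

(* Iterated integral of F over t_v in [0, 1] for v in the list s, the other
   variables being given by t. *)
Fixpoint iterated_integral (R : realType) (V : finType) (s : seq V)
    (F : (V -> R) -> R[i]) (t : V -> R) : R[i] :=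
  if s is v :: s' then
    unit_integral (fun u =>
      iterated_integral s' F (fun w => if w == v then u else t w))
  else F t.

Definition feynman_integrand (R : realType) (V E : finType) (G : graph V E)
    (tau : R[i]) (z : V -> R[i]) : R[i] :=
  \prod_(e : E) - propagator tau (z (G (e, false)) - z (G (e, true))).

(* I_{Gamma,Omega}, with z_j running through the path t |-> i y_j + t. *)
Definition feynman_integral_at (R : realType) (V E : finType) (G : graph V E)
    (tau : R[i]) (y : V -> R) : R[i] :=
  if has_loop G then 0
  else iterated_integral (enum V)
         (fun t => feynman_integrand G tau (fun j => t j +i* y j)) (fun=> 0).

(* A total order Omega on n vertices is given by the rank of each vertex, a
   permutation of 'I_n. *)
Definition admissible_heights (R : realType) (n : nat) (tau : R[i])
    (Omega : {perm 'I_n}) (y : 'I_n -> R) : Prop :=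
  [/\ injective y,
      forall i j, (y i < y j) = (Omega i < Omega j)%N &
      forall i j, `|y i - y j| < complex.Im tau].

Definition feynman_integral (R : realType) (n : nat) (E : finType)
    (G : graph 'I_n E) (tau : R[i]) (y : {perm 'I_n} -> 'I_n -> R) : R[i] :=
  \sum_(Omega : {perm 'I_n}) feynman_integral_at G tau (y Omega).

Definition graph_ends (V E : finType) (G : graph V E) (e : E) : {set V} :=
  (G (e, false) |: finset.set1 (G (e, true)))%SET.

Definition graph_iso (V E : finType) (G G' : graph V E)
    (s : {perm V} * {perm E}) : bool :=
  [forall e, graph_ends G' (s.2 e) == imset s.1 (mem (graph_ends G e))].

Definition graph_isomorphic (V E : finType) : rel (graph V E) :=
  fun G G' => [exists s, graph_iso G G' s].

Definition card_graph_aut (V E : finType) (G : graph V E) : nat :=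
  #|[pred s | graph_iso G G s]|.

Definition labelled_feynman_graphs (g : nat) :
    {set graph 'I_(2 * g - 2) 'I_(3 * g - 3)} :=
  finset (fun G => [&& trivalent G, connected_graph G & genus G == g]).

(* One (labelled) representative of each isomorphism class. *)
Definition feynman_graphs (g : nat) :
    {set graph 'I_(2 * g - 2) 'I_(3 * g - 3)} :=
  transversal
    (equivalence_partition (@graph_isomorphic 'I_(2 * g - 2) 'I_(3 * g - 3))
       (labelled_feynman_graphs g))
    (labelled_feynman_graphs g).

(* Main.v *)
Require Import Defs.
Set Warnings "-all".
From HB Require Import structures.
From mathcomp Require Import all_boot all_order all_algebra all_fingroup.
From mathcomp Require Import complex.
From mathcomp Require Import all_classical all_reals all_analysis.
From mathcomp Require Import zify ring lra.
Import Order.TTheory GRing.Theory Num.Theory numFieldNormedType.Exports.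
Set Implicit Arguments.
Unset Strict Implicit.
Unset Printing Implicit Defensive.
Local Open Scope classical_set_scope.
Local Open Scope ring_scope.
Local Open Scope complex_scope.

(** Both sides are generating series of the same finite combinatorial objects,
    and both are averages over the finite group of relabellings.

    Let [q] be [exp(2 pi i tau)], the square of the nome. By Lipschitz' formula
    the rows of the Weierstrass sum are values of the Koebe function
    [koebe x = x / (1 - x)^2], and the Eisenstein series removes all the
    constants, so that [- P(z)] is the sum over all integers [m] of
    [koebe (exp(2 pi i (z + m tau)))] ([propagator_koebe_exp_sum]). For
    [0 < |Im z| < Im tau] each of these terms has a convergent expansion, in
    [x] or in [1/x], and [- P(z)] is the sum of
    [|k| exp(2 pi i k (z + m tau))] over the integers [k] and [m] with
    [0 < k (m Im tau + Im z)]; truncating to [|k|, |m| <= N] makes an error that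
    tends to zero uniformly in [Re z] ([fourier_box_approx]).

    Multiply these expansions over the edges of a graph. This chooses for each
    edge a flow [k] and a winding number [m], and the integral over the real
    parts of the variables keeps the choices in which the flow is conserved at
    every vertex ([feynman_box_lim]). The surviving term is
    [prod_e |k_e| * q ^ (sum_e k_e m_e)], and the condition
    [0 < k (m Im tau + Im z)] depends only on the order of the heights of the
    vertices ([positive_heights]).

    A tropical cover that maps its vertices to distinct points has no loop and no
    edge of slope zero, and its vertices are ordered by their images once the
    circle is cut open at a point. Each edge has a slope and a winding
    number; balancing is conservation of the flow, and the condition above says
    that the length of the edge is positive. Counting the preimages of a point
    by integer parts gives the degree [sum_e k_e m_e] ([fibre_sum]). So
    the data of labelled covers are exactly the choices that occur in the Feynman
    integrals ([cover_key], [key_cover]), with the same weight.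

    The group of relabellings of vertices, edges and orientations acts on these
    data. Isomorphism classes of covers are its orbits and automorphisms are
    stabilisers; the same holds for graphs without loops. Hence each side is the
    sum over all labelled data divided by the order of the group
    ([sum_transversal]). Finally, since the degree bounds all flows and winding
    numbers ([flow_le_degree], [winding_le_degree]), the data of degree less
    than [N] all lie in the box [|k|, |m| <= N], and what the box contains
    besides them is polynomially many terms of size at most [N^e |q|^N], with
    [e] the number of edges ([feynman_degree_lim]). *)

(** * Limits of complex sequences *)

Section ComplexLimits.
Variable R : realType.
Local Notation C := R[i].
Implicit Types (z w : C) (u v : nat -> C).

Definition cabs z : R := complex.Re `|z|.

Lemma cabsE z : `|z| = (cabs z)%:C.
Proof. by rewrite /cabs normc_def. Qed.

Lemma cabs_sqrt z : cabs z = Num.sqrt (complex.Re z ^+ 2 + complex.Im z ^+ 2).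
Proof. by rewrite /cabs normc_def. Qed.

Lemma cabs_ge0 z : 0 <= cabs z.
Proof. by rewrite cabs_sqrt sqrtr_ge0. Qed.

Lemma cabs_sqr z : cabs z ^+ 2 = complex.Re z ^+ 2 + complex.Im z ^+ 2.
Proof. by rewrite cabs_sqrt sqr_sqrtr // addr_ge0 // sqr_ge0. Qed.

Lemma cabsN z : cabs (- z) = cabs z.
Proof. by rewrite /cabs normrN. Qed.

Lemma cabsC z w : cabs (z - w) = cabs (w - z).
Proof. by rewrite -cabsN opprB. Qed.

Lemma cabsD z w : cabs (z + w) <= cabs z + cabs w.
Proof. by rewrite -lecR rmorphD -!cabsE; exact: ler_normD. Qed.

Lemma cabsM z w : cabs (z * w) = cabs z * cabs w.
Proof. by apply: complexI; rewrite rmorphM -!cabsE normrM. Qed.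

Lemma cabs_real (x : R) : cabs x%:C = `|x|.
Proof. by rewrite cabs_sqrt /= expr0n addr0 sqrtr_sqr. Qed.

Lemma cabs0 : cabs 0 = 0.
Proof. by rewrite /cabs normr0. Qed.

Lemma cabs1 : cabs 1 = 1.
Proof. by rewrite /cabs normr1. Qed.

Lemma cabs_eq0 z : (cabs z == 0) = (z == 0).
Proof. by rewrite -[z == 0]normr_eq0 cabsE -(inj_eq (@complexI R)). Qed.

Lemma cabs_gt0 z : (0 < cabs z) = (z != 0).
Proof. by rewrite lt_def cabs_ge0 andbT cabs_eq0. Qed.

Lemma cabsV z : cabs z^-1 = (cabs z)^-1.
Proof. by apply: complexI; rewrite fmorphV -!cabsE normfV. Qed.

Lemma cabsX z n : cabs (z ^+ n) = cabs z ^+ n.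
Proof. by apply: complexI; rewrite rmorphXn -!cabsE normrX. Qed.

Lemma cabs_nat n : cabs n%:R = n%:R.
Proof. by rewrite -(rmorph_nat (real_complex R)) cabs_real ger0_norm. Qed.

Lemma cabs_sum (I : Type) (s : seq I) (P : pred I) (F : I -> C) :
  cabs (\sum_(i <- s | P i) F i) <= \sum_(i <- s | P i) cabs (F i).
Proof.
elim/big_rec2: _ => [|i y z _ le_zy]; first by rewrite cabs0.
by apply: le_trans (cabsD _ _) _; rewrite lerD2l.
Qed.

Lemma cabs_prod (I : Type) (s : seq I) (P : pred I) (F : I -> C) :
  cabs (\prod_(i <- s | P i) F i) = \prod_(i <- s | P i) cabs (F i).
Proof.
by elim/big_rec2: _ => [|i y z _ <-]; rewrite ?cabs1 ?cabsM.
Qed.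

Lemma Re_le_cabs z : `|complex.Re z| <= cabs z.
Proof. by rewrite -lecR -cabsE normc_ge_Re. Qed.

Lemma Im_le_cabs z : `|complex.Im z| <= cabs z.
Proof.
rewrite cabs_sqrt -sqrtr_sqr ler_sqrt; last by rewrite addr_ge0 ?sqr_ge0.
by rewrite lerDr sqr_ge0.
Qed.

Lemma cabs_le_ReIm z : cabs z <= `|complex.Re z| + `|complex.Im z|.
Proof.
rewrite -(@ler_pXn2r _ 2) ?nnegrE ?cabs_ge0 ?addr_ge0 //.
rewrite cabs_sqr sqrrD !real_normK ?num_real // lerD2r lerDl.
by rewrite mulrn_wge0 // mulr_ge0.
Qed.

Lemma cabs_dist z w x : cabs (z - x) <= cabs (z - w) + cabs (w - x).
Proof. by rewrite -[z - x](subrKA w) cabsD. Qed.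

(** Convergence is expressed by a real sequence, to which the order and squeeze
    lemmas apply. *)
Definition clim u l : Prop := (fun n => cabs (u n - l)) @ \oo --> (0 : R).

Lemma clim_squeeze u l (d : nat -> R) (n0 : nat) :
  (forall n, (n0 <= n)%N -> cabs (u n - l) <= d n) -> d @ \oo --> (0 : R) -> clim u l.
Proof.
move=> le_d d0; apply: (squeeze_cvgr _ (cvg_cst (0 : R)) d0).
by exists n0 => // n /= n0n; rewrite cabs_ge0 le_d.
Qed.

Lemma clim_cvg u l : clim u l -> (u : nat -> C^o) @ \oo --> (l : C^o).
Proof.
move=> /cvgrPdist_lt u_l; apply/cvgrPdist_lt => -[e e'] /=.
rewrite ltcE /= => /andP[/eqP -> e0]; near=> n.
rewrite cabsE ltcR; near: n; have := u_l e e0.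
apply: filterS => n; rewrite sub0r normrN ger0_norm ?cabs_ge0 //.
by rewrite cabsC.
Unshelve. all: by end_near. Qed.

Lemma clim_limn u l : clim u l -> limn (u : nat -> C^o) = l.
Proof. by move/clim_cvg => u_l; apply: cvg_lim => //; exact: norm_hausdorff. Qed.

Lemma clim_cst z : clim (fun=> z) z.
Proof. by rewrite /clim subrr cabs0; exact: cvg_cst. Qed.

Lemma climD u v a b : clim u a -> clim v b -> clim (fun n => u n + v n) (a + b).
Proof.
move=> ua vb; apply: (@clim_squeeze _ _ (fun n => cabs (u n - a) + cabs (v n - b)) 0).
  by move=> n _; rewrite opprD addrACA cabsD.
by rewrite -[X in _ --> X](addr0 0); apply: cvgD.
Qed.

Lemma climZ u a z : clim u a -> clim (fun n => z * u n) (z * a).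
Proof.
move=> ua; apply: (@clim_squeeze _ _ (fun n => cabs z * cabs (u n - a)) 0).
  by move=> n _; rewrite -mulrBr cabsM.
by rewrite -[X in _ --> X](mulr0 (cabs z)); apply: cvgMr.
Qed.

Lemma climN u a : clim u a -> clim (fun n => - u n) (- a).
Proof.
by move=> /(climZ (-1)); rewrite mulN1r; under eq_fun do rewrite mulN1r.
Qed.

Lemma clim_sum (I : Type) (s : seq I) (P : pred I) (U : I -> nat -> C) (l : I -> C) :
  (forall i, P i -> clim (U i) (l i)) ->
  clim (fun n => \sum_(i <- s | P i) U i n) (\sum_(i <- s | P i) l i).
Proof.
move=> Ul; elim: s => [|i s IH].
  by rewrite big_nil; under eq_fun do rewrite big_nil; exact: clim_cst.
rewrite big_cons; under eq_fun do rewrite big_cons.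
by case: ifP => // Pi; apply: climD => //; exact: Ul.
Qed.

Lemma clim_near u v a : clim u a -> (fun n => cabs (v n - u n)) @ \oo --> (0 : R) -> clim v a.
Proof.
move=> ua vu; apply: (@clim_squeeze _ _ (fun n => cabs (v n - u n) + cabs (u n - a)) 0).
  by move=> n _; exact: cabs_dist.
by rewrite -[X in _ --> X](addr0 0); apply: cvgD.
Qed.

Lemma clim_le u a (b : R) (n0 : nat) :
  clim u a -> (forall n, (n0 <= n)%N -> cabs (u n) <= b) -> cabs a <= b.
Proof.
move=> ua ub; apply/ler_addgt0Pr => e e0.
move/cvgrPdist_lt: ua => /(_ e e0) [n1 _ near_a].
have /= := near_a (maxn n0 n1) (leq_maxr _ _).
rewrite sub0r normrN ger0_norm ?cabs_ge0 // cabsC => lt_e.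
rewrite -(subrK (u (maxn n0 n1)) a) addrC.
apply: le_trans (cabsD _ _) _; apply: lerD; last exact: ltW.
by apply: ub; rewrite leq_maxl.
Qed.

(** Shifting the sequence by d n downwards and upwards gives a nondecreasing and a
    nonincreasing sequence; the limit of the former is within d n of x n. *)
Lemma monotone_shift_cvg (x : nat -> R) (d : nat -> R) :
  (forall n, `|x n.+1 - x n| <= d n - d n.+1) -> d @ \oo --> (0 : R) ->
  (forall n, 0 <= d n) ->
  exists l : R, forall n, `|x n - l| <= d n.
Proof.
move=> le_d d0 dge0.
pose a n := x n - d n; pose b n := x n + d n.
have a_nd : nondecreasing_seq a.
  apply/nondecreasing_seqP => n; have := le_d n; rewrite ler_norml /a => /andP[+ _].
  lra.
have b_ni : nonincreasing_seq b.
  apply/nonincreasing_seqP => n; have := le_d n; rewrite ler_norml /b => /andP[_ +].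
  lra.
have le_ab n m : a n <= b m.
  apply: (le_trans (a_nd _ _ (leq_maxl n m))).
  apply: (le_trans _ (b_ni _ _ (leq_maxr n m))).
  by rewrite /a /b; have := dge0 (maxn n m); lra.
have a_cvg : cvgn a.
  apply: nondecreasing_is_cvgn => //.
  by exists (b 0) => _ [n _ <-]; exact: le_ab.
exists (limn a) => n; rewrite ler_norml; apply/andP; split.
  suff: limn a <= b n by rewrite /b; lra.
  by apply: limr_le => //; near=> m; exact: le_ab.
suff: a n <= limn a by rewrite /a; lra.
exact: nondecreasing_cvgn_le.
Unshelve. all: by end_near. Qed.

Lemma complex_cauchy u (d : nat -> R) :
  (forall n, cabs (u n.+1 - u n) <= d n - d n.+1) -> d @ \oo --> (0 : R) ->
  (forall n, 0 <= d n) ->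
  exists l : C, forall n, cabs (u n - l) <= 2 * d n.
Proof.
move=> le_d d0 dge0.
have [x|l1 h1] := @monotone_shift_cvg (fun n => complex.Re (u n)) d _ d0 dge0.
  by apply: le_trans (le_d x); apply: le_trans (Re_le_cabs _); case: (u _) (u _) => ? ? [].
have [x|l2 h2] := @monotone_shift_cvg (fun n => complex.Im (u n)) d _ d0 dge0.
  by apply: le_trans (le_d x); apply: le_trans (Im_le_cabs _); case: (u _) (u _) => ? ? [].
exists (l1 +i* l2) => n; apply: (le_trans (cabs_le_ReIm _)).
have := h1 n; have := h2 n; case: (u n) => a b /=; lra.
Qed.

End ComplexLimits.

(** * Elementary bounds for trigonometric and hyperbolic functions *)

Section TrigBounds.
Variable R : realType.
Implicit Types (a b x : R).

(** All the bounds below are iterations of this form of the mean value theorem. *)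
Lemma MVT0 (f df : R -> R) : (forall x, is_derive x 1 f (df x)) -> f 0 = 0 ->
  forall b, exists2 c, `|c| <= `|b| & f b = df c * b.
Proof.
move=> f' f0 b.
have cf s : {within s, continuous f}.
  apply: continuous_subspaceT => x; apply: differentiable_continuous.
  by apply/derivable1_diffP; apply: ex_derive.
have [b0|b0] := leP 0 b.
  have [c|c cb] := @MVT_segment _ f df 0 b b0 (fun x _ => f' x); first exact: cf.
  rewrite f0 !subr0 => ->; exists c => //; move: cb; rewrite in_itv /= => /andP[c0 cb].
  by rewrite !ger0_norm.
have [c|c cb] := @MVT_segment _ f df b 0 (ltW b0) (fun x _ => f' x); first exact: cf.
rewrite f0 !sub0r mulrN => /oppr_inj ->; exists c => //; move: cb; rewrite in_itv /= => /andP[bc c0].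
by rewrite !ler0_norm ?lerN2 // ltW.
Qed.

Lemma abs_sin_le x : `|sin x| <= `|x|.
Proof.
have [c _ ->] := MVT0 (fun x => is_derive_sin x) (@sin0 R) x.
by rewrite normrM ler_piMl // cos_max.
Qed.

Lemma onemcos_ge0 x : 0 <= 1 - cos x.
Proof. by rewrite subr_ge0 cos_le1. Qed.

Lemma onemcos_le x : 1 - cos x <= x ^+ 2 / 2.
Proof.
have -> : 1 - cos x = 2 * sin (x / 2) ^+ 2.
  have := cos_mulr2n (x / 2); rewrite [x / 2 *+ 2]mulr2n -splitr => ->.
  by rewrite sin2cos2; ring.
have := abs_sin_le (x / 2); rewrite -(@ler_pXn2r _ 2) ?nnegrE //.
rewrite !real_normK ?num_real // exprMn; lra.
Qed.

Lemma abs_subsin_le x : `|x - sin x| <= `|x| ^+ 3.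
Proof.
have d (y : R) : is_derive y 1 (fun t : R => t - sin t) (1 - cos y).
  by apply: is_deriveB.
have [|c le_c ->] := MVT0 d _ x; first by rewrite sin0 subr0.
rewrite normrM exprS mulrC ler_wpM2l // ger0_norm ?onemcos_ge0 //.
apply: le_trans (onemcos_le c) _.
move: le_c; rewrite -(@ler_pXn2r _ 2) ?nnegrE // !real_normK ?num_real //.
have := sqr_ge0 c; lra.
Qed.

(** The bound is needed a little beyond the quarter period pi/2: halving the
    argument makes the cosine bounded below. *)
Lemma abs_sin_ge : exists2 c : R, 0 < c &
  forall x, `|x| <= 3 / 4 * pi -> c * `|x| <= `|sin x|.
Proof.
pose c0 : R := cos (3 / 8 * pi); have pi0 := pi_gt0 R.
have c0_gt0 : 0 < c0 by apply: cos_gt0_pihalf; apply/andP; split; lra.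
exists (c0 ^+ 2); first by rewrite exprn_gt0.
move=> x le_x; have cos_ge y : `|y| <= 3 / 8 * pi -> c0 <= cos y.
  move=> le_y; rewrite -cos_norm /c0 leNgt ltr_cos ?in_itv /= ?normr_ge0 -?leNgt //.
    by lra.
  by apply/andP; split; lra.
have le_h : `|x / 2| <= 3 / 8 * pi by rewrite normrM (ger0_norm (_ : 0 <= 2^-1)); lra.
have := sin_mulr2n (x / 2); rewrite [x / 2 *+ 2]mulr2n -splitr => ->.
have [c le_c ->] := MVT0 (fun x => is_derive_sin x) (@sin0 R) (x / 2).
have c1 := cos_ge _ le_h; have c2 := cos_ge c (le_trans le_c le_h).
have -> : (cos (x / 2) * (cos c * (x / 2))) *+ 2 = cos (x / 2) * cos c * x.
  by field.
rewrite normrM ler_wpM2r // ger0_norm; last by rewrite mulr_ge0 //; lra.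
by rewrite expr2 ler_pM // ltW.
Qed.

Definition sinhR x : R := (expR x - expR (- x)) / 2.
Definition coshR x : R := (expR x + expR (- x)) / 2.

Lemma is_derive_expRN x : is_derive x 1 (fun t : R => expR (- t)) (- expR (- x)).
Proof.
have := @is_derive1_comp _ expR (@GRing.opp R) x (expR (- x)) (-1).
by rewrite mulrN1; apply.
Qed.

Lemma is_derive_sinhR x : is_derive x 1 sinhR (coshR x).
Proof.
rewrite /sinhR /coshR; have := is_derive_expRN x => d.
have : is_derive x 1 (fun t : R => (2^-1 : R) *: (expR t - expR (- t)))
  (2^-1 *: (expR x - - expR (- x))) by apply: is_deriveZ.
rewrite opprK; congr is_derive; last by rewrite /GRing.scale /= mulrC.
by apply/funext => t; rewrite /GRing.scale /= mulrC.
Qed.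

Lemma sinhR0 : sinhR 0 = 0.
Proof. by rewrite /sinhR oppr0 subrr mul0r. Qed.

Lemma coshR_sqr x : coshR x ^+ 2 = 1 + sinhR x ^+ 2.
Proof. by rewrite /coshR /sinhR expRN; field; rewrite gt_eqF ?expR_gt0. Qed.

Lemma coshR_gt0 x : 0 < coshR x.
Proof. by rewrite /coshR divr_gt0 // addr_gt0 ?expR_gt0. Qed.

Lemma coshR_ge1 x : 1 <= coshR x.
Proof.
rewrite -(@ler_pXn2r _ 2) ?nnegrE ?ler01 ?(ltW (coshR_gt0 _)) //.
by rewrite coshR_sqr expr1n lerDl sqr_ge0.
Qed.

Lemma coshR_le x B : `|x| <= B -> coshR x <= expR B.
Proof.
rewrite ler_norml => /andP[lo hi]; rewrite /coshR.
have : expR x <= expR B by rewrite ler_expR.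
have : expR (- x) <= expR B by rewrite ler_expR; lra.
lra.
Qed.

Lemma abs_sinhR_le x B : `|x| <= B -> `|sinhR x| <= expR B * `|x|.
Proof.
move=> xB; have [c le_c ->] := MVT0 is_derive_sinhR sinhR0 x.
rewrite normrM ler_wpM2r // ger0_norm ?(ltW (coshR_gt0 _)) //.
by apply: coshR_le; exact: le_trans le_c xB.
Qed.

Lemma abs_sinhR_ge x : `|x| <= `|sinhR x|.
Proof.
have [c le_c ->] := MVT0 is_derive_sinhR sinhR0 x.
rewrite normrM ler_peMl // ger0_norm ?(ltW (coshR_gt0 _)) //; exact: coshR_ge1.
Qed.

Lemma coshRm1_le x B : `|x| <= B -> coshR x - 1 <= expR B ^+ 2 * x ^+ 2.
Proof.
move=> xB; have : `|x / 2| <= B.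
  by rewrite normrM (ger0_norm (_ : 0 <= 2^-1)) //; have := normr_ge0 x; lra.
move=> /abs_sinhR_le; rewrite -(@ler_pXn2r _ 2) ?nnegrE ?mulr_ge0 ?expR_ge0 //.
rewrite exprMn !real_normK ?num_real // [(x / 2) ^+ 2](_ : _ = x ^+ 2 / 4); last by field.
have -> : coshR x - 1 = 2 * sinhR (x / 2) ^+ 2.
  rewrite /coshR /sinhR {1 2}[x]splitr opprD !expRD !expRN; field.
  by rewrite gt_eqF ?expR_gt0.
have e0 : 0 <= expR B ^+ 2 * x ^+ 2 by rewrite mulr_ge0 // sqr_ge0.
rewrite mulrA; move: (sinhR (x / 2) ^+ 2) (expR B ^+ 2 * x ^+ 2) e0 => s t; lra.
Qed.

Lemma abs_subsinhR_le x B : `|x| <= B -> `|x - sinhR x| <= expR B ^+ 2 * `|x| ^+ 3.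
Proof.
move=> xB.
have d (y : R) : is_derive y 1 (fun t : R => t - sinhR t) (1 - coshR y).
  by apply: is_deriveB; exact: is_derive_sinhR.
have [|c le_c ->] := MVT0 d _ x; first by rewrite sinhR0 subr0.
rewrite normrM exprS mulrCA mulrC ler_wpM2l // distrC ger0_norm; last first.
  by rewrite subr_ge0 coshR_ge1.
apply: le_trans (coshRm1_le (le_trans le_c xB)) _.
rewrite ler_wpM2l ?sqr_ge0 // -(real_normK (num_real c)).
by rewrite ler_pXn2r // nnegrE.
Qed.

End TrigBounds.

(** * The exponential, the sine and the Koebe function *)

Section Exponential.
Variable R : realType.
Local Notation C := R[i].
Implicit Types (z w : C) (s t : R).

Definition cis s : C := cos (2 * pi * s) +i* sin (2 * pi * s).

Lemma cisD s t : cis (s + t) = cis s * cis t.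
Proof.
rewrite /cis mulrDr cosD sinD; apply/eqP; rewrite eq_complex /=.
by rewrite [X in _ && (_ == X)]addrC eqxx [X in _ && (X + _ == _)]mulrC mulrC !eqxx.
Qed.

Lemma cis0 : cis 0 = 1.
Proof. by rewrite /cis mulr0 cos0 sin0. Qed.

Lemma cabs_cis s : cabs (cis s) = 1.
Proof.
apply/eqP; rewrite -(@eqrXn2 _ 2) ?cabs_ge0 ?ler01 // cabs_sqr /= cos2Dsin2.
by rewrite expr1n.
Qed.

Lemma cis1 : cis 1 = 1.
Proof. by rewrite /cis mulr1 mulr_natl cos2pi sin2pi. Qed.

Lemma cis_half : cis 2^-1 = -1.
Proof.
rewrite /cis mulrAC divff // mul1r cospi sinpi.
by apply/eqP; rewrite eq_complex /= oppr0 !eqxx.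
Qed.

Lemma cisX n s : cis s ^+ n = cis (n%:R * s).
Proof.
elim: n => [|n IH]; first by rewrite mul0r cis0.
by rewrite exprS IH -cisD -natr1 mulrDl mul1r addrC.
Qed.

(** The character z |-> exp(2 pi i z) of C/Z. *)
Definition e2pi z : C := (expR (- (2 * pi * complex.Im z)))%:C * cis (complex.Re z).

Lemma ReD z w : complex.Re (z + w) = complex.Re z + complex.Re w.
Proof. by case: z w => [? ?] []. Qed.

Lemma ImD z w : complex.Im (z + w) = complex.Im z + complex.Im w.
Proof. by case: z w => [? ?] []. Qed.

Lemma ReN z : complex.Re (- z) = - complex.Re z.
Proof. by case: z. Qed.

Lemma ImN z : complex.Im (- z) = - complex.Im z.
Proof. by case: z. Qed.

Lemma natcE n : (n%:R : C) = (n%:R : R)%:C.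
Proof. by rewrite rmorph_nat. Qed.

Lemma intcE (m : int) : (m%:~R : C) = (m%:~R : R)%:C.
Proof. by rewrite rmorph_int. Qed.

Lemma half_c z : z / 2 = (2^-1 : R)%:C * z.
Proof. by rewrite fmorphV rmorph_nat mulrC. Qed.

Lemma Re_realM t z : complex.Re (t%:C * z) = t * complex.Re z.
Proof. by case: z => a b /=; rewrite mul0r subr0. Qed.

Lemma Im_realM t z : complex.Im (t%:C * z) = t * complex.Im z.
Proof. by case: z => a b /=; rewrite mul0r addr0. Qed.

Lemma e2piD z w : e2pi (z + w) = e2pi z * e2pi w.
Proof. by rewrite /e2pi ReD ImD mulrDr opprD expRD cisD rmorphM mulrACA. Qed.

Lemma e2pi_real t : e2pi t%:C = cis t.
Proof. by rewrite /e2pi /= mulr0 oppr0 expR0 mul1r. Qed.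

Lemma e2pi0 : e2pi 0 = 1.
Proof. by rewrite (e2pi_real 0) cis0. Qed.

Lemma cabs_e2pi z : cabs (e2pi z) = expR (- (2 * pi * complex.Im z)).
Proof. by rewrite /e2pi cabsM cabs_cis mulr1 cabs_real ger0_norm // expR_ge0. Qed.

Lemma e2pi_neq0 z : e2pi z != 0.
Proof. by rewrite -cabs_gt0 cabs_e2pi expR_gt0. Qed.

Lemma e2piN z : e2pi (- z) = (e2pi z)^-1.
Proof.
apply: (mulIf (e2pi_neq0 z)); rewrite mulVf ?e2pi_neq0 //.
by rewrite -e2piD addNr e2pi0.
Qed.

Lemma e2pi_natM n z : e2pi (n%:R * z) = e2pi z ^+ n.
Proof.
elim: n => [|n IH]; first by rewrite mul0r e2pi0.
by rewrite -natr1 mulrDl mul1r e2piD IH exprSr.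
Qed.

Lemma e2pi1 : e2pi 1 = 1.
Proof. by rewrite (e2pi_real 1) cis1. Qed.

Lemma e2piD1 z : e2pi (z + 1) = e2pi z.
Proof. by rewrite e2piD e2pi1 mulr1. Qed.

Lemma e2pi_half z : e2pi ((z - 1) / 2) = - e2pi (z / 2).
Proof.
rewrite mulrBl mul1r e2piD e2piN.
have -> : (2^-1 : C) = (2^-1 : R)%:C by rewrite fmorphV rmorph_nat.
by rewrite e2pi_real cis_half invrN1 mulrN1.
Qed.

Lemma nome_sqr tau : nome tau ^+ 2 = e2pi tau.
Proof.
have -> : nome tau = e2pi (tau / 2).
  rewrite /nome /cexp /e2pi /cis.
  rewrite half_c Re_realM Im_realM; case: tau => a b /=.
  by congr (_ * _); [congr (_%:C); congr expR|congr (_ +i* _); [congr cos|congr sin]]; field.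
by rewrite -e2pi_natM mulrC divfK.
Qed.

Lemma e2pi_eq1_Im z : e2pi z = 1 -> complex.Im z = 0.
Proof.
move=> ez; have := cabs_e2pi z; rewrite ez cabs1 -(expR0 R) => /expR_inj/esym/eqP.
by rewrite oppr_eq0 mulf_eq0 gt_eqF ?mulr_gt0 ?pi_gt0 //= => /eqP.
Qed.

Lemma e2pi_neq1_real t : 0 < t < 1 -> e2pi t%:C != 1.
Proof.
move=> /andP[t0 t1]; rewrite e2pi_real /cis eq_complex /= negb_and.
apply/orP; left; have -> : 2 * pi * t = (pi * t) *+ 2 :> R by ring.
have pi0 := pi_gt0 R.
have : 0 < sin (pi * t).
  by apply: sin_gt0_pi; rewrite mulr_gt0 //= gtr_pMr.
rewrite cos_mulr2n cos2sin2 => s0; rewrite lt_eqF //.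
have : 0 < sin (pi * t) ^+ 2 by rewrite exprn_gt0.
lra.
Qed.

(** The Koebe function, whose Taylor series sums k x^k. *)
Definition koebe (x : C) : C := x / (1 - x) ^+ 2.

(** Up to the factor -1/4 this is the inverse square of the sine of pi z, see
    [koebe_exp_csin]. *)
Definition koebe_exp z : C := koebe (e2pi z).

Lemma koebe_expD1 z : koebe_exp (z + 1) = koebe_exp z.
Proof. by rewrite /koebe_exp e2piD1. Qed.

Lemma koebeV x : koebe x^-1 = koebe x.
Proof.
have [->|x0] := eqVneq x 0; first by rewrite invr0.
have [->|x1] := eqVneq x 1; first by rewrite invr1.
by rewrite /koebe; field; rewrite x0 !subr_eq0 [1 == x]eq_sym x1.
Qed.

Lemma koebe_expN z : koebe_exp (- z) = koebe_exp z.
Proof. by rewrite /koebe_exp e2piN koebeV. Qed.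

Lemma koebe_exp0 : koebe_exp 0 = 0.
Proof. by rewrite /koebe_exp e2pi0 /koebe subrr expr0n invr0 mulr0. Qed.

Lemma koebe_exp_mhalf : koebe_exp ((0 - 1) / 2) = - 4^-1.
Proof. by rewrite /koebe_exp e2pi_half mul0r e2pi0 /koebe; field. Qed.

(** An identity between rational functions of a square root y of exp(2 pi i z),
    the other square root being -y. *)
Lemma koebe_exp_dup z : e2pi z != 1 -> koebe_exp (z / 2) + koebe_exp ((z - 1) / 2) = 4 * koebe_exp z.
Proof.
move=> z1; rewrite /koebe_exp e2pi_half.
have -> : e2pi z = e2pi (z / 2) ^+ 2 by rewrite -e2pi_natM mulrC divfK.
have : e2pi (z / 2) ^+ 2 != 1 by rewrite -e2pi_natM mulrC divfK.
rewrite -subr_eq0 subr_sqr_1 mulf_eq0 negb_or => /andP[y1 y2].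
rewrite /koebe; field; rewrite opprK [1 + e2pi _]addrC y2 -[1 - _ ^+ 2]opprB oppr_eq0.
by rewrite subr_sqr_1 mulf_neq0 // -[1 - _]opprB oppr_eq0 y1.
Qed.

(** The complex sine of pi w. *)
Definition csin w : C :=
  (sin (pi * complex.Re w) * coshR (pi * complex.Im w)) +i*
  (cos (pi * complex.Re w) * sinhR (pi * complex.Im w)).

Lemma csin_e2pi w : e2pi (w / 2) * csin w * ('i * 2) = e2pi w - 1.
Proof.
have -> : e2pi w - 1 = e2pi (w / 2) * (e2pi (w / 2) - e2pi (- (w / 2))).
  by rewrite mulrBr -!e2piD subrr e2pi0 -splitr.
rewrite -mulrA; congr (_ * _).
rewrite /e2pi ReN ImN.
rewrite half_c Re_realM Im_realM /cis.
have e1 t : 2 * pi * (2^-1 * t) = pi * t by field.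
have e2 t : 2 * pi * - (2^-1 * t) = - (pi * t) by field.
rewrite !e2 !e1 cosN sinN opprK /csin /coshR /sinhR.
by rewrite natcE; apply/eqP; rewrite eq_complex /=; apply/andP; split; apply/eqP; field.
Qed.

Lemma koebe_exp_csin w : koebe_exp w = - (4 * csin w ^+ 2)^-1.
Proof.
rewrite /koebe_exp /koebe.
have e : 1 - e2pi w = - (e2pi (w / 2) * csin w * ('i * 2)) by rewrite csin_e2pi opprB.
have -> : e2pi w = e2pi (w / 2) ^+ 2 by rewrite -e2pi_natM mulrC divfK.
have <- : 1 - e2pi w = 1 - e2pi (w / 2) ^+ 2 by rewrite -e2pi_natM mulrC divfK.
rewrite e; have -> : (- (e2pi (w / 2) * csin w * ('i * 2))) ^+ 2 =
    e2pi (w / 2) ^+ 2 * - (4 * csin w ^+ 2) by rewrite sqrrN !exprMn sqr_i; ring.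
by rewrite invfM mulrA divff ?expf_neq0 ?e2pi_neq0 // mul1r invrN.
Qed.

Lemma csin_sqr w :
  cabs (csin w) ^+ 2 = sin (pi * complex.Re w) ^+ 2 + sinhR (pi * complex.Im w) ^+ 2.
Proof.
rewrite cabs_sqr /=.
have := coshR_sqr (pi * complex.Im w); have := cos2sin2 (pi * complex.Re w).
move: (sin _) (cos _) (coshR _) (sinhR _) => s c h k cE hE.
by rewrite !exprMn cE hE; ring.
Qed.

(** The square of the modulus is sin^2 (pi Re w) + sinh^2 (pi Im w), and each of
    the two terms dominates its argument. *)
Lemma csin_ge : exists2 c : R, 0 < c &
  forall w, `|complex.Re w| <= 3 / 4 -> c * cabs (pi%:C * w) <= cabs (csin w).
Proof.
have [c c0 c_le] := abs_sin_ge R; have pi0 := pi_gt0 R.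
exists (Num.min c 1); first by rewrite lt_min c0 ltr01.
move=> w le_w; set m := Num.min c 1.
have m0 : 0 < m by rewrite lt_min c0 ltr01.
rewrite -(@ler_pXn2r _ 2) ?nnegrE ?mulr_ge0 ?cabs_ge0 ?(ltW m0) //.
rewrite exprMn cabs_sqr Re_realM Im_realM csin_sqr mulrDr.
have sq (x y : R) : `|x| <= `|y| -> x ^+ 2 <= y ^+ 2.
  by rewrite -(@ler_pXn2r _ 2) ?nnegrE // !real_normK ?num_real.
apply: lerD; rewrite -exprMn; apply: sq; rewrite normrM (gtr0_norm m0).
  have /c_le : `|pi * complex.Re w| <= 3 / 4 * pi.
    by rewrite normrM (gtr0_norm pi0) mulrC ler_wpM2r // ltW.
  by apply: le_trans; rewrite ler_wpM2r // ge_min lexx.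
apply: le_trans (abs_sinhR_ge _); rewrite ler_piMl //.
by rewrite ge_min lexx orbT.
Qed.

(** The cubic order is what makes the difference of the inverse squares of
    pi w and of its sine bounded. *)
Lemma csin_cubic (B : R) : 0 <= B -> exists2 K : R, 0 <= K &
  forall w, `|complex.Im w| <= B ->
  cabs (pi%:C * w - csin w) <= K * cabs (pi%:C * w) ^+ 3.
Proof.
move=> B0; have pi0 := pi_gt0 R; pose e := expR (pi * B).
have e0 : 0 <= e by rewrite expR_ge0.
exists (1 + e ^+ 2 + (e ^+ 2 + e)) => [|w le_w].
  by rewrite !addr_ge0 ?sqr_ge0.
set u := pi%:C * w; apply: le_trans (cabs_le_ReIm _) _.
rewrite /csin -[pi * complex.Re w]Re_realM -[pi * complex.Im w]Im_realM -/u.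
have := Re_le_cabs u; have := Im_le_cabs u.
have bB : `|complex.Im u| <= pi * B.
  by rewrite Im_realM normrM (gtr0_norm pi0) ler_pM2l.
move: (cabs u) (cabs_ge0 u) bB => U U0; case: u => a b /= bB bU aU.
have a3 : `|a| ^+ 3 <= U ^+ 3 by rewrite lerXn2r ?nnegrE.
have b3 : `|b| ^+ 3 <= U ^+ 3 by rewrite lerXn2r ?nnegrE.
have b2 : b ^+ 2 <= U ^+ 2 by rewrite -(real_normK (num_real b)) lerXn2r ?nnegrE.
have a2 : a ^+ 2 <= U ^+ 2 by rewrite -(real_normK (num_real a)) lerXn2r ?nnegrE.
rewrite mulrDl; apply: lerD.
  have -> : a - sin a * coshR b = (a - sin a) - sin a * (coshR b - 1) by ring.
  apply: le_trans (ler_normB _ _) _; rewrite mulrDl mul1r; apply: lerD.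
    exact: le_trans (abs_subsin_le a) a3.
  rewrite normrM (ger0_norm (_ : 0 <= coshR b - 1)) ?subr_ge0 ?coshR_ge1 //.
  rewrite exprS mulrCA; apply: ler_pM => //; rewrite ?subr_ge0 ?coshR_ge1 //.
    exact: le_trans (abs_sin_le a) aU.
  by apply: le_trans (coshRm1_le bB) _; rewrite ler_wpM2l ?sqr_ge0.
have -> : b - cos a * sinhR b = (b - sinhR b) + (1 - cos a) * sinhR b by ring.
apply: le_trans (ler_normD _ _) _; rewrite [_ * U ^+ 3]mulrDl; apply: lerD.
  by apply: le_trans (abs_subsinhR_le bB) _; rewrite ler_wpM2l ?sqr_ge0.
rewrite normrM (ger0_norm (onemcos_ge0 a)) exprSr mulrCA.
apply: ler_pM => //; rewrite ?onemcos_ge0 //.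
  by apply: le_trans (onemcos_le a) _; have := sqr_ge0 a; lra.
by apply: le_trans (abs_sinhR_le bB) _; rewrite ler_wpM2l.
Qed.

(** The double pole of pi^2 / sin^2(pi w) at the origin has principal part
    w^-2, so that the difference stays bounded on the strip. *)
Lemma koebe_exp_pole_bound (B : R) : 0 <= B -> exists2 K : R, 0 <= K &
  forall w, `|complex.Re w| <= 3 / 4 -> `|complex.Im w| <= B ->
  cabs (4 * (pi%:C) ^+ 2 * koebe_exp w + w ^- 2) <= K.
Proof.
move=> B0; have pi0 := pi_gt0 R.
have [c c0 c_le] := csin_ge; have [K K0 K_le] := csin_cubic B0.
pose U : R := pi * (3 / 4 + B).
have U0 : 0 <= U by rewrite mulr_ge0 //; lra.
pose M := pi ^+ 2 * (K * (2 + K * U ^+ 2)) / (c ^+ 2).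
have M0 : 0 <= M.
  apply: divr_ge0; last exact: sqr_ge0.
  apply: mulr_ge0; first exact: sqr_ge0.
  apply: mulr_ge0 => //; apply: addr_ge0 => //; apply: mulr_ge0 => //.
  exact: sqr_ge0.
exists M => // w re im.
have [->|w0] := eqVneq w 0; first by rewrite koebe_exp0 expr0n /= invr0 mulr0 addr0 cabs0.
have pic0 : pi%:C != 0 :> C by rewrite -cabs_gt0 cabs_real normr_gt0 gt_eqF.
set u := pi%:C * w.
have u0 : u != 0 by rewrite mulf_neq0.
have au : 0 < cabs u by rewrite cabs_gt0.
have s_ge := c_le w re; rewrite -/u in s_ge.
have as0 : 0 < cabs (csin w) by apply: lt_le_trans s_ge; rewrite mulr_gt0.
have s0 : csin w != 0 by rewrite -cabs_gt0.
have us := K_le w im; rewrite -/u in us.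
have uU : cabs u <= U.
  apply: le_trans (cabs_le_ReIm _) _; rewrite Re_realM Im_realM !normrM (gtr0_norm pi0).
  by rewrite -mulrDr ler_pM2l //; lra.
have -> : 4 * pi%:C ^+ 2 * koebe_exp w + w ^- 2 =
    - (pi%:C ^+ 2 * ((u - csin w) * (2 * u - (u - csin w))) / (csin w ^+ 2 * u ^+ 2)).
  rewrite koebe_exp_csin /u; move: (csin w) (pi%:C) s0 pic0 => s p s0 p0.
  by field; rewrite s0 w0 p0.
rewrite cabsN !cabsM cabsV cabsM !cabsX cabs_real (gtr0_norm pi0).
have h2 : cabs (2 * u - (u - csin w)) <= (2 + K * U ^+ 2) * cabs u.
  apply: le_trans (cabsD _ _) _; rewrite cabsN cabsM cabs_nat [(2 + K * U ^+ 2) * cabs u]mulrDl lerD2l.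
  apply: le_trans us _; rewrite exprSr mulrA ler_wpM2r ?cabs_ge0 // ler_wpM2l //.
  by rewrite lerXn2r ?nnegrE // ltW.
rewrite ler_pdivrMr ?mulr_gt0 ?exprn_gt0 //.
have : cabs (u - csin w) * cabs (2 * u - (u - csin w)) <=
   K * cabs u ^+ 3 * ((2 + K * U ^+ 2) * cabs u) by apply: ler_pM; rewrite ?cabs_ge0.
have : c ^+ 2 * cabs u ^+ 2 <= cabs (csin w) ^+ 2.
  by rewrite -exprMn lerXn2r ?nnegrE ?mulr_ge0 ?cabs_ge0 // ltW.
set x := cabs (u - _) * _; set y := cabs u in au *; set q := cabs (csin w) ^+ 2.
move=> hq hx; apply: (@le_trans _ _ (pi ^+ 2 * (K * y ^+ 3 * ((2 + K * U ^+ 2) * y)))).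
  by rewrite ler_wpM2l ?sqr_ge0.
have -> : pi ^+ 2 * (K * y ^+ 3 * ((2 + K * U ^+ 2) * y)) = M * (c ^+ 2 * y ^+ 2 * y ^+ 2).
  by rewrite /M; field; rewrite gt_eqF.
by rewrite ler_wpM2l // ler_wpM2r ?sqr_ge0.
Qed.

End Exponential.

(** * Lipschitz' formula *)

Section Lipschitz.
Variable R : realType.
Local Notation C := R[i].
Implicit Types (z w v : C).

Lemma symm_sum (V : nmodType) (F : int -> V) (N : nat) :
  \sum_(m < (2 * N).+1) F (m%:Z - N%:Z) =
  F 0 + \sum_(m < N) (F m.+1%:Z + F (- m.+1%:Z)).
Proof.
elim: N => [|N IH]; first by rewrite muln0 big_ord1 big_ord0 !addr0.
rewrite big_ord_recr /= [in RHS]big_ord_recr /= addrA -IH.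
have -> : (2 * N.+1 = (2 * N).+2)%N by lia.
rewrite big_ord_recl /=.
have -> : (0%:Z - N.+1%:Z = - N.+1%:Z)%R by rewrite sub0r.
have -> : ((2 * N).+2%:Z - N.+1%:Z = N.+1%:Z)%R by lia.
rewrite [LHS]addrC addrA [LHS]addrC; congr (_ + _).
by apply: eq_bigr => i _; congr F; rewrite /bump /=; lia.
Qed.

(** The truncations of the Lipschitz sum. The convention 0^-1 = 0 drops the
    term m = w when w is an integer, so that at w = 0 this truncates 2 zeta(2). *)
Definition lipschitz_sum (N : nat) w : C :=
  \sum_(m < (2 * N).+1) (w - (m%:Z - N%:Z)%:~R) ^- 2.

Lemma lipschitz_sumS N w : lipschitz_sum N.+1 w = lipschitz_sum N w + ((w - N.+1%:R) ^- 2 + (w + N.+1%:R) ^- 2).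
Proof.
rewrite /lipschitz_sum !(symm_sum (fun m => (w - m%:~R) ^- 2)) big_ord_recr /= addrA.
by rewrite mulrNz opprK.
Qed.

(** The value to which the truncated sums converge, up to the factor -4 pi^2. *)
Definition lipschitz_value w : C := if w == 0 then - 12^-1 else koebe_exp w.

(** The points at which the rows of the Weierstrass sum are evaluated are n tau
    and z + n tau, which all are of this kind. *)
Definition off_axis w : Prop := w = 0 \/ complex.Im w != 0.

Lemma e2pi_neq1 w (k j : nat) : off_axis w -> (k < 2 ^ j)%N ->
  (w != 0) || (k != 0)%N -> e2pi ((w + k%:R) / (2 ^ j)%:R) != 1.
Proof.
have p2 : (2 ^ j)%:R != 0 :> C by rewrite pnatr_eq0 -lt0n expn_gt0.
have p2R : (0 : R) < (2 ^ j)%:R by rewrite ltr0n expn_gt0.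
move=> [-> kj|]; rewrite ?eqxx /=.
  rewrite add0r => k0; have -> : k%:R / (2 ^ j)%:R = (k%:R / (2 ^ j)%:R : R)%:C :> C.
    by rewrite rmorphM fmorphV !rmorph_nat.
  apply: e2pi_neq1_real; apply/andP; split; first by rewrite divr_gt0 // ltr0n lt0n.
  by rewrite ltr_pdivrMr // mul1r ltr_nat.
move=> im _ _; apply: contra_neq im => /e2pi_eq1_Im.
have -> : (w + k%:R) / (2 ^ j)%:R = ((2 ^ j)%:R^-1 : R)%:C * (w + k%:R).
  by rewrite fmorphV rmorph_nat mulrC.
rewrite Im_realM ImD natcE addr0 => /eqP.
by rewrite mulf_eq0 invr_eq0 gt_eqF //= => /eqP.
Qed.

Lemma koebe_exp_split w j :
  \sum_(k < 2 ^ j.+1) koebe_exp ((w + k%:R) / (2 ^ j.+1)%:R) =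
  \sum_(k < 2 ^ j) (koebe_exp ((w + k%:R) / (2 ^ j)%:R / 2) + koebe_exp (((w + k%:R) / (2 ^ j)%:R - 1) / 2)).
Proof.
have n0 : (2 ^ j)%:R != 0 :> C by rewrite pnatr_eq0 -lt0n expn_gt0.
have -> : (2 ^ j.+1 = 2 ^ j + 2 ^ j)%N by rewrite expnS mul2n addnn.
rewrite big_split_ord /= big_split /=; congr (_ + _); apply: eq_bigr => k _.
  congr koebe_exp; rewrite natrD /=; move: ((2 ^ j)%:R) n0 => n n0.
  by rewrite -mulr2n -[n *+ 2]mulr_natr; field.
rewrite -[RHS]koebe_expD1; congr koebe_exp; rewrite !natrD /=; move: ((2 ^ j)%:R) n0 => n n0.
by rewrite -[n + n]mulr2n -[n *+ 2]mulr_natr; field.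
Qed.

(** Iterating the duplication formula. For w = 0 the formula fails at the division
    point 0 alone, where the value is 0 by convention; this is the source of the
    constants 1/12. *)
Lemma koebe_exp_division w j : off_axis w ->
  \sum_(k < 2 ^ j) koebe_exp ((w + k%:R) / (2 ^ j)%:R) =
  (4 ^ j)%:R * lipschitz_value w + (w == 0)%:R / 12.
Proof.
move=> w_off; elim: j => [|j IH].
  rewrite big_ord1 /= addr0 !expn0 divr1 mul1r /lipschitz_value.
  by case: eqP => [->|_]; [rewrite koebe_exp0 mulr1n; field|rewrite mul0r addr0].
rewrite koebe_exp_split.
have -> : (4 ^ j.+1)%:R * lipschitz_value w + (w == 0)%:R / 12 =
   4 * ((4 ^ j)%:R * lipschitz_value w + (w == 0)%:R / 12) - (w == 0)%:R / 4 :> C.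
  by rewrite expnS natrM; field.
rewrite -IH mulr_sumr.
have [w0|w0] := eqVneq w 0; last first.
  rewrite mul0r subr0; apply: eq_bigr => k _.
  by apply: koebe_exp_dup; apply: e2pi_neq1 => //; rewrite w0.
have p0 : (0 < 2 ^ j)%N by rewrite expn_gt0.
rewrite (bigD1 (Ordinal p0)) //= [in RHS](bigD1 (Ordinal p0)) //= w0 addr0 mul0r.
rewrite koebe_exp_mhalf mul0r koebe_exp0 add0r mulr0 add0r mul1r addrC; congr (_ - _).
apply: eq_bigr => k k0; apply: koebe_exp_dup; apply: e2pi_neq1 => //; first by left.
by rewrite orbC -(inj_eq val_inj) in k0 *; rewrite k0.
Qed.

(** The representatives -n <= k < n of the residues modulo 2 n keep the division
    points near the pole at the origin, and form a symmetric range up to one end. *)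
Lemma lipschitz_division w (n : nat) :
  \sum_(k < n) ((w + k%:R) ^- 2 + (w + k%:R - n%:R) ^- 2) = lipschitz_sum n w - (w + n%:R) ^- 2.
Proof.
rewrite /lipschitz_sum (symm_sum (fun m => (w - m%:~R) ^- 2)).
rewrite mulr0z subr0 !big_split /=.
have -> : \sum_(k < n) (w + k%:R - n%:R) ^- 2 = \sum_(k < n) (w - k.+1%:R) ^- 2.
  rewrite (reindex_inj rev_ord_inj) /=; apply: eq_bigr => k _; congr (_ ^- 2).
  by rewrite natrB // -addrA; congr (w + _); ring.
have : \sum_(k < n.+1) (w + k%:R) ^- 2 = \sum_(k < n.+1) (w + k%:R) ^- 2 by [].
rewrite {1}big_ord_recr big_ord_recl /= addr0 => h.
apply: (addIr ((w + n%:R) ^- 2)); rewrite subrK addrAC h -addrA; congr (_ + _).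
rewrite addrC; congr (_ + _); apply: eq_bigr => k _.
by rewrite mulrNz opprK.
Qed.

End Lipschitz.

Section LipschitzLimit.
Variable R : realType.
Local Notation C := R[i].
Implicit Types (z w v : C).

Lemma cvg_div_nat (c : R) : (fun n : nat => c / n%:R) @ \oo --> (0 : R).
Proof.
have : (fun n : nat => c * n.+1%:R^-1) @ \oo --> c * (0 : R).
  by apply: cvgMr; exact: (@cvg_harmonic R).
by rewrite mulr0 -(cvg_shiftS (fun n : nat => c / n%:R)).
Qed.

Lemma invsq_shift_le w (m : nat) : (0 < m)%N -> 2 * cabs w <= m%:R ->
  cabs ((w + m%:R) ^- 2) <= 4 / m%:R ^+ 2.
Proof.
move=> m0 wm; have mR : (0 : R) < m%:R by rewrite ltr0n.
have h : m%:R / 2 <= cabs (w + m%:R).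
  have : cabs (m%:R : C) <= cabs (w + m%:R) + cabs (- w).
    by rewrite -{1}[m%:R](addKr w) addrC cabsD.
  rewrite cabs_nat cabsN; lra.
rewrite cabsV cabsX -[4 / _]invf_div lef_pV2 ?posrE ?exprn_gt0 ?divr_gt0 ?exprn_gt0 //.
  have -> : m%:R ^+ 2 / 4 = (m%:R / 2) ^+ 2 :> R by field.
  by rewrite lerXn2r // nnegrE ?cabs_ge0 // divr_ge0.
by apply: lt_le_trans h; rewrite divr_gt0.
Qed.

Lemma lipschitz_tail w (N M : nat) : (0 < N)%N -> 2 * cabs w <= N%:R -> (N <= M)%N ->
  cabs (lipschitz_sum M w - lipschitz_sum N w) <= 8 / N%:R - 8 / M%:R.
Proof.
move=> N0 wN; elim: M => [|M IH]; first by rewrite leqn0 => /eqP N1; rewrite N1 in N0.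
rewrite leq_eqVlt => /orP[/eqP <-|]; first by rewrite !subrr cabs0.
rewrite ltnS => NM; rewrite lipschitz_sumS addrAC.
apply: le_trans (cabsD _ _) _; apply: le_trans (lerD (IH NM) (cabsD _ _)) _.
have NMR : N%:R <= M.+1%:R :> R by rewrite ler_nat leqW.
have h1 := @invsq_shift_le w M.+1 isT (le_trans wN NMR).
have h2 : cabs ((w - M.+1%:R) ^- 2) <= 4 / M.+1%:R ^+ 2.
  rewrite -sqrrN opprB addrC; apply: invsq_shift_le => //.
  by rewrite cabsN; exact: le_trans NMR.
have M0 : (0 : R) < M%:R by rewrite ltr0n; exact: leq_trans NM.
have M1 : (0 : R) < M.+1%:R by rewrite ltr0n.
have : 8 / M.+1%:R ^+ 2 <= 8 / M%:R - 8 / M.+1%:R :> R.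
  have -> : 8 / M%:R - 8 / M.+1%:R = 8 / (M%:R * M.+1%:R) :> R.
    by rewrite -natr1; field; rewrite !lt0r_neq0 // addr_gt0.
  rewrite ler_pM2l // lef_pV2 ?posrE ?mulr_gt0 ?exprn_gt0 // expr2.
  by rewrite ler_pM2r // ler_nat.
move: h1 h2; move: (cabs ((w - M.+1%:R) ^- 2)) (cabs ((w + M.+1%:R) ^- 2)) => a b.
move: (8 / M%:R) (8 / M.+1%:R) (8 / N%:R) (M.+1%:R ^+ 2)^-1 => p q r s; lra.
Qed.

(** At each of the 2 n division points, n = 2^j, the function is replaced by its
    principal part at the cost of a bounded error; as the sum is normalised by
    4 n^2, the total error is O(1/n). *)
Lemma lipschitz_dyadic w : off_axis w -> exists K : R, forall j : nat,
  2 * cabs w <= (2 ^ j)%:R ->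
  cabs (lipschitz_sum (2 ^ j) w + 4 * pi%:C ^+ 2 * lipschitz_value w) <= K / (2 ^ j)%:R.
Proof.
move=> w_off; have [K K0 K_le] := koebe_exp_pole_bound (cabs_ge0 w).
exists (K / 2 + 4 + pi ^+ 2) => j wj.
have p0 : (0 < 2 ^ j)%N by rewrite expn_gt0.
have := koebe_exp_division j.+1 w_off; rewrite koebe_exp_split.
have -> : (4 ^ j.+1)%:R = 4 * (2 ^ j)%:R ^+ 2 :> C.
  by rewrite expnS natrM -natrX -expnM mulnC expnM.
move: (2 ^ j)%N p0 wj => n p0 wj.
have nR : (0 : R) < n%:R by rewrite ltr0n.
have n1 : (1 : R) <= n%:R by rewrite ler1n.
have n0 : n%:R != 0 :> C by rewrite pnatr_eq0 -lt0n.
set c : C := 4 * pi%:C ^+ 2; set V := lipschitz_value w => sumE.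
have b_le : 2 * `|complex.Re w| <= n%:R.
  by apply: le_trans wj; rewrite ler_pM2l // Re_le_cabs.
have n_inv x : x / n%:R = (n%:R^-1 : R)%:C * x :> C by rewrite fmorphV rmorph_nat mulrC.
have term (k : 'I_n) :
  cabs (c * (koebe_exp ((w + k%:R) / n%:R / 2) + koebe_exp (((w + k%:R) / n%:R - 1) / 2)) +
    4 * n%:R ^+ 2 * ((w + k%:R) ^- 2 + (w + k%:R - n%:R) ^- 2)) <= 2 * K.
  have bound (b : C) : `|complex.Re b| <= n%:R -> complex.Im b = 0 ->
      cabs (c * koebe_exp ((w + b) / n%:R / 2) + 4 * n%:R ^+ 2 * (w + b) ^- 2) <= K.
    move=> re_b im_b.
    have -> : 4 * n%:R ^+ 2 * (w + b) ^- 2 = ((w + b) / n%:R / 2) ^- 2.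
      rewrite -[_ / n%:R / 2]mulrA -invfM [in RHS]exprMn exprVn [in RHS]invfM [in RHS]invrK mulrC.
      by congr (_ * _); ring.
    have e : (w + b) / n%:R / 2 = ((2 * n%:R)^-1 : R)%:C * (w + b).
      by rewrite half_c n_inv mulrA -rmorphM invfM.
    have i0 : 0 < (2 * n%:R)^-1 :> R by rewrite invr_gt0 mulr_gt0.
    apply: K_le; rewrite e ?Re_realM ?Im_realM normrM (gtr0_norm i0) mulrC ler_pdivrMr ?mulr_gt0 //.
      rewrite ReD; apply: le_trans (ler_normD _ _) _; lra.
    rewrite ImD im_b addr0; apply: le_trans (Im_le_cabs _) _.
    by rewrite ler_peMr ?cabs_ge0 //; lra.
  have kn : k%:R <= n%:R :> R by rewrite ler_nat ltnW.
  have b1 := bound k%:R; have b2 := bound (k%:R - n%:R).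
  have -> : ((w + k%:R) / n%:R - 1) / 2 = (w + (k%:R - n%:R)) / n%:R / 2.
    by congr (_ / 2); rewrite addrA [RHS]mulrBl divff.
  rewrite -[w + k%:R - n%:R]addrA.
  rewrite [_ * (_ + _)]mulrDr [4 * _ * (_ + _)]mulrDr addrACA.
  apply: le_trans (cabsD _ _) _; have -> : 2 * K = K + K by ring.
  apply: lerD.
    by apply: b1; rewrite natcE //= ger0_norm.
  apply: b2; rewrite !natcE ?ReD ?ImD ?ReN ?ImN /= ?subrr //.
  by rewrite ler0_norm ?subr_le0 // opprB lerBlDr lerDl.
have := cabs_sum (index_enum 'I_n) xpredT (fun k : 'I_n =>
   c * (koebe_exp ((w + k%:R) / n%:R / 2) + koebe_exp (((w + k%:R) / n%:R - 1) / 2)) +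
    4 * n%:R ^+ 2 * ((w + k%:R) ^- 2 + (w + k%:R - n%:R) ^- 2)).
rewrite big_split /= -!mulr_sumr sumE lipschitz_division => le1.
have le2 := le_trans le1 (ler_sum _ (fun k _ => term k)).
rewrite sumr_const card_ord in le2.
set X := c * _ + _ in le2.
have -> : lipschitz_sum n w + c * V = X / (4 * n%:R ^+ 2) + (w + n%:R) ^- 2 - c * ((w == 0)%:R / 12) / (4 * n%:R ^+ 2).
  rewrite /X; move: (lipschitz_sum n w) ((w + n%:R) ^- 2) ((w == 0)%:R : C) => r s t.
  by field.
have le3 : cabs ((w + n%:R) ^- 2) <= 4 / n%:R.
  apply: le_trans (invsq_shift_le p0 wj) _; rewrite ler_pM2l //.
  by rewrite lef_pV2 ?posrE ?exprn_gt0 // expr2 ler_peMr // ltW.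
have n2C : cabs (4 * n%:R ^+ 2 : C) = 4 * n%:R ^+ 2 by rewrite cabsM cabsX !cabs_nat.
have n2R : 0 < 4 * n%:R ^+ 2 :> R by rewrite mulr_gt0 ?exprn_gt0.
have le4 : cabs (X / (4 * n%:R ^+ 2)) <= K / 2 / n%:R.
  rewrite cabsM cabsV n2C ler_pdivrMr //; apply: le_trans le2 _.
  rewrite -[(2 * K) *+ n]mulr_natr; have -> // : 2 * K * n%:R = K / 2 / n%:R * (4 * n%:R ^+ 2).
  by field; rewrite gt_eqF.
have le5 : cabs (c * ((w == 0)%:R / 12) / (4 * n%:R ^+ 2)) <= pi ^+ 2 / n%:R.
  have cE : cabs c = 4 * pi ^+ 2.
    by rewrite /c cabsM cabsX cabs_nat cabs_real (gtr0_norm (pi_gt0 R)).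
  rewrite cabsM cabsV n2C ler_pdivrMr // cabsM cE cabsM cabsV !cabs_nat.
  have -> : pi ^+ 2 / n%:R * (4 * n%:R ^+ 2) = 4 * pi ^+ 2 * n%:R :> R.
    by field; rewrite gt_eqF.
  apply: ler_wpM2l; first by rewrite mulr_ge0 ?sqr_ge0.
  apply: le_trans n1.
  by case: (w == 0) => /=; lra.
apply: le_trans (cabsD _ _) _; rewrite cabsN.
apply: le_trans (lerD (cabsD _ _) le5) _.
have -> : (K / 2 + 4 + pi ^+ 2) / n%:R = K / 2 / n%:R + 4 / n%:R + pi ^+ 2 / n%:R by ring.
by rewrite lerD2r; exact: lerD.
Qed.

(** Lipschitz' formula, with Euler's value of zeta(2) as the case w = 0. *)
Lemma lipschitz_clim w : off_axis w -> clim (fun n => lipschitz_sum n w) (- (4 * pi%:C ^+ 2 * lipschitz_value w)).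
Proof.
move=> w_off; have [K K_le] := lipschitz_dyadic w_off.
have [n0 n0_le] : exists n0 : nat, 2 * cabs w <= n0%:R.
  have : 0 <= 2 * cabs w by rewrite mulr_ge0 ?cabs_ge0.
  by move=> /archi_boundP h; exists (Num.bound (2 * cabs w)); exact: ltW.
have K0 : 0 <= K.
  have h : 2 * cabs w <= (2 ^ n0)%:R.
    by apply: le_trans n0_le _; rewrite ler_nat ltnW // ltn_expl.
  have := le_trans (cabs_ge0 _) (K_le n0 h).
  by rewrite pmulr_lge0 // invr_gt0 ltr0n expn_gt0.
apply: (@clim_squeeze _ _ _ (fun n => (8 + K) / n%:R) n0.+1); last exact: cvg_div_nat.
move=> n n_ge.
have nR : (0 : R) < n%:R by rewrite ltr0n; exact: leq_trans n_ge.
have wn : 2 * cabs w <= n%:R by apply: le_trans n0_le _; rewrite ler_nat ltnW.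
have n2 : (n <= 2 ^ n)%N by rewrite ltnW // ltn_expl.
have n2R : n%:R <= (2 ^ n)%:R :> R by rewrite ler_nat.
have -> : (8 + K) / n%:R = 8 / n%:R + K / n%:R by ring.
apply: le_trans (cabs_dist _ (lipschitz_sum (2 ^ n) w) _) _; rewrite opprK.
apply: lerD.
  rewrite cabsC; apply: le_trans (lipschitz_tail _ wn n2) _; first by rewrite -(ltr0n R).
  by rewrite lerBlDr lerDl divr_ge0.
apply: le_trans (K_le n (le_trans wn n2R)) _.
by rewrite ler_wpM2l // lef_pV2 ?posrE // (lt_le_trans nR).
Qed.

End LipschitzLimit.

(** * Truncated Lambert series *)

Section Truncation.
Variable R : realType.
Local Notation C := R[i].
Implicit Types (x z w : C) (r : R).

Lemma bernoulli_le (h : R) (n : nat) : 0 <= h -> 1 + n%:R * h <= (1 + h) ^+ n.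
Proof.
move=> h0; elim: n => [|n IH]; first by rewrite mul0r addr0.
rewrite exprS; apply: le_trans (ler_wpM2l _ IH); last by rewrite addr_ge0.
rewrite -natr1; have : 0 <= n%:R * h ^+ 2 by rewrite mulr_ge0 ?sqr_ge0.
rewrite expr2 -subr_ge0; have -> // : (1 + h) * (1 + n%:R * h) - (1 + (n%:R + 1) * h) = n%:R * (h * h).
by ring.
Qed.

(** By induction on the degree: r is at most the square of s = (1 + r) / 2; one
    factor s^n absorbs a power of n and the other is left to the induction. *)
Lemma poly_geometric_cvg (a : nat) r : 0 <= r < 1 ->
  (fun n : nat => n.+1%:R ^+ a * r ^+ n) @ \oo --> (0 : R).
Proof.
elim: a r => [|a IH] r /andP[r0 r1].
  under eq_fun do rewrite expr0 mul1r.
  by apply: cvg_expr; rewrite ger0_norm.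
pose s := (1 + r) / 2.
have s0 : 0 < s by rewrite /s; lra.
have s1 : s < 1 by rewrite /s; lra.
have rs : r <= s ^+ 2.
  rewrite -subr_ge0; have -> : s ^+ 2 - r = ((1 - r) / 2) ^+ 2 by rewrite /s; field.
  exact: sqr_ge0.
pose h := s^-1 - 1.
have h0 : 0 < h by rewrite subr_gt0 invf_gt1.
pose m := Num.min 1 h.
have m0 : 0 < m by rewrite lt_min ltr01.
have bound n : n.+1%:R * s ^+ n <= m^-1.
  rewrite -ler_pdivlMr ?exprn_gt0 // -exprVn -[s^-1](subrK 1) addrC -/h.
  rewrite -ler_pdivrMl ?invr_gt0 // invrK.
  apply: le_trans (bernoulli_le n (ltW h0)).
  have m1 : m <= 1 by rewrite ge_min lexx.
  have mh : m <= h by rewrite ge_min lexx orbT.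
  rewrite -natr1 mulrDr mulr1 addrC mulrC; apply: lerD => //.
  by rewrite ler_wpM2l.
apply: (@squeeze_cvgr _ _ _ _ (fun=> 0) (fun n => m^-1 * (n.+1%:R ^+ a * s ^+ n))).
- near=> n; apply/andP; split; first by rewrite mulr_ge0 ?exprn_ge0.
  apply: (@le_trans _ _ (n.+1%:R ^+ a.+1 * (s ^+ 2) ^+ n)).
    by rewrite ler_wpM2l ?exprn_ge0 // lerXn2r ?nnegrE // ?sqr_ge0.
  rewrite exprS -exprM mul2n -addnn exprD.
  have -> : n.+1%:R * n.+1%:R ^+ a * (s ^+ n * s ^+ n) =
    (n.+1%:R * s ^+ n) * (n.+1%:R ^+ a * s ^+ n) by ring.
  by rewrite ler_wpM2r // mulr_ge0 ?exprn_ge0 // ltW.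
- exact: cvg_cst.
- rewrite -[X in _ --> X](mulr0 m^-1); apply: cvgMr; apply: IH.
  by rewrite s1 ltW.
Unshelve. all: by end_near. Qed.

Definition koebe_trunc (N : nat) x : C := \sum_(k < N) k.+1%:R * x ^+ k.+1.

Lemma koebe_truncE N x : (1 - x) ^+ 2 * koebe_trunc N x =
  x - x ^+ N.+1 * (N.+1%:R - N%:R * x).
Proof.
elim: N => [|N IH]; first by rewrite /koebe_trunc big_ord0; ring.
rewrite /koebe_trunc big_ord_recr /= mulrDr IH -!natr1 !exprS; ring.
Qed.

Lemma koebe_trunc_le N x r : cabs x <= r -> r < 1 ->
  cabs (koebe x - koebe_trunc N x) <= 2 * N.+1%:R * r ^+ N.+1 / (1 - r) ^+ 2.
Proof.
move=> xr r1; have r0 := le_trans (cabs_ge0 x) xr.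
have d_ge : 1 - r <= cabs (1 - x).
  have : cabs (1 : C) <= cabs (1 - x) + cabs x by rewrite -{1}(subrK x 1) cabsD.
  rewrite cabs1; lra.
have d0 : 0 < cabs (1 - x) by apply: lt_le_trans d_ge; rewrite subr_gt0.
have dx : 1 - x != 0 by rewrite -cabs_gt0.
have -> : koebe x - koebe_trunc N x = x ^+ N.+1 * (N.+1%:R - N%:R * x) / (1 - x) ^+ 2.
  apply: (mulfI (expf_neq0 2 dx)); rewrite mulrBr koebe_truncE /koebe mulrCA divff ?expf_neq0 //.
  by rewrite [RHS]mulrCA divff ?expf_neq0 // !mulr1 opprB addrC subrK.
rewrite cabsM cabsV cabsM !cabsX; apply: ler_pM.
- by rewrite mulr_ge0 ?exprn_ge0 ?cabs_ge0.
- by rewrite invr_ge0 exprn_ge0 ?cabs_ge0.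
- rewrite mulrC; apply: ler_pM; rewrite ?exprn_ge0 ?cabs_ge0 //.
    apply: le_trans (cabsD _ _) _; rewrite cabsN cabsM !cabs_nat.
    have : N%:R * cabs x <= N.+1%:R * 1.
      by apply: ler_pM; rewrite ?cabs_ge0 ?ler_nat // ltW // (le_lt_trans xr).
    lra.
  by rewrite lerXn2r ?nnegrE ?cabs_ge0.
- rewrite lef_pV2 ?posrE ?exprn_gt0 ?subr_gt0 //.
  by rewrite lerXn2r ?nnegrE ?subr_ge0 ?cabs_ge0 // ltW.
Qed.

Lemma koebe_le x r : cabs x <= r -> r < 1 -> cabs (koebe x) <= 2 * r / (1 - r) ^+ 2.
Proof.
move=> xr r1; have := koebe_trunc_le 0 xr r1.
by rewrite /koebe_trunc big_ord0 subr0 mulr1 expr1.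
Qed.

(** Each divisor b of d is counted together with its cofactor a. *)
Lemma sigma1_pairs (N d : nat) : (0 < d <= N)%N ->
  sigma1 d = (\sum_(a < N) \sum_(b < N | a.+1 * b.+1 == d) b.+1)%N.
Proof.
move=> /andP[d0 dN].
have -> : sigma1 d = (\sum_(b < N | b.+1 %| d) b.+1)%N.
  rewrite /sigma1 -(big_mkord (fun b => (b.+1 %| d)%N) (fun b => b.+1)).
  rewrite -(big_map S (fun m => (m %| d)%N) id) -[RHS]big_filter.
  apply: perm_big; apply: uniq_perm; first exact: divisors_uniq.
    by rewrite filter_uniq // map_inj_uniq ?iota_uniq // => i j [].
  move=> m; rewrite -dvdn_divisors // mem_filter; case: (boolP (m %| d)%N) => //= md.
  symmetry; apply/mapP; exists m.-1; last by rewrite prednK // (dvdn_gt0 d0).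
  by rewrite mem_index_iota prednK ?(dvdn_gt0 d0) //= (leq_trans (dvdn_leq d0 md)).
rewrite (exchange_big_dep predT) //= big_mkcond; apply: eq_bigr => b _.
rewrite sum_nat_const; case: ifP => [bd|bd].
  have q0 : (0 < d %/ b.+1)%N by rewrite divn_gt0 // dvdn_leq.
  have qN : ((d %/ b.+1).-1 < N)%N.
    by rewrite prednK //; apply: leq_trans dN; exact: leq_div.
  rewrite (@fintype.eq_card1 _ (Ordinal qN)) ?mul1n // => a; rewrite !inE -val_eqE /=.
  apply/eqP/eqP => [<-|->]; first by rewrite mulnK.
  by rewrite prednK // divnK.
rewrite fintype.eq_card0 // => a; rewrite !inE; apply/negP => /eqP e.
by rewrite -e dvdn_mull in bd.
Qed.

(** The two sums are those of b x^(a b) over a b <= N and over a, b <= N. *)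
Lemma eisenstein_box (N : nat) x : cabs x <= 1 ->
  cabs (\sum_(1 <= d < N.+1) (sigma1 d)%:R * x ^+ d - \sum_(a < N) koebe_trunc N (x ^+ a.+1))
  <= N%:R ^+ 3 * cabs x ^+ N.
Proof.
move=> x1.
have -> : \sum_(1 <= d < N.+1) (sigma1 d)%:R * x ^+ d =
    \sum_(a < N) \sum_(b < N | (a.+1 * b.+1 <= N)%N) b.+1%:R * x ^+ (a.+1 * b.+1)%N.
  transitivity (\sum_(d < N) \sum_(a < N) \sum_(b < N | (a.+1 * b.+1 == d.+1)%N)
     b.+1%:R * x ^+ (a.+1 * b.+1)%N).
    rewrite big_add1 /= big_mkord; apply: eq_bigr => d _.
    rewrite (@sigma1_pairs N) ?ltn_ord // natr_sum mulr_suml; apply: eq_bigr => a _.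
    rewrite natr_sum mulr_suml; apply: eq_bigr => b /eqP ->.
    by [].
  rewrite exchange_big /=; apply: eq_bigr => a _.
  rewrite (exchange_big_dep (fun b : 'I_N => (a.+1 * b.+1 <= N)%N)) /=; last first.
    by move=> d b _ /eqP ->; exact: ltn_ord.
  apply: eq_bigr => b abN; by rewrite (big_pred1 (Ordinal abN)).
have -> : \sum_(a < N) koebe_trunc N (x ^+ a.+1) =
    \sum_(a < N) \sum_(b < N) b.+1%:R * x ^+ (a.+1 * b.+1)%N.
  by apply: eq_bigr => a _; apply: eq_bigr => b _; rewrite -exprM.
rewrite -sumrB; apply: le_trans (cabs_sum _ _ _) _.
have -> : N%:R ^+ 3 * cabs x ^+ N = \sum_(a < N) N%:R ^+ 2 * cabs x ^+ N.
  by rewrite sumr_const card_ord -mulr_natl; ring.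
apply: ler_sum => a _.
rewrite [X in _ - X](bigID (fun b : 'I_N => (a.+1 * b.+1 <= N)%N)) /= opprD addrA subrr add0r cabsN.
apply: le_trans (cabs_sum _ _ _) _.
have -> : N%:R ^+ 2 * cabs x ^+ N = \sum_(b < N) N%:R * cabs x ^+ N.
  by rewrite sumr_const card_ord -mulr_natl; ring.
rewrite [leLHS]big_mkcond; apply: ler_sum => b _; case: ifP => [ab|_]; last first.
  by rewrite mulr_ge0 ?exprn_ge0 ?cabs_ge0.
rewrite cabsM cabs_nat cabsX; apply: ler_pM; rewrite ?exprn_ge0 ?cabs_ge0 ?ler_nat //.
by apply: ler_wiXn2l; rewrite ?cabs_ge0 // ltnW // ltnNge.
Qed.

End Truncation.

(** * The Weierstrass function as a sum over boxes *)

Section WeierstrassBox.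
Variable R : realType.
Local Notation C := R[i].
Implicit Types (z v x tau : C).

Lemma invsq_diff_le z x : x != 0 -> 2 * cabs z <= cabs x ->
  cabs ((z + x) ^- 2 - x ^- 2) <= 10 * cabs z / cabs x ^+ 3.
Proof.
move=> x0 zx; have ax : 0 < cabs x by rewrite cabs_gt0.
have zx_ge : cabs x / 2 <= cabs (z + x).
  have : cabs x <= cabs (z + x) + cabs (- z) by rewrite -{1}[x](addKr z) addrC cabsD.
  rewrite cabsN; lra.
have azx : 0 < cabs (z + x) by apply: lt_le_trans zx_ge; rewrite divr_gt0.
have zx0 : z + x != 0 by rewrite -cabs_gt0.
have -> : (z + x) ^- 2 - x ^- 2 = - (z * (2 * x + z)) / ((z + x) ^+ 2 * x ^+ 2).
  by field; rewrite x0.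
have num : cabs (- (z * (2 * x + z))) <= cabs z * (5 / 2 * cabs x).
  rewrite cabsN cabsM ler_wpM2l ?cabs_ge0 //; apply: le_trans (cabsD _ _) _.
  rewrite cabsM cabs_nat; lra.
have den : (cabs x / 2) ^+ 2 * cabs x ^+ 2 <= cabs ((z + x) ^+ 2 * x ^+ 2).
  rewrite cabsM !cabsX ler_wpM2r ?exprn_ge0 ?cabs_ge0 //.
  by rewrite lerXn2r ?nnegrE ?cabs_ge0 // divr_ge0 ?cabs_ge0.
rewrite cabsM cabsV; apply: le_trans (_ : cabs z * (5 / 2 * cabs x) / ((cabs x / 2) ^+ 2 * cabs x ^+ 2) <= _).
  apply: ler_pM => //; rewrite ?invr_ge0 ?cabs_ge0 // lef_pV2 ?posrE //.
    by rewrite cabs_gt0 mulf_neq0 ?expf_neq0.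
  by rewrite mulr_gt0 ?exprn_gt0 ?divr_gt0.
by rewrite le_eqVlt; apply/orP; left; apply/eqP; field; rewrite gt_eqF.
Qed.

(** The left-hand side is the modulus of the imaginary part of the product of
    s tau + t with the conjugate of tau. *)
Lemma line_dist_ge tau (s t : R) :
  `|t| * `|complex.Im tau| <= cabs (s%:C * tau + t%:C) * cabs tau.
Proof.
have -> : cabs tau = cabs (tau^*)%C by rewrite !cabs_sqrt; case: tau => a b /=; rewrite sqrrN.
rewrite -cabsM; apply: le_trans (Im_le_cabs _).
case: tau => a b /=; rewrite -normrM -[leLHS]normrN le_eqVlt; apply/orP; left.
by apply/eqP; congr (`|_|); ring.
Qed.

Section Lattice.
Variables (tau z : C).
Hypothesis tau_gt0 : 0 < complex.Im tau.

Definition lipschitz_diff (N : nat) v : C := lipschitz_sum N (z + v) - lipschitz_sum N v.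

(** Differences of inverse squares decay like cubes, and the distance from a
    point of the line R tau to an integer m is at least proportional to |m|:
    the bound is uniform in s. *)
Lemma lipschitz_diff_tail : exists2 K : R, 0 <= K & exists n0 : nat, forall (s : R) (N M : nat),
  (n0 < N <= M)%N ->
  cabs (lipschitz_diff N (s%:C * tau) - lipschitz_diff M (s%:C * tau)) <= K / N%:R ^+ 2.
Proof.
have at0 : 0 < cabs tau by apply: lt_le_trans (Im_le_cabs _); rewrite normr_gt0 gt_eqF.
pose c := complex.Im tau / cabs tau.
have c0 : 0 < c by rewrite divr_gt0.
have [n0 n0_le] : exists n0 : nat, 2 * cabs z / c <= n0%:R.
  have : 0 <= 2 * cabs z / c.
    by apply: divr_ge0; [rewrite mulr_ge0 ?cabs_ge0|exact: ltW].
  by move=> /archi_boundP h; exists (Num.bound (2 * cabs z / c)); exact: ltW.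
pose K := 20 * cabs z / c ^+ 3.
have K0 : 0 <= K.
  by apply: divr_ge0; [rewrite mulr_ge0 ?cabs_ge0|rewrite exprn_ge0 // ltW].
exists K => //; exists n0 => s N M /andP[nN].
set v := s%:C * tau.
have dist (t : R) : c * `|t| <= cabs (v + t%:C).
  rewrite /c mulrAC ler_pdivrMr // mulrC; have := line_dist_ge tau s t.
  by rewrite (gtr0_norm tau_gt0).
have step (n : nat) (t : R) : (n0 <= n)%N -> `|t| = n.+1%:R ->
    cabs ((z + (v + t%:C)) ^- 2 - (v + t%:C) ^- 2) <= K / 2 / n.+1%:R ^+ 3.
  move=> n0n tE; have nR : (0 : R) < n.+1%:R by rewrite ltr0n.
  have xge : c * n.+1%:R <= cabs (v + t%:C) by rewrite -tE.
  have cn : 0 < c * n.+1%:R by rewrite mulr_gt0.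
  have ax : 0 < cabs (v + t%:C) by apply: lt_le_trans xge.
  apply: le_trans (invsq_diff_le _ _) _; first by rewrite -cabs_gt0.
    apply: le_trans xge; rewrite [c * _]mulrC -ler_pdivrMr //; apply: le_trans n0_le _.
    by rewrite ler_nat ltnW.
  have -> : K / 2 / n.+1%:R ^+ 3 = 10 * cabs z / (c * n.+1%:R) ^+ 3.
    by rewrite /K; field; rewrite !lt0r_neq0.
  rewrite ler_wpM2l ?mulr_ge0 ?cabs_ge0 // lef_pV2 ?posrE ?exprn_gt0 //.
  by rewrite lerXn2r ?nnegrE ?(ltW cn) ?cabs_ge0.
suff h : (N <= M)%N -> cabs (lipschitz_diff N v - lipschitz_diff M v) <= K / N%:R ^+ 2 - K / M%:R ^+ 2.
  move=> NM; apply: le_trans (h NM) _; rewrite lerBlDr lerDl.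
  by rewrite divr_ge0 ?exprn_ge0.
elim: M => [|M IH]; first by rewrite leqn0 => /eqP N0; rewrite N0 in nN.
rewrite leq_eqVlt => /orP[/eqP <-|]; first by rewrite !subrr cabs0.
rewrite ltnS => NM.
have -> : lipschitz_diff N v - lipschitz_diff M.+1 v = (lipschitz_diff N v - lipschitz_diff M v) -
   (((z + (v + (- M.+1%:R)%:C)) ^- 2 - (v + (- M.+1%:R)%:C) ^- 2) +
    ((z + (v + (M.+1%:R)%:C)) ^- 2 - (v + (M.+1%:R)%:C) ^- 2)).
  rewrite /lipschitz_diff !lipschitz_sumS rmorphN !rmorph_nat !addrA.
  move: (lipschitz_sum N _) (lipschitz_sum N _) (lipschitz_sum M _) (lipschitz_sum M _) => a b a' b'.
  move: (_ ^- 2) (_ ^- 2) (_ ^- 2) (_ ^- 2) => p q r t; ring.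
apply: le_trans (cabsD _ _) _; rewrite cabsN.
apply: le_trans (lerD (IH NM) (cabsD _ _)) _.
have n0M : (n0 <= M)%N by apply: ltnW; exact: leq_trans NM.
have h1 := @step M (- M.+1%:R) n0M; rewrite normrN normr_nat in h1.
have h2 := @step M M.+1%:R n0M (normr_nat _ _).
have M0 : (0 : R) < M%:R by rewrite ltr0n; apply: leq_trans NM; exact: leq_trans nN.
have M1 : (0 : R) < M.+1%:R by rewrite ltr0n.
have h3 : K / M.+1%:R ^+ 3 <= K / M%:R ^+ 2 - K / M.+1%:R ^+ 2.
  rewrite -mulrBr ler_wpM2l // -subr_ge0.
  have -> : M%:R ^- 2 - M.+1%:R ^- 2 - M.+1%:R ^- 3 =
      (M%:R ^+ 2 + 3 * M%:R + 1) / (M%:R ^+ 2 * M.+1%:R ^+ 3) :> R.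
    by rewrite -natr1; field; rewrite !lt0r_neq0 // addr_gt0.
  apply: divr_ge0; last by rewrite mulr_ge0 ?exprn_ge0.
  by rewrite !addr_ge0 ?mulr_ge0 ?exprn_ge0.
have h4 : K / M.+1%:R ^+ 3 = K / 2 / M.+1%:R ^+ 3 + K / 2 / M.+1%:R ^+ 3.
  by rewrite -mulrDl -splitr.
rewrite h4 in h3; have {h1 h2} h5 := lerD (h1 erefl) h2.
apply: le_trans (_ : K / N%:R ^+ 2 - K / M%:R ^+ 2 + (K / M%:R ^+ 2 - K / M.+1%:R ^+ 2) <= _).
  by apply: lerD => //; exact: le_trans h3.
by rewrite addrA subrK.
Qed.

Definition lipschitz_diff_value v : C := - (4 * pi%:C ^+ 2) * (lipschitz_value (z + v) - lipschitz_value v).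

Lemma lipschitz_diff_lim : exists2 K : R, 0 <= K & exists n0 : nat, forall (s : R) (N : nat),
  (n0 < N)%N -> off_axis (s%:C * tau) -> off_axis (z + s%:C * tau) ->
  cabs (lipschitz_diff N (s%:C * tau) - lipschitz_diff_value (s%:C * tau)) <= K / N%:R ^+ 2.
Proof.
have [K K0 [n0 le_K]] := lipschitz_diff_tail; exists K => //; exists n0 => s N n0N o1 o2.
apply: (@clim_le _ (fun M => lipschitz_diff N (s%:C * tau) - lipschitz_diff M (s%:C * tau)) _ _ N).
  apply: climD; first exact: clim_cst.
  apply: climN; rewrite /lipschitz_diff_value mulrBr !mulNr.
  apply: climD; first exact: lipschitz_clim.
  by apply: climN; exact: lipschitz_clim.
by move=> M NM; apply: le_K; rewrite n0N.
Qed.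

(** By the convention 0^-1 = 0 the term of the origin in the right-hand side is
    z^-2, which the Weierstrass function has outside of its sum. *)
Lemma wp_box (N : nat) :
  z ^- 2 + \sum_(m < (2 * N).+1) \sum_(n < (2 * N).+1)
     wp_term tau z (m%:Z - N%:Z) (n%:Z - N%:Z) =
  \sum_(n < (2 * N).+1) lipschitz_diff N ((- (n%:Z - N%:Z)%:~R : R)%:C * tau).
Proof.
pose F (m n : int) : C := (z - (m%:~R + n%:~R * tau)) ^- 2 - (m%:~R + n%:~R * tau) ^- 2.
pose D (m n : int) : C := if (m == 0) && (n == 0) then z ^- 2 else 0.
have wpE m n : wp_term tau z m n = F m n - D m n.
  rewrite /wp_term /F /D; case: ifP => [/andP[/eqP -> /eqP ->]|]; last by rewrite subr0.
  by rewrite !mulr0z mul0r addr0 subr0 expr0n invr0 subr0 subrr.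
under eq_bigr do under eq_bigr do rewrite wpE.
under eq_bigr do rewrite sumrB.
rewrite sumrB.
have -> : \sum_(m < (2 * N).+1) \sum_(n < (2 * N).+1) D (m%:Z - N%:Z) (n%:Z - N%:Z) = z ^- 2.
  under eq_bigr do rewrite symm_sum.
  rewrite (symm_sum (fun m => D m 0 + \sum_(n < N) (D m n.+1%:Z + D m (- n.+1%:Z)))).
  rewrite big1 ?addr0 => [|n _]; last by rewrite /D !andbF addr0.
  by rewrite big1 ?addr0 // => m _; rewrite /D /= !addr0.
rewrite addrC subrK exchange_big /=; apply: eq_bigr => n _.
rewrite /lipschitz_diff /lipschitz_sum /F sumrB; congr (_ - _).
  by apply: eq_bigr => m _; congr (_ ^- 2); rewrite rmorphN rmorph_int; ring.
by apply: eq_bigr => m _; rewrite -[in LHS]sqrrN; congr (_ ^- 2); rewrite rmorphN rmorph_int; ring.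
Qed.

End Lattice.
End WeierstrassBox.

(** * The Fourier expansion of the propagator *)

Section PropagatorExpansion.
Variable R : realType.
Local Notation C := R[i].
Implicit Types (z v x tau : C).

Lemma symm_sum_opp (V : nmodType) (F : int -> V) (N : nat) :
  \sum_(m < (2 * N).+1) F (- (m%:Z - N%:Z)) = \sum_(m < (2 * N).+1) F (m%:Z - N%:Z).
Proof.
rewrite (symm_sum (fun m => F (- m))) symm_sum oppr0; congr (_ + _).
by apply: eq_bigr => m _; rewrite opprK addrC.
Qed.

Lemma koebe_geometric_le x (r : R) (n : nat) : 0 <= r -> r < 1 ->
  cabs x <= r ^+ n.+1 -> cabs (koebe x) <= 2 * r ^+ n.+1 / (1 - r) ^+ 2.
Proof.
move=> r0 r1 xr.
have rn : r ^+ n.+1 <= r by rewrite exprS ler_piMr // exprn_ile1 // ltW.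
apply: le_trans (koebe_le xr (le_lt_trans rn r1)) _.
rewrite ler_wpM2l ?mulr_ge0 ?exprn_ge0 // lef_pV2 ?posrE ?exprn_gt0 ?subr_gt0 //.
  by rewrite lerXn2r ?nnegrE ?subr_ge0 ?(le_trans rn) ?(ltW r1) // lerB.
exact: le_lt_trans rn r1.
Qed.

Lemma geometric_lim (u : nat -> C) (r K : R) : 0 <= r -> r < 1 -> 0 <= K ->
  (forall n, cabs (u n.+1 - u n) <= K * r ^+ n) ->
  exists l, forall n, cabs (u n - l) <= 2 * (K / (1 - r) * r ^+ n).
Proof.
move=> r0 r1 K0 du; have r1' : 0 < 1 - r by rewrite subr_gt0.
apply: (@complex_cauchy _ _ (fun n => K / (1 - r) * r ^+ n)).
- move=> n; apply: le_trans (du n) _; rewrite le_eqVlt; apply/orP; left; apply/eqP.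
  by rewrite exprS; field; rewrite gt_eqF.
- rewrite -[X in _ --> X](mulr0 (K / (1 - r))); apply: cvgMr.
  by apply: cvg_expr; rewrite ger0_norm.
- by move=> n; rewrite mulr_ge0 ?exprn_ge0 // divr_ge0 // ltW.
Qed.

Lemma cvg_poly_geometric (K r : R) (a : nat) : 0 <= r < 1 ->
  (fun n : nat => K * (n.+1%:R ^+ a * r ^+ n)) @ \oo --> (0 : R).
Proof.
by move=> r01; rewrite -[X in _ --> X](mulr0 K); apply: cvgMr; exact: poly_geometric_cvg.
Qed.

Section FixedLattice.
Variable tau : C.
Hypothesis tau_gt0 : 0 < complex.Im tau.
Local Notation b := (complex.Im tau).

Lemma e2pi_tau_lt1 : 0 <= cabs (e2pi tau) < 1.
Proof.
rewrite cabs_ge0 cabs_e2pi expR_lt1 oppr_lt0 mulr_gt0 // mulr_gt0 //.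
exact: pi_gt0.
Qed.

(** The Lambert series sum_n koebe_exp(n tau), and hence E_2, converges. *)
Lemma eisenstein2_lim : exists e : C,
  clim (fun N => \sum_(n < N) koebe_exp (n.+1%:R * tau)) e /\
  eisenstein2 (nome tau ^+ 2) = 1 - 24 * e.
Proof.
have /andP[r0 r1] := e2pi_tau_lt1; set r := cabs (e2pi tau) in r0 r1.
have r1' : 0 < 1 - r by rewrite subr_gt0.
have koebe_exp_le n : cabs (koebe_exp (n.+1%:R * tau)) <= 2 * r / (1 - r) ^+ 2 * r ^+ n.
  have -> : 2 * r / (1 - r) ^+ 2 * r ^+ n = 2 * r ^+ n.+1 / (1 - r) ^+ 2.
    by rewrite [r ^+ n.+1]exprS; ring.
  by apply: koebe_geometric_le => //; rewrite e2pi_natM cabsX.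
have K0 : 0 <= 2 * r / (1 - r) ^+ 2.
  by apply: divr_ge0; rewrite ?mulr_ge0 ?exprn_ge0 // ltW.
have [n|e e_le] := @geometric_lim (fun N => \sum_(n < N) koebe_exp (n.+1%:R * tau)) r _ r0 r1 K0.
  by rewrite big_ord_recr /= addrAC subrr add0r; exact: koebe_exp_le.
have lim_e : clim (fun N => \sum_(n < N) koebe_exp (n.+1%:R * tau)) e.
  apply: (@clim_squeeze _ _ _ _ 0) => [n _|]; first exact: e_le.
  rewrite -[X in _ --> X](mulr0 2); apply: cvgMr.
  rewrite -[X in _ --> X](mulr0 (2 * r / (1 - r) ^+ 2 / (1 - r))); apply: cvgMr.
  by apply: cvg_expr; rewrite ger0_norm.
exists e; split => //.
rewrite /eisenstein2 nome_sqr; congr (1 - 24 * _); apply: clim_limn.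
rewrite /clim -cvg_shiftS; apply: (clim_near lim_e).
pose d (N : nat) := 1 * (N.+1%:R ^+ 3 * r ^+ N) + 2 * r / (1 - r) ^+ 2 * (N.+1%:R ^+ 2 * r ^+ N).
apply: (@squeeze_cvgr _ _ _ _ (fun=> 0) d); [|exact: cvg_cst|]; last first.
  rewrite -[X in _ --> X](addr0 0); apply: cvgD; apply: cvg_poly_geometric; exact: e2pi_tau_lt1.
apply: nearW => N; rewrite cabs_ge0 /=.
apply: le_trans (cabs_dist _ (\sum_(a < N) koebe_trunc N (e2pi tau ^+ a.+1)) _) _.
apply: lerD.
  rewrite mul1r; apply: le_trans (eisenstein_box _ (ltW r1)) _.
  by rewrite ler_wpM2r ?exprn_ge0 // lerXn2r ?nnegrE // ler_nat.
rewrite -sumrB; apply: le_trans (cabs_sum _ _ _) _.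
have -> : 2 * r / (1 - r) ^+ 2 * (N.+1%:R ^+ 2 * r ^+ N) =
   N.+1%:R * (2 * N.+1%:R * r ^+ N.+1 / (1 - r) ^+ 2) by rewrite [r ^+ N.+1]exprS; ring.
apply: (@le_trans _ _ (\sum_(a < N) (2 * N.+1%:R * r ^+ N.+1 / (1 - r) ^+ 2))).
  apply: ler_sum => a _; rewrite cabsC /koebe_exp e2pi_natM; apply: koebe_trunc_le => //.
  by rewrite cabsX exprS ler_piMr ?cabs_ge0 // exprn_ile1 ?cabs_ge0 // ltW.
rewrite sumr_const card_ord -[_ *+ N]mulr_natl ler_wpM2r ?ler_nat //.
by apply: divr_ge0; rewrite ?mulr_ge0 ?exprn_ge0 // ltW.
Qed.

Section FixedHeight.
Variable s : R.
Hypothesis s_bound : 0 < `|s| < b.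

Definition koebe_exp_sum (N : nat) z : C := \sum_(m < (2 * N).+1) koebe_exp (z + (m%:Z - N%:Z)%:~R * tau).

(** For Im z = s, one of exp(2 pi i (z + m tau)) and its inverse is at most this
    in modulus, whatever m. *)
Definition rate : R :=
  Num.max (expR (- (2 * pi * `|s|))) (expR (- (2 * pi * (b - `|s|)))).

Lemma rate_bound : 0 <= rate < 1.
Proof.
have /andP[s0 sb] := s_bound; have pi0 := pi_gt0 R.
rewrite /rate le_max expR_ge0 gt_max !expR_lt1 !oppr_lt0 /=.
by rewrite !mulr_gt0 // subr_gt0.
Qed.

Lemma Im_shift z (m : int) : complex.Im z = s ->
  complex.Im (z + m%:~R * tau) = m%:~R * b + s.
Proof. by move=> zs; rewrite ImD intcE Im_realM zs addrC. Qed.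

Lemma shift_dist (m : int) (n : nat) : `|m| = n.+1%:Z -> n.+1%:R * (b - `|s|) <= `|m%:~R * b + s|.
Proof.
move=> mn; have /andP[s0 sb] := s_bound.
have : `|m%:~R * b| <= `|m%:~R * b + s| + `|- s|.
  by apply: le_trans (ler_normD _ _); rewrite addrK.
rewrite normrN normrM -intr_norm mn (gtr0_norm tau_gt0).
have : 0 <= n%:R * `|s| by rewrite mulr_ge0.
rewrite -[n.+1%:~R]/(n.+1%:R) -natr1 => h1 h2.
have -> : (n%:R + 1) * (b - `|s|) = (n%:R + 1) * b - n%:R * `|s| - `|s| by ring.
lra.
Qed.

Lemma shift_neq0 (m : int) : m%:~R * b + s != 0.
Proof.
have /andP[s0 sb] := s_bound; have [n0|n0] := eqVneq m 0.
  by rewrite n0 mul0r add0r -normr_gt0.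
rewrite -normr_gt0.
case E : `|m|%N => [|n]; first by rewrite -absz_eq0 E in n0.
apply: lt_le_trans (@shift_dist m n _); last by rewrite -E.
by rewrite mulr_gt0 // subr_gt0.
Qed.

(** Of the two points x and 1/x at which the Koebe function takes the same
    value, the one inside the unit disc. *)
Definition disc_point (c : R) v : C := if 0 < c then e2pi v else e2pi (- v).

Lemma koebe_exp_disc_point c v : koebe_exp v = koebe (disc_point c v).
Proof. by rewrite /disc_point; case: ifP => // _; rewrite -[RHS]/(koebe_exp (- v)) koebe_expN. Qed.

Lemma cabs_disc_point v : cabs (disc_point (complex.Im v) v) = expR (- (2 * pi * `|complex.Im v|)).
Proof.
rewrite /disc_point; case: ltP => h; rewrite cabs_e2pi ?ImN; first by rewrite gtr0_norm.
by rewrite ler0_norm.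
Qed.

Lemma cabs_disc_point_shift z (m : int) (n : nat) : complex.Im z = s -> `|m| = n.+1%:Z ->
  cabs (disc_point (m%:~R * b + s) (z + m%:~R * tau)) <= rate ^+ n.+1.
Proof.
move=> zs mn; rewrite -(Im_shift m zs) cabs_disc_point Im_shift //.
have r0 := expR_ge0 (- (2 * pi * (b - `|s|))).
apply: (@le_trans _ _ (expR (- (2 * pi * (b - `|s|))) ^+ n.+1)); last first.
  by rewrite lerXn2r ?nnegrE // ?(le_trans r0) // /rate le_max lexx orbT.
rewrite -expRM_natl ler_expR mulrN lerN2 mulrCA ler_wpM2l //.
  by rewrite mulr_ge0 // pi_ge0.
exact: shift_dist.
Qed.

Lemma cabs_disc_point_le z (m : int) : complex.Im z = s ->
  cabs (disc_point (m%:~R * b + s) (z + m%:~R * tau)) <= rate.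
Proof.
move=> zs; have /andP[r0 r1] := rate_bound.
case E : `|m|%N => [|n].
  have /eqP -> : m == 0 by rewrite -absz_eq0 E.
  rewrite !mul0r addr0 add0r -zs cabs_disc_point zs /rate le_max lexx //.
apply: le_trans (@cabs_disc_point_shift z m n zs _) _; first by rewrite -E.
by rewrite exprS ler_piMr // exprn_ile1 // ltW.
Qed.

Lemma koebe_exp_sum_lim : exists K : R, forall z, complex.Im z = s ->
  exists l, forall N, cabs (koebe_exp_sum N z - l) <= K * rate ^+ N.
Proof.
have /andP[r0 r1] := rate_bound; have r1' : 0 < 1 - rate by rewrite subr_gt0.
pose K0 := 4 * rate / (1 - rate) ^+ 2.
have K00 : 0 <= K0 by apply: divr_ge0; rewrite ?mulr_ge0 ?exprn_ge0 // ltW.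
exists (2 * (K0 / (1 - rate))) => z zs.
have [n|l l_le] := @geometric_lim (fun N => koebe_exp_sum N z) rate K0 r0 r1 K00.
  rewrite /koebe_exp_sum !(symm_sum (fun m => koebe_exp (z + m%:~R * tau))) big_ord_recr /=.
  rewrite addrA [_ + (_ + _)]addrC addrK.
  have -> : K0 * rate ^+ n = 2 * rate ^+ n.+1 / (1 - rate) ^+ 2 + 2 * rate ^+ n.+1 / (1 - rate) ^+ 2.
    by rewrite /K0 [rate ^+ n.+1]exprS; ring.
  apply: le_trans (cabsD _ _) _; apply: lerD.
    rewrite (koebe_exp_disc_point (n.+1%:~R * b + s)).
    by apply: koebe_geometric_le => //; exact: cabs_disc_point_shift.
  rewrite (koebe_exp_disc_point ((- n.+1%:Z)%:~R * b + s)).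
  by apply: koebe_geometric_le => //; apply: cabs_disc_point_shift; rewrite // normrN.
by exists l => N; apply: le_trans (l_le N) _; rewrite mulrA.
Qed.

Lemma off_axis_shift z (m : int) : complex.Im z = s -> off_axis (z + (m%:~R : R)%:C * tau).
Proof. by move=> zs; right; rewrite -intcE Im_shift // shift_neq0. Qed.

Lemma off_axis_period (m : int) : off_axis ((m%:~R : R)%:C * tau).
Proof.
have [->|m0] := eqVneq m 0; first by left; rewrite mul0r.
by right; rewrite Im_realM mulf_neq0 ?intr_eq0 // gt_eqF.
Qed.

(** All the corrections of the Weierstrass function, namely the terms of the
    lattice points and the value zeta(2), cancel against the Eisenstein series. *)
Lemma propagator_koebe_exp_sum z l : complex.Im z = s -> clim (fun N => koebe_exp_sum N z) l ->
  - propagator tau z = l.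
Proof.
move=> zs lim_l; have [e [lim_e E2]] := eisenstein2_lim.
have pi0 : pi%:C != 0 :> C by rewrite -cabs_gt0 cabs_real normr_gt0 gt_eqF // pi_gt0.
pose c : C := - (4 * pi%:C ^+ 2).
have W : weierstrass_p tau z = c * (l - (- 12^-1 + 2 * e)).
  rewrite /weierstrass_p; set x := c * _.
  transitivity (z ^- 2 + (- z ^- 2 + x)); last by rewrite addrA subrr add0r.
  congr (_ + _); apply: clim_limn.
  have [K K0 [n0 le_K]] := lipschitz_diff_lim z tau_gt0.
  have lim2 : clim (fun N => \sum_(n < (2 * N).+1) lipschitz_diff_value z ((- (n%:Z - N%:Z)%:~R : R)%:C * tau)) x.
    have valE N : \sum_(n < (2 * N).+1) lipschitz_diff_value z ((- (n%:Z - N%:Z)%:~R : R)%:C * tau) =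
        c * (koebe_exp_sum N z - (- 12^-1 + 2 * \sum_(n < N) koebe_exp (n.+1%:R * tau))).
      rewrite /lipschitz_diff_value -mulr_sumr sumrB; congr (_ * (_ - _)).
        rewrite /koebe_exp_sum -(symm_sum_opp (fun m => koebe_exp (z + m%:~R * tau))).
        apply: eq_bigr => m _; rewrite -mulrNz /lipschitz_value intcE; case: eqP => // z0.
        have := shift_neq0 (- (m%:Z - N%:Z)).
        by rewrite -(Im_shift _ zs) intcE z0 eqxx.
      under eq_bigr do rewrite -mulrNz.
      rewrite (symm_sum_opp (fun m => lipschitz_value ((m%:~R : R)%:C * tau))).
      rewrite (symm_sum (fun m => lipschitz_value ((m%:~R : R)%:C * tau))) mul0r /lipschitz_value eqxx.
      congr (_ + _); rewrite mulr_sumr; apply: eq_bigr => m _.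
      have t0 (k : R) : k != 0 -> (k%:C * tau == 0) = false.
        move=> k0; apply/negbTE/eqP => /(congr1 (@complex.Im _)); rewrite Im_realM => /eqP.
        by rewrite mulf_eq0 (negbTE k0) gt_eqF.
      rewrite !t0 ?intr_eq0 //; rewrite mulrNz rmorphN mulNr koebe_expN.
      by rewrite [RHS]mulr_natl mulr2n natcE.
    under eq_fun do rewrite valE.
    apply: climZ; apply: climD => //; apply: climN; apply: climD; first exact: clim_cst.
    exact: climZ.
  have lim3 : clim (fun N => \sum_(n < (2 * N).+1) lipschitz_diff z N ((- (n%:Z - N%:Z)%:~R : R)%:C * tau)) x.
    apply: (clim_near lim2).
    apply: (@squeeze_cvgr _ _ _ _ (fun=> 0) (fun N : nat => 3 * K / N%:R)).
    - near=> N; rewrite cabs_ge0 /= -sumrB.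
      have n0N : (n0 < N)%N by near: N; exists n0.+1.
      have NR : (0 : R) < N%:R by rewrite ltr0n; exact: leq_trans n0N.
      apply: le_trans (cabs_sum _ _ _) _.
      apply: (@le_trans _ _ (\sum_(n < (2 * N).+1) (K / N%:R ^+ 2))).
        apply: ler_sum => n _; rewrite -mulrNz; apply: le_K => //.
          exact: off_axis_period.
        exact: off_axis_shift.
      rewrite sumr_const card_ord -[_ *+ _]mulr_natr mulrAC ler_pdivrMr ?exprn_gt0 //.
      have -> : 3 * K / N%:R * N%:R ^+ 2 = K * (3 * N%:R) by field; rewrite gt_eqF.
      rewrite ler_wpM2l // -natr1 natrM.
      have : (1 : R) <= N%:R by rewrite ler1n; exact: leq_trans n0N.
      lra.
    - exact: cvg_cst.
    - exact: cvg_div_nat.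
  have lim4 := climD (clim_cst (- z ^- 2)) lim3.
  rewrite /clim in lim4 *; under eq_fun do rewrite -(addKr (z ^- 2) (\sum_(m < _) _)) wp_box.
  exact: lim4.
rewrite /propagator W E2 /c; move: (pi%:C) pi0 => p p0; field.
by rewrite p0.
Unshelve. all: by end_near. Qed.

(** Truncation of the Fourier expansion of -P on the line of height Im z; the
    condition selects, for each m, the exponents k for which
    exp(2 pi i k (z + m tau)) is small. *)
Definition fourier_box (N : nat) z : C :=
  \sum_(m < (2 * N).+1) \sum_(k < (2 * N).+1)
    if 0 < (k%:Z - N%:Z)%:~R * ((m%:Z - N%:Z)%:~R * b + complex.Im z)
    then `|k%:Z - N%:Z|%:~R * e2pi ((k%:Z - N%:Z)%:~R * (z + (m%:Z - N%:Z)%:~R * tau)) else 0.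

Lemma fourier_row (N : nat) (c : R) v : c != 0 ->
  \sum_(k < (2 * N).+1) (if 0 < (k%:Z - N%:Z)%:~R * c
    then `|k%:Z - N%:Z|%:~R * e2pi ((k%:Z - N%:Z)%:~R * v) else 0) = koebe_trunc N (disc_point c v).
Proof.
move=> c0; rewrite (symm_sum (fun k : int => if 0 < k%:~R * c then `|k|%:~R * e2pi (k%:~R * v) else 0)).
rewrite mul0r ltxx add0r; apply: eq_bigr => k _.
rewrite mulrNz mulNr oppr_gt0 normrN [in X in _ + X]mulNr e2piN /disc_point.
rewrite -[k.+1%:Z%:~R]/(k.+1%:R) -[`|k.+1%:Z|%:~R]/(k.+1%:R) pmulr_rgt0 // pmulr_rlt0 //.
have -> : e2pi (k.+1%:Z%:~R * v) = e2pi v ^+ k.+1 by exact: e2pi_natM.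
case: (ltgtP c 0) c0 => // _ _; rewrite ?add0r ?addr0 //.
by rewrite e2piN exprVn.
Qed.

(** The error depends on z through its imaginary part only, hence is uniform
    along the paths of integration. *)
Lemma fourier_box_approx : exists2 d : nat -> R, d @ \oo --> (0 : R) &
  forall z, complex.Im z = s -> forall N, cabs (- propagator tau z - fourier_box N z) <= d N.
Proof.
have /andP[r0 r1] := rate_bound; have r1' : 0 < 1 - rate by rewrite subr_gt0.
have [K K_le] := koebe_exp_sum_lim.
exists (fun N => K * (N.+1%:R ^+ 0 * rate ^+ N) +
   4 * rate / (1 - rate) ^+ 2 * (N.+1%:R ^+ 2 * rate ^+ N)).
  rewrite -[X in _ --> X](addr0 0); apply: cvgD; apply: cvg_poly_geometric; exact: rate_bound.
move=> z zs N; have [l l_le] := K_le z zs.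
have -> : - propagator tau z = l.
  apply: propagator_koebe_exp_sum => //; apply: (@clim_squeeze _ _ _ _ 0) => [n _|]; first exact: l_le.
  rewrite -[X in _ --> X](mulr0 K); apply: cvgMr.
  by apply: cvg_expr; rewrite ger0_norm.
apply: le_trans (cabs_dist _ (koebe_exp_sum N z) _) _; apply: lerD.
  by rewrite cabsC expr0 mul1r.
rewrite /koebe_exp_sum /fourier_box -sumrB; apply: le_trans (cabs_sum _ _ _) _.
apply: (@le_trans _ _ (\sum_(m < (2 * N).+1) (2 * N.+1%:R * rate ^+ N.+1 / (1 - rate) ^+ 2))).
  apply: ler_sum => m _; rewrite zs fourier_row ?shift_neq0 //.
  rewrite (koebe_exp_disc_point ((m%:Z - N%:Z)%:~R * b + s)); apply: koebe_trunc_le => //.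
  exact: cabs_disc_point_le.
rewrite sumr_const card_ord -[_ *+ _]mulr_natl.
have -> : 4 * rate / (1 - rate) ^+ 2 * (N.+1%:R ^+ 2 * rate ^+ N) =
  (2 * N.+1%:R) * (2 * N.+1%:R * rate ^+ N.+1 / (1 - rate) ^+ 2) by rewrite [rate ^+ N.+1]exprS; ring.
rewrite ler_wpM2r //.
  by apply: divr_ge0; rewrite ?mulr_ge0 ?exprn_ge0 // ltW.
by rewrite -natrM ler_nat; lia.
Qed.

End FixedHeight.
End FixedLattice.
End PropagatorExpansion.

(** * Constant terms of trigonometric polynomials *)

Section TrigIntegral.
Variable R : realType.
Local Notation C := R[i].
Local Notation mu := (@lebesgue_measure R).
Local Notation "'I01' f" := (\int[mu]_(t in `[0%R, 1%R]) (f t)) (at level 10).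

Lemma cont_integrable (f : R -> R) : continuous f -> mu.-integrable `[0%R, 1%R] (EFin \o f).
Proof.
move=> cf; apply: continuous_compact_integrable; first exact: segment_compact.
exact: continuous_subspaceT.
Qed.

Lemma mu01 : fine (mu `[0%R, 1%R]%classic) = 1.
Proof. by rewrite lebesgue_measure_itv /= lte_fin ltr01 /= subr0. Qed.

Lemma I01_dist (f g : R -> R) (d : R) : continuous f -> continuous g ->
  (forall u, `|f u - g u| <= d) -> `|I01 f - I01 g| <= d.
Proof.
move=> cf cg fg; have cfg : continuous (fun u => f u - g u).
  by move=> u; apply: cvgB; [exact: cf|exact: cg].
rewrite -RintegralB //; [|exact: cont_integrable|exact: cont_integrable].
apply: le_trans (le_normr_Rintegral _ _) _ => //; first exact: cont_integrable.
have -> : d = I01 (fun=> d) by rewrite Rintegral_cst // mu01 mulr1.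
apply: le_Rintegral => //; apply: cont_integrable => u.
  by apply: cvg_norm; exact: cfg.
exact: cvg_cst.
Qed.

Lemma continuous_uniform_limit (f : R -> R) (F : nat -> R -> R) (d : nat -> R) :
  (forall N, continuous (F N)) -> d @ \oo --> (0 : R) ->
  (forall N u, `|f u - F N u| <= d N) -> continuous f.
Proof.
move=> cF d0 fF u; apply/cvgrPdist_le => e e0.
have e3 : 0 < e / 3 by rewrite divr_gt0.
move/cvgrPdist_le: d0 => /(_ _ e3) [N _ /(_ N (leqnn N)) /=].
rewrite sub0r normrN => dN; have dN' := le_trans (ler_norm _) dN.
have /cvgrPdist_le /(_ _ e3) := cF N u.
apply: filterS => v Fuv.
have -> : f u - f v = (f u - F N u) + (F N u - F N v) - (f v - F N v) by ring.
apply: le_trans (ler_normB _ _) _; apply: le_trans (lerD (ler_normD _ _) (lexx _)) _.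
have h1 := le_trans (fF N u) dN'; have h2 := le_trans (fF N v) dN'.
have -> : e = e / 3 + e / 3 + e / 3 by field.
by rewrite !lerD.
Qed.

(** The shape of the real and imaginary parts of a multiple of cis (x + k u); it
    is stable under differentiation. *)
Definition wave (A B x k u : R) : R := A * cos (2 * pi * (x + k * u)) + B * sin (2 * pi * (x + k * u)).

Lemma is_derive_wave (A B x k u : R) :
  is_derive u 1 (wave A B x k) (wave (2 * pi * k * B) (- (2 * pi * k * A)) x k u).
Proof.
have d1 : is_derive u 1 (fun t : R => 2 * pi * (x + k * t)) (2 * pi * k).
  have : is_derive u 1 (fun t : R => (2 * pi * x) + (2 * pi * k) *: t) (0 + (2 * pi * k) *: (1 : R)).
    by apply: is_deriveD.
  rewrite add0r /GRing.scale /= mulr1; congr is_derive.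
  by apply/funext => t /=; rewrite /GRing.scale /=; ring.
pose l (t : R) : R := 2 * pi * (x + k * t).
have dc := @is_derive1_comp _ cos l u _ _ (is_derive_cos (l u)) d1.
have ds := @is_derive1_comp _ sin l u _ _ (is_derive_sin (l u)) d1.
have := is_deriveD (is_deriveZ A dc) (is_deriveZ B ds).
congr is_derive; rewrite /wave /GRing.scale /= /l; ring.
Qed.

Lemma continuous_wave (A B x k : R) : continuous (wave A B x k).
Proof.
move=> u; apply: differentiable_continuous; apply/derivable1_diffP.
by have := is_derive_wave A B x k u => ?; exact: ex_derive.
Qed.

Lemma cis_int (m : int) : cis (m%:~R : R) = 1.
Proof.
have n1 (n : nat) : cis (n%:R : R) = 1 by rewrite -[n%:R]mulr1 -cisX cis1 expr1n.
case: m => n; first exact: n1.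
rewrite NegzE mulrNz; have := cisD (n.+1%:R : R) (- n.+1%:R).
by rewrite subrr cis0 n1 mul1r => <-.
Qed.

Lemma wave_period (A B x : R) (k : int) : wave A B x k%:~R 1 = wave A B x k%:~R 0.
Proof.
rewrite /wave mulr1 mulr0 addr0; have : cis (x + k%:~R) = cis x by rewrite cisD cis_int mulr1.
by rewrite /cis => -[-> ->].
Qed.

Lemma I01_wave (A B x : R) (k : int) :
  I01 (wave A B x k%:~R) = if k == 0 then wave A B x 0 0 else 0.
Proof.
case: eqP => [->|/eqP k0].
  have -> : wave A B x 0%:~R = fun=> wave A B x 0 0.
    by apply/funext => u; rewrite /wave !mul0r.
  by rewrite Rintegral_cst // mu01 mulr1.
have pk : 2 * pi * k%:~R != 0 :> R.
  by rewrite mulf_neq0 ?intr_eq0 // mulf_neq0 // gt_eqF // pi_gt0.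
pose F : R -> R := wave (- (B / (2 * pi * k%:~R))) (A / (2 * pi * k%:~R)) x k%:~R.
rewrite /Rintegral (@continuous_FTC2 _ _ F) //.
- by rewrite /= /F wave_period subrr.
- by apply: continuous_subspaceT; exact: continuous_wave.
- split; last 2 first.
  + by apply: cvg_at_right_filter; exact: continuous_wave.
  + by apply: cvg_at_left_filter; exact: continuous_wave.
  + by move=> u _; have := is_derive_wave (- (B / (2 * pi * k%:~R))) (A / (2 * pi * k%:~R)) x k%:~R u => ?; exact: ex_derive.
- move=> u _; rewrite derive1E; have := is_derive_wave (- (B / (2 * pi * k%:~R))) (A / (2 * pi * k%:~R)) x k%:~R u => d.
  rewrite derive_val; clear F d; move: (2 * pi * k%:~R) pk => P P0.
  by congr (wave _ _ _ _ _); field.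
Qed.

Lemma Re_mul_cis (c : C) (y : R) : complex.Re (c * cis y) =
  complex.Re c * cos (2 * pi * y) + (- complex.Im c) * sin (2 * pi * y).
Proof. by case: c => a b /=; rewrite mulNr. Qed.

Lemma Im_mul_cis (c : C) (y : R) : complex.Im (c * cis y) =
  complex.Im c * cos (2 * pi * y) + complex.Re c * sin (2 * pi * y).
Proof. by case: c => a b /=; rewrite addrC. Qed.

Definition ccont (f : R -> C) : Prop :=
  continuous (fun u => complex.Re (f u)) /\ continuous (fun u => complex.Im (f u)).

Lemma ccontD f g : ccont f -> ccont g -> ccont (fun u => f u + g u).
Proof.
move=> [f1 f2] [g1 g2]; split => u; under eq_fun do rewrite ?ReD ?ImD.
  by apply: cvgD; [exact: f1|exact: g1].
by apply: cvgD; [exact: f2|exact: g2].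
Qed.

Lemma ccont_mono (c : C) (x k : R) : ccont (fun u => c * cis (x + k * u)).
Proof.
split.
  by under eq_fun do rewrite Re_mul_cis; exact: continuous_wave.
by under eq_fun do rewrite Im_mul_cis; exact: continuous_wave.
Qed.

Lemma unit_integral_mono (c : C) (x : R) (k : int) :
  unit_integral (fun u => c * cis (x + k%:~R * u)) = if k == 0 then c * cis x else 0.
Proof.
rewrite /unit_integral; under eq_Rintegral do rewrite Re_mul_cis.
under [X in _ +i* X]eq_Rintegral do rewrite Im_mul_cis.
rewrite (I01_wave (complex.Re c) (- complex.Im c) x k) (I01_wave (complex.Im c) (complex.Re c) x k).
case: eqP => // _; rewrite /wave mul0r addr0 -Re_mul_cis -Im_mul_cis.
by case: (c * cis x).
Qed.

Lemma unit_integralD f g : ccont f -> ccont g ->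
  unit_integral (fun u => f u + g u) = unit_integral f + unit_integral g.
Proof.
move=> [f1 f2] [g1 g2]; rewrite /unit_integral.
under eq_Rintegral do rewrite ReD.
under [X in _ +i* X]eq_Rintegral do rewrite ImD.
by rewrite !RintegralD //; apply: cont_integrable.
Qed.

Lemma unit_integral0 : unit_integral (fun=> 0 : C) = 0.
Proof. by rewrite /unit_integral !Rintegral_cst // mul0r. Qed.

Lemma ccont_cst (c : C) : ccont (fun=> c).
Proof. by split => u; exact: cvg_cst. Qed.

Lemma ccont_sum (I : Type) (s : seq I) (F : I -> R -> C) :
  (forall i, ccont (F i)) -> ccont (fun u => \sum_(i <- s) F i u).
Proof.
move=> cF; elim: s => [|i s IH].
  by under eq_fun do rewrite big_nil; exact: ccont_cst.
by under eq_fun do rewrite big_cons; exact: ccontD.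
Qed.

Lemma unit_integral_sum (I : Type) (s : seq I) (F : I -> R -> C) :
  (forall i, ccont (F i)) ->
  unit_integral (fun u => \sum_(i <- s) F i u) = \sum_(i <- s) unit_integral (F i).
Proof.
move=> cF; elim: s => [|i s IH].
  by under eq_fun do rewrite big_nil; rewrite big_nil unit_integral0.
under eq_fun do rewrite big_cons; rewrite big_cons unit_integralD ?IH //.
exact: ccont_sum.
Qed.

Lemma unit_integral_dist (f g : R -> C) (d : R) : ccont f -> ccont g ->
  (forall u, cabs (f u - g u) <= d) -> cabs (unit_integral f - unit_integral g) <= 2 * d.
Proof.
move=> [f1 f2] [g1 g2] fg; apply: le_trans (cabs_le_ReIm _) _.
have -> : 2 * d = d + d by ring.
rewrite ReD ReN ImD ImN /=; apply: lerD; apply: I01_dist => // u.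
  by apply: le_trans (fg u); rewrite -ReN -ReD Re_le_cabs.
by apply: le_trans (fg u); rewrite -ImN -ImD Im_le_cabs.
Qed.

Lemma ccont_uniform_limit (f : R -> C) (F : nat -> R -> C) (d : nat -> R) :
  (forall N, ccont (F N)) -> d @ \oo --> (0 : R) ->
  (forall N u, cabs (f u - F N u) <= d N) -> ccont f.
Proof.
move=> cF d0 fF; split.
  apply: (continuous_uniform_limit (fun N => (cF N).1) d0) => N u.
  by apply: le_trans (fF N u); rewrite -ReN -ReD Re_le_cabs.
apply: (continuous_uniform_limit (fun N => (cF N).2) d0) => N u.
by apply: le_trans (fF N u); rewrite -ImN -ImD Im_le_cabs.
Qed.

Section Iterated.
Variable V : finType.
Implicit Types (t : V -> R) (v w : V).

Definition upd t v (u : R) : V -> R := fun w => if w == v then u else t w.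

Definition trig_poly (I : finType) (c : I -> C) (a : I -> V -> int) t : C :=
  \sum_i c i * cis (\sum_v (a i v)%:~R * t v).

Lemma upd_sum (b : V -> int) t v u :
  \sum_w (b w)%:~R * upd t v u w = \sum_(w | w != v) (b w)%:~R * t w + (b v)%:~R * u :> R.
Proof.
rewrite (bigD1 v) //= /upd eqxx addrC; congr (_ + _).
by apply: eq_bigr => w /negbTE ->.
Qed.

Lemma trig_ccont (I : finType) (c : I -> C) (a : I -> V -> int) t v :
  ccont (fun u => trig_poly c a (upd t v u)).
Proof.
apply: ccont_sum => i; under eq_fun do rewrite upd_sum; exact: ccont_mono.
Qed.

Lemma unit_integral_trig (I : finType) (c : I -> C) (a : I -> V -> int) t v :
  unit_integral (fun u => trig_poly c a (upd t v u)) =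
  trig_poly (fun i => if a i v == 0 then c i else 0) a t.
Proof.
rewrite unit_integral_sum; last first.
  by move=> i; under eq_fun do rewrite upd_sum; exact: ccont_mono.
apply: eq_bigr => i _; under eq_fun do rewrite upd_sum.
rewrite unit_integral_mono; case: eqP => a0; last by rewrite mul0r.
by rewrite [in RHS](bigD1 v) //= a0 mul0r add0r.
Qed.

(** Integrating over a period in each variable extracts the constant term. *)
Lemma iterated_trig (s : seq V) (I : finType) (c : I -> C) (a : I -> V -> int) t :
  iterated_integral s (trig_poly c a) t =
  trig_poly (fun i => if all (fun v => a i v == 0) s then c i else 0) a t.
Proof.
elim: s t => [|v s IH] t //=.
transitivity (unit_integral (fun u =>
    trig_poly (fun i => if all (fun v => a i v == 0) s then c i else 0) a (upd t v u))).
  by congr unit_integral; apply/funext => u; exact: IH.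
rewrite unit_integral_trig; congr trig_poly; apply/funext => i.
by case: (a i v == 0).
Qed.

(** The iterated integrals of trigonometric polynomials are trigonometric
    polynomials, hence continuous in each variable; this passes to the uniform
    limit and makes the inner integrals integrable. *)
Lemma iterated_approx (s : seq V) (F : (V -> R) -> C) (I : nat -> finType)
    (c : forall N, I N -> C) (a : forall N, I N -> V -> int) (d : nat -> R) :
  d @ \oo --> (0 : R) ->
  (forall N t, cabs (F t - trig_poly (c N) (a N) t) <= d N) ->
  forall N t, cabs (iterated_integral s F t - iterated_integral s (trig_poly (c N) (a N)) t)
    <= 2 ^+ size s * d N.
Proof.
move=> d0 approx; elim: s => [|v s IH] N t /=; first by rewrite mul1r.
rewrite exprS -mulrA.
have cT M : ccont (fun u => iterated_integral s (trig_poly (c M) (a M)) (upd t v u)).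
  by under eq_fun do rewrite iterated_trig; exact: trig_ccont.
apply: unit_integral_dist => [||u]; [|exact: cT|exact: IH].
apply: (ccont_uniform_limit cT) (fun M u => IH M (upd t v u)).
by rewrite -[X in _ --> X](mulr0 (2 ^+ size s)); apply: cvgMr.
Qed.

Lemma iterated_constant_term (F : (V -> R) -> C) (I : nat -> finType)
    (c : forall N, I N -> C) (a : forall N, I N -> V -> int) (d : nat -> R) t :
  d @ \oo --> (0 : R) ->
  (forall N t, cabs (F t - trig_poly (c N) (a N) t) <= d N) ->
  clim (fun N => \sum_(i | [forall v, a N i v == 0]) c N i) (iterated_integral (enum V) F t).
Proof.
move=> d0 approx.
apply: (@clim_squeeze _ _ _ (fun N => 2 ^+ size (enum V) * d N) 0) => [N _|]; last first.
  by rewrite -[X in _ --> X](mulr0 (2 ^+ size (enum V))); apply: cvgMr.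
rewrite cabsC; have := iterated_approx (enum V) d0 approx N t; congr (cabs (_ - _) <= _).
rewrite iterated_trig /trig_poly [RHS]big_mkcond; apply: eq_bigr => i _.
have -> : all (fun v => a N i v == 0) (enum V) = [forall v, a N i v == 0].
  apply/allP/forallP => h v; first by apply: h; rewrite mem_enum.
  by move=> _; exact: h.
case: ifP => [/forallP a0|_]; last by rewrite mul0r.
by rewrite big1 ?cis0 ?mulr1 // => v _; rewrite (eqP (a0 v)) mul0r.
Qed.

End Iterated.
End TrigIntegral.

(** * Feynman integrals as sums over flows *)

Section Flows.
Variables (n : nat) (E : finType).
Local Notation V := 'I_n.
Implicit Types (G : graph V E) (Omega : {perm V}).

(** A pair of integers in [-N, N] for each edge, both shifted by N so as to be
    ordinals. *)
Definition box (N : nat) : finType := {ffun E -> 'I_(2 * N).+1 * 'I_(2 * N).+1}.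

Definition winding (N : nat) (k : box N) (e : E) : int := (k e).1%:Z - N%:Z.
Definition flow (N : nat) (k : box N) (e : E) : int := (k e).2%:Z - N%:Z.

Definition excess G (f : E -> int) (v : V) : int :=
  \sum_e f e * ((G (e, false) == v)%:Z - (G (e, true) == v)%:Z).

Definition conserved G (f : E -> int) : bool := [forall v, excess G f v == 0].

(** On a circle of length n with the vertices at their ranks r, an edge from u to
    v of flow f and winding number w has length (n w + r_u - r_v) / f. *)
Definition positive_edges G Omega (f w : E -> int) : bool :=
  [forall e, 0 < f e * (n%:Z * w e + (Omega (G (e, false)))%:Z - (Omega (G (e, true)))%:Z)].

Definition flow_degree (f w : E -> int) : nat := (\sum_e absz (f e * w e)%R)%N.

Definition flow_weight (f : E -> int) : nat := (\prod_e absz (f e))%N.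

(** Summation by parts on a graph. *)
Lemma sum_excess (R : comPzRingType) G (f : E -> int) (x : V -> R) :
  \sum_v (excess G f v)%:~R * x v = \sum_e (f e)%:~R * (x (G (e, false)) - x (G (e, true))).
Proof.
under eq_bigr do rewrite /excess rmorph_sum mulr_suml.
rewrite exchange_big /=; apply: eq_bigr => e _.
have pick u : \sum_v ((u == v)%:Z)%:~R * x v = x u.
  rewrite (bigD1 u) //= eqxx mul1r big1 ?addr0 // => v /negbTE vu.
  by rewrite eq_sym vu mul0r.
rewrite mulrBr -!pick !mulr_sumr -sumrB; apply: eq_bigr => v _.
by rewrite intrM intrB; ring.
Qed.

Lemma positive_edge_ge0 (i j : nat) (f w : int) : (i < n)%N -> (j < n)%N ->
  0 < f * (n%:Z * w + i%:Z - j%:Z) -> 0 <= f * w.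
Proof.
move=> lin ljn; have [f0|f0|->] := ltgtP f 0; last by rewrite mul0r ltxx.
  by rewrite nmulr_rgt0 // nmulr_rge0 // => h; nia.
by rewrite pmulr_rgt0 // pmulr_rge0 // => h; nia.
Qed.

End Flows.

Section FlowSeries.
Variables (R : realType) (n : nat) (E : finType).
Local Notation V := 'I_n.
Local Notation C := R[i].
Implicit Types (G : graph V E) (Omega : {perm V}).

Lemma height_sign (b d : R) (d' k m : int) : 0 < b -> (0 < n)%N ->
  `|d| < b -> `|d'| < n%:Z -> (0 < d) = (0 < d') -> (d < 0) = (d' < 0) ->
  (0 < k%:~R * (m%:~R * b + d)) = (0 < k * (n%:Z * m + d')).
Proof.
move=> b0 n0 db dn pos neg.
have signE : (0 < m%:~R * b + d) = (0 < n%:Z * m + d') /\ (m%:~R * b + d < 0) = (n%:Z * m + d' < 0).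
  move: db; rewrite ltr_norml => /andP[db1 db2].
  have [m0|m0|->] := ltgtP m 0; last by rewrite mul0r mulr0 !add0r.
    have mR : m%:~R * b <= - b :> R.
      have : m%:~R <= -1 :> R by rewrite -[-1]/((-1 : int)%:~R) ler_int; lia.
      by move=> h; rewrite -mulN1r ler_wpM2r // ltW.
    have l1 : m%:~R * b + d < 0 by lra.
    have l2 : n%:Z * m + d' < 0 by nia.
    by rewrite l1 l2 (lt_gtF l1) (lt_gtF l2).
  have mR : b <= m%:~R * b.
    have : 1 <= m%:~R :> R by rewrite -[1]/((1 : int)%:~R) ler_int; lia.
    by move=> h; rewrite ler_peMl // ltW.
  have l1 : 0 < m%:~R * b + d by lra.
  have l2 : 0 < n%:Z * m + d' by nia.
  by rewrite l1 l2 (lt_gtF l1) (lt_gtF l2).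
case: signE; move: (m%:~R * b + d) (n%:Z * m + d') => x x' h1 h2.
have [k0|k0|->] := ltgtP k 0; last by rewrite !mul0r !ltxx.
  by rewrite !nmulr_rgt0 ?ltrz0 ?ltr0z.
by rewrite !pmulr_rgt0 ?ltr0z.
Qed.

(** The heights differ by less than the period b, and the ranks by less than n,
    so that the sign is decided by m, or by the order of the heights if m = 0. *)
Lemma positive_heights (y : V -> R) (b : R) Omega (u v : V) (k m : int) :
  0 < b -> (forall i j, (y i < y j) = (Omega i < Omega j)%N) ->
  (forall i j, `|y i - y j| < b) ->
  (0 < k%:~R * (m%:~R * b + (y u - y v))) = (0 < k * (n%:Z * m + (Omega u)%:Z - (Omega v)%:Z)).
Proof.
move=> b0 mono yb; rewrite -addrA; apply: height_sign => //.
- exact: leq_ltn_trans (ltn_ord u).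
- by have := ltn_ord (Omega u); have := ltn_ord (Omega v); lia.
- by rewrite subr_gt0 mono subr_gt0 ltz_nat.
- by rewrite subr_lt0 mono subr_lt0 ltz_nat.
Qed.

Lemma prod_approx (T : Type) (s : seq E) (A : E -> T -> C) (B : nat -> E -> T -> C)
    (d : E -> nat -> R) (M : E -> R) :
  (forall e, d e @ \oo --> (0 : R)) -> (forall N e t, cabs (A e t - B N e t) <= d e N) ->
  (forall e t, cabs (A e t) <= M e) ->
  exists2 D : nat -> R, D @ \oo --> (0 : R) &
    forall N t, cabs (\prod_(e <- s) A e t - \prod_(e <- s) B N e t) <= D N.
Proof.
move=> d0 AB AM; elim: s => [|e s [D D0 le_D]].
  exists (fun=> 0); first exact: cvg_cst.
  by move=> N t; rewrite !big_nil subrr cabs0.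
exists (fun N => d e N * \prod_(e <- s) M e + (M e + d e N) * D N).
  have : (fun N => d e N * \prod_(e <- s) M e + (M e + d e N) * D N) @ \oo -->
      (0 : R) * \prod_(e <- s) M e + (M e + 0) * 0.
    apply: cvgD; first by apply: cvgM; [exact: d0|exact: cvg_cst].
    by apply: cvgM => //; apply: cvgD; [exact: cvg_cst|exact: d0].
  by rewrite mul0r mulr0 addr0.
move=> N t; rewrite !big_cons.
set a := \prod_(_ <- _) _; set b := \prod_(_ <- _) _.
have -> : A e t * a - B N e t * b = (A e t - B N e t) * a + B N e t * (a - b) by ring.
apply: le_trans (cabsD _ _) _; rewrite !cabsM; apply: lerD.
  apply: ler_pM; rewrite ?cabs_ge0 // /a cabs_prod.
  by apply: ler_prod => e' _; rewrite cabs_ge0 AM.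
apply: ler_pM; rewrite ?cabs_ge0 //; last exact: le_D.
have -> : B N e t = A e t - (A e t - B N e t) by ring.
by apply: le_trans (cabsD _ _) _; rewrite cabsN lerD.
Qed.

Definition flow_term (q : C) (f w : E -> int) : C := (flow_weight f)%:R * q ^+ flow_degree f w.

Section Expansion.
Variables (tau : C) (y : V -> R) (Omega : {perm V}) (G : graph V E).
Hypothesis tau_gt0 : 0 < complex.Im tau.
Hypothesis y_adm : admissible_heights tau Omega y.
Local Notation b := (complex.Im tau).
Local Notation z t := (fun j : V => t j +i* y j).

(** The contribution of the imaginary parts of the variables; it is 1 for a
    conserved flow. *)
Definition height_exponent (N : nat) (k : box E N) : C :=
  (expR (- (2 * pi * \sum_v (excess G (flow k) v)%:~R * y v)))%:C.

Definition box_coef (N : nat) (k : box E N) : C :=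
  if positive_edges G Omega (flow k) (winding k)
  then flow_term (e2pi tau) (flow k) (winding k) * height_exponent k else 0.

Lemma e2pi_sum (I : Type) (s : seq I) (F : I -> C) : e2pi (\sum_(i <- s) F i) = \prod_(i <- s) e2pi (F i).
Proof.
by elim: s => [|i s IH]; rewrite ?big_nil ?e2pi0 // !big_cons e2piD IH.
Qed.

Lemma ReImsum (I : Type) (s : seq I) (a c : I -> R) :
  \sum_(i <- s) (a i +i* c i) = (\sum_(i <- s) a i) +i* (\sum_(i <- s) c i).
Proof. by elim: s => [|i s IH]; rewrite ?big_nil // !big_cons IH. Qed.

(** Expanding the product chooses a term for each edge, and by summation by parts
    the variables appear through the excesses at the vertices only. *)
Lemma fourier_prod (N : nat) (t : V -> R) :
  \prod_e fourier_box tau N (z t (G (e, false)) - z t (G (e, true))) =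
  trig_poly (@box_coef N) (fun k => excess G (flow k)) t.
Proof.
rewrite /fourier_box; under eq_bigr do rewrite pair_big /=.
rewrite bigA_distr_bigA /=; apply: eq_bigr => k _.
rewrite /box_coef; case: ifP => [/forallP pos|]; last first.
  move=> /negbT/forallPn[e neg]; rewrite (bigD1 e) //= mul0r.
  rewrite (@positive_heights y b Omega) //; [|by case: y_adm|by case: y_adm].
  by rewrite (negbTE neg) mul0r.
transitivity (\prod_e ((absz (flow k e))%:R * e2pi tau ^+ absz (flow k e * winding k e) *
     e2pi ((flow k e)%:~R * (z t (G (e, false)) - z t (G (e, true)))))).
  apply: eq_bigr => e _; have := pos e.
  rewrite -(@positive_heights y b) //; [|by case: y_adm|by case: y_adm].
  move=> pe; rewrite /= -/(winding k e) -/(flow k e) pe.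
  rewrite mulrDr e2piD -[RHS]mulrA [X in _ = _ * X]mulrC; congr (_ * (_ * _)).
  have nn := positive_edge_ge0 (ltn_ord _) (ltn_ord _) (pos e).
  by rewrite mulrA -rmorphM /= -{1}(gez0_abs nn) e2pi_natM.
rewrite big_split big_split /= /flow_term /flow_weight /flow_degree.
rewrite -natr_prod -expr_sum -e2pi_sum -[RHS]mulrA; congr (_ * _).
rewrite -(sum_excess G (flow k) (fun j => t j +i* y j)).
have -> : \sum_v (excess G (flow k) v)%:~R * (t v +i* y v) =
   (\sum_v (excess G (flow k) v)%:~R * t v) +i* (\sum_v (excess G (flow k) v)%:~R * y v).
  rewrite -ReImsum; apply: eq_bigr => v _; rewrite intcE.
  by apply/eqP; rewrite eq_complex /= !mul0r subr0 addr0 !eqxx.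
by rewrite /e2pi /=.
Qed.

(** The constant term of the integrand consists of the terms whose flow has zero
    excess at every vertex. *)
Lemma feynman_box_lim : ~~ has_loop G ->
  clim (fun N => \sum_(k : box E N | conserved G (flow k) && positive_edges G Omega (flow k) (winding k))
     flow_term (e2pi tau) (flow k) (winding k)) (feynman_integral_at G tau y).
Proof.
move=> noloop; rewrite /feynman_integral_at (negbTE noloop).
have [y_inj mono yb] := y_adm.
pose s e := y (G (e, false)) - y (G (e, true)).
have s_bound e : 0 < `|s e| < b.
  rewrite yb andbT normr_gt0 subr_eq0; apply: contra noloop => /eqP/y_inj h.
  by apply/existsP; exists e; rewrite h.
have /choice[d hd] : forall e, exists d : nat -> R, d @ \oo --> (0 : R) /\
    forall x, complex.Im x = s e -> forall N, cabs (- propagator tau x - fourier_box tau N x) <= d N.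
  by move=> e; have [d d0 d_le] := fourier_box_approx tau_gt0 (s_bound e); exists d.
have box0 x : fourier_box tau 0 x = 0.
  by rewrite /fourier_box !big_ord1 /= mul0r ltxx.
have [||e t|D D0 le_D] := @prod_approx (V -> R) (index_enum E)
  (fun e t => - propagator tau (z t (G (e, false)) - z t (G (e, true))))
  (fun N e t => fourier_box tau N (z t (G (e, false)) - z t (G (e, true)))) d (fun e => d e 0).
- by move=> e; case: (hd e).
- by move=> N e t; case: (hd e) => _ h; exact: h.
- by case: (hd e) => _ /(_ (z t (G (e, false)) - z t (G (e, true))) erefl 0%N); rewrite box0 subr0.
have := @iterated_constant_term R V (fun t => feynman_integrand G tau (z t)) (box E)
  box_coef (fun N k => excess G (flow k)) D (fun=> 0) D0.
have h N t : cabs (feynman_integrand G tau (z t) - trig_poly (@box_coef N) (fun k => excess G (flow k)) t) <= D N.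
  by rewrite -fourier_prod; exact: le_D.
move/(_ h); congr clim; apply/funext => N.
rewrite big_mkcondr; apply: eq_bigr => k /forallP k0.
rewrite /box_coef; case: ifP => // _; rewrite /height_exponent.
by rewrite big1 ?mulr0 ?oppr0 ?expR0 ?mulr1 // => v _; rewrite (eqP (k0 v)) mul0r.
Qed.

(** The terms of the box that have degree at least N are polynomially many and
    exponentially small. *)
Lemma feynman_degree_lim : ~~ has_loop G ->
  clim (fun N => \sum_(k : box E N | [&& conserved G (flow k),
       positive_edges G Omega (flow k) (winding k) & (flow_degree (flow k) (winding k) < N)%N])
     flow_term (e2pi tau) (flow k) (winding k)) (feynman_integral_at G tau y).
Proof.
move=> noloop; apply: (clim_near (feynman_box_lim noloop)).
have /andP[r0 r1] := e2pi_tau_lt1 tau_gt0; set r := cabs (e2pi tau) in r0 r1.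
pose e := #|E|.
apply: (@squeeze_cvgr _ _ _ _ (fun=> 0) (fun N : nat => 4 ^+ e * (N.+1%:R ^+ (3 * e) * r ^+ N))).
- apply: nearW => N; rewrite cabs_ge0 /= cabsC.
  under [X in _ - X]eq_bigl do rewrite andbA.
  rewrite (bigID (fun k : box E N => flow_degree (flow k) (winding k) < N)%N) /= addrC addrK.
  apply: le_trans (cabs_sum _ _ _) _.
  apply: (@le_trans _ _ (\sum_(k : box E N) N.+1%:R ^+ e * r ^+ N)).
    rewrite [leLHS]big_mkcond; apply: ler_sum => k _; case: ifP => [|_]; last first.
      by rewrite mulr_ge0 ?exprn_ge0.
    move=> /andP[_]; rewrite -leqNgt => deg.
    rewrite /flow_term cabsM cabs_nat cabsX -/r; apply: ler_pM; rewrite ?exprn_ge0 //.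
      rewrite /flow_weight natr_prod -[e]/(#|E|) -prodr_const; apply: ler_prod => i _.
      rewrite ler0n ler_nat /=.
      by rewrite /flow; have := ltn_ord (k i).2; move: (nat_of_ord (k i).2) => j; lia.
    by apply: ler_wiXn2l => //; exact: ltW.
  rewrite sumr_const card_ffun card_prod !card_ord -[_ *+ _]mulr_natl.
  rewrite natrX natrM.
  have -> : 4 ^+ e * (N.+1%:R ^+ (3 * e) * r ^+ N) =
     (2 * N.+1%:R * (2 * N.+1%:R)) ^+ e * (N.+1%:R ^+ e * r ^+ N).
    rewrite mulrA mulrA exprM -!exprMn; congr (_ ^+ _ * _); ring.
  rewrite ler_wpM2r ?mulr_ge0 ?exprn_ge0 // -/e lerXn2r ?nnegrE ?mulr_ge0 //.
  have : (2 * N).+1%:R <= 2 * N.+1%:R :> R by rewrite -natrM ler_nat; lia.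
  by move=> h; apply: ler_pM.
- exact: cvg_cst.
- by apply: cvg_poly_geometric; rewrite r0.
Qed.

End Expansion.
End FlowSeries.

(** * Labelled combinatorial data of covers *)

Section Keys.
Variables (n : nat) (E : finType).
Local Notation V := 'I_n.
Implicit Types (G : graph V E) (Omega : {perm V}).

Lemma flow_degreeE G Omega (f w : E -> int) : positive_edges G Omega f w ->
  (flow_degree f w)%:Z = \sum_e f e * w e.
Proof.
move=> /forallP pos; rewrite /flow_degree.
transitivity (\sum_e (absz (f e * w e) : int)); first by rewrite -natz natr_sum; apply: eq_bigr => e _; rewrite natz.
by apply: eq_bigr => e _; rewrite gez0_abs // (positive_edge_ge0 _ _ (pos e)) ?ltn_ord.
Qed.

(** The degree may be computed from any potential, by conservation of the flow. *)
Lemma flow_degree_potential G Omega (f w : E -> int) (p : V -> int) :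
  conserved G f -> positive_edges G Omega f w ->
  (flow_degree f w)%:Z = \sum_e f e * (w e + p (G (e, false)) - p (G (e, true))).
Proof.
move=> /forallP cons pos; rewrite (flow_degreeE pos).
have : \sum_v (excess G f v)%:~R * p v = 0 :> int.
  by rewrite big1 // => v _; rewrite (eqP (cons v)) mul0r.
rewrite sum_excess => h; rewrite -[LHS]addr0 -[X in _ + X = _]h -big_split /=.
by apply: eq_bigr => e _; rewrite intz -mulrDr addrA.
Qed.

Lemma positive_edges_neq0 G Omega (f w : E -> int) e : positive_edges G Omega f w -> f e != 0.
Proof. by move=> /forallP/(_ e); apply: contraTneq => ->; rewrite mul0r ltxx. Qed.

(** The indicator of the vertices above a level is a potential for which all
    the terms are nonnegative; taken at the level of the higher end of an edge
    that does not wind, its term there is the absolute value of the flow. *)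
Lemma flow_le_degree G Omega (f w : E -> int) e :
  conserved G f -> positive_edges G Omega f w -> (absz (f e) <= flow_degree f w)%N.
Proof.
move=> cons pos; have /forallP pos' := pos.
have key (p : V -> int) : (forall e', 0 <= f e' * (w e' + p (G (e', false)) - p (G (e', true)))) ->
    (absz (f e))%:Z <= f e * (w e + p (G (e, false)) - p (G (e, true))) ->
    (absz (f e) <= flow_degree f w)%N.
  move=> p_ge0 p_e; rewrite -lez_nat (flow_degree_potential p cons pos) (bigD1 e) //=.
  by apply: le_trans p_e _; rewrite lerDl sumr_ge0.
have lt_n i : (Omega i < n)%N by [].
have [w0|w0] := eqVneq (w e) 0; last first.
  apply: (key (fun=> 0)) => [e'|]; rewrite addr0 subr0.
    exact: positive_edge_ge0 (lt_n _) (lt_n _) (pos' e').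
  have := positive_edge_ge0 (lt_n _) (lt_n _) (pos' e); move: w0.
  by move: (f e) (w e) => a b; nia.
pose top := maxn (Omega (G (e, false))) (Omega (G (e, true))).
apply: (key (fun v => (top <= Omega v)%N%:Z)) => [e'|].
  have := pos' e'; have := lt_n (G (e', false)); have := lt_n (G (e', true)).
  move: (nat_of_ord (Omega (G (e', false)))) (nat_of_ord (Omega (G (e', true)))) => i j ljn lin.
  have [f0|f0|->] := ltgtP (f e') 0; last by rewrite !mul0r.
    rewrite nmulr_rgt0 // nmulr_rge0 // => h.
    have w'0 : w e' <= 0 by nia.
    have [w1|w1] := eqVneq (w e') 0; last by case: (leqP top i) => _; case: (leqP top j) => _ /=; lia.
    rewrite w1 in h *; have ij : (i < j)%N by lia.
    by case: (leqP top i); case: (leqP top j) => /=; lia.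
  rewrite pmulr_rgt0 // pmulr_rge0 // => h.
  have w'0 : 0 <= w e' by nia.
  have [w1|w1] := eqVneq (w e') 0; last by case: (leqP top i) => _; case: (leqP top j) => _ /=; lia.
  rewrite w1 in h *; have ij : (j < i)%N by lia.
  by case: (leqP top i); case: (leqP top j) => /=; lia.
have := pos' e; rewrite w0 mulr0 !add0r /top.
move: (nat_of_ord (Omega (G (e, false)))) (nat_of_ord (Omega (G (e, true)))) => i j.
have [f0|f0|->] := ltgtP (f e) 0; last by rewrite !mul0r ltxx.
  rewrite nmulr_rgt0 // => h.
  have -> : (maxn i j <= i)%N = false by lia.
  have -> : (maxn i j <= j)%N by lia.
  by rewrite /=; lia.
rewrite pmulr_rgt0 // => h.
have -> : (maxn i j <= i)%N by lia.
have -> : (maxn i j <= j)%N = false by lia.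
by rewrite /=; lia.
Qed.

Lemma winding_le_degree G Omega (f w : E -> int) e :
  positive_edges G Omega f w -> (absz (w e) <= flow_degree f w)%N.
Proof.
move=> pos; apply: (@leq_trans (absz (f e * w e))); last first.
  by rewrite /flow_degree (bigD1 e) //= leq_addr.
rewrite abszM leq_pmull // absz_gt0; exact: positive_edges_neq0 pos.
Qed.

(** The combinatorial data of a cover with labelled vertices and edges: the graph,
    the position of the vertices on the circle cut open at a point, and the
    winding number and flow of the edges. *)
Definition key (N : nat) : finType := (graph V E * {perm V} * box E N)%type.

Section FixedBox.
Variable N : nat.
Implicit Types (x : key N) (phi psi : iso_data V E).

Definition kflow x : E -> int := flow x.2.
Definition kwinding x : E -> int := winding x.2.
Definition kdegree x : nat := flow_degree (kflow x) (kwinding x).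
Definition kweight x : nat := flow_weight (kflow x).

Definition good_graph G : bool := [&& trivalent G, connected_graph G & ~~ has_loop G].

Definition valid_key x : bool :=
  [&& good_graph x.1.1, conserved x.1.1 (kflow x) &
      positive_edges x.1.1 x.1.2 (kflow x) (kwinding x)].

Definition flip_pair (b : bool) (i : 'I_(2 * N).+1 * 'I_(2 * N).+1) :=
  if b then (rev_ord i.1, rev_ord i.2) else i.

Definition graph_act phi G : graph V E :=
  [ffun p => phi.1.1 (G ((phi.1.2)^-1%g p.1, p.2 (+) phi.2 ((phi.1.2)^-1%g p.1)))].

Definition key_act phi x : key N :=
  (graph_act phi x.1.1, ((phi.1.1)^-1 * x.1.2)%g,
   [ffun e => flip_pair (phi.2 ((phi.1.2)^-1%g e)) (x.2 ((phi.1.2)^-1%g e))]).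

Definition iso_comp psi phi : iso_data V E :=
  ((phi.1.1 * psi.1.1)%g, (phi.1.2 * psi.1.2)%g, [ffun e => phi.2 e (+) psi.2 (phi.1.2 e)]).

Definition iso_inv phi : iso_data V E :=
  ((phi.1.1)^-1%g, (phi.1.2)^-1%g, [ffun e => phi.2 ((phi.1.2)^-1%g e)]).

Lemma graph_actE phi G e b : graph_act phi G (phi.1.2 e, b (+) phi.2 e) = phi.1.1 (G (e, b)).
Proof. by rewrite ffunE /= permK -addbA addbb addbF. Qed.

Lemma graph_act_eq phi G G' :
  (forall e b, G' (phi.1.2 e, b (+) phi.2 e) = phi.1.1 (G (e, b))) -> G' = graph_act phi G.
Proof.
move=> h; apply/ffunP => -[e b]; rewrite ffunE /= -h permKV.
by rewrite -addbA addbb addbF.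
Qed.

Lemma graph_act_comp psi phi G : graph_act (iso_comp psi phi) G = graph_act psi (graph_act phi G).
Proof.
symmetry; apply: graph_act_eq => e b; rewrite /= ffunE permM permM addbA graph_actE.
by rewrite graph_actE.
Qed.

Lemma graph_act_inv phi G : graph_act (iso_inv phi) (graph_act phi G) = G.
Proof.
symmetry; apply: graph_act_eq => e b /=.
by rewrite !ffunE /= permK.
Qed.

Lemma zflip (i : 'I_(2 * N).+1) : ((rev_ord i)%:Z - N%:Z) = - (i%:Z - N%:Z).
Proof. by rewrite /=; have := ltn_ord i; move: (nat_of_ord i) => j; lia. Qed.

(** The sign by which reversing an edge changes its flow and its winding number. *)
Definition sgb (b : bool) : int := if b then -1 else 1.

Lemma kflow_act phi x e : kflow (key_act phi x) (phi.1.2 e) = sgb (phi.2 e) * kflow x e.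
Proof.
rewrite /kflow /flow ffunE permK /flip_pair /sgb; case: (phi.2 e); last by rewrite mul1r.
by rewrite zflip mulN1r.
Qed.

Lemma kwinding_act phi x e : kwinding (key_act phi x) (phi.1.2 e) = sgb (phi.2 e) * kwinding x e.
Proof.
rewrite /kwinding /winding ffunE permK /flip_pair /sgb; case: (phi.2 e); last by rewrite mul1r.
by rewrite zflip mulN1r.
Qed.

Lemma order_act phi x v : (key_act phi x).1.2 (phi.1.1 v) = x.1.2 v.
Proof. by rewrite /= permM permK. Qed.

Lemma box_eq (k k' : box E N) : flow k =1 flow k' -> winding k =1 winding k' -> k = k'.
Proof.
move=> ff ww; apply/ffunP => e; have := ff e; have := ww e; rewrite /flow /winding.
case: (k e) (k' e) => [i j] [i' j'] /= /addIr [] ii' /addIr [] jj'.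
by congr (_, _); apply: val_inj.
Qed.

Lemma key_act_eq phi x x' :
  (forall e b, x'.1.1 (phi.1.2 e, b (+) phi.2 e) = phi.1.1 (x.1.1 (e, b))) ->
  (forall v, x'.1.2 (phi.1.1 v) = x.1.2 v) ->
  (forall e, kflow x' (phi.1.2 e) = sgb (phi.2 e) * kflow x e) ->
  (forall e, kwinding x' (phi.1.2 e) = sgb (phi.2 e) * kwinding x e) ->
  x' = key_act phi x.
Proof.
move=> hG hO hf hw.
rewrite [x']surjective_pairing [x'.1]surjective_pairing /key_act; congr (_, _, _).
- exact: graph_act_eq.
- by apply/permP => v; rewrite permM -hO permKV.
- apply: box_eq => e; rewrite -(permKV phi.1.2 e).
    by rewrite -/(kflow x') hf -kflow_act.
  by rewrite -/(kwinding x') hw -kwinding_act.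
Qed.

Lemma sgbM b b' : sgb b * sgb b' = sgb (b (+) b').
Proof. by case: b; case: b'. Qed.

Lemma key_act_comp psi phi x : key_act (iso_comp psi phi) x = key_act psi (key_act phi x).
Proof.
symmetry; apply: key_act_eq => [e b|v|e|e].
- by rewrite /= ffunE permM permM addbA !graph_actE.
- have -> : (iso_comp psi phi).1.1 v = psi.1.1 (phi.1.1 v) by rewrite permM.
  by rewrite (order_act psi) (order_act phi).
- by rewrite [(iso_comp psi phi).1.2 e]permM !kflow_act mulrA sgbM ffunE addbC.
- by rewrite [(iso_comp psi phi).1.2 e]permM !kwinding_act mulrA sgbM ffunE addbC.
Qed.

Lemma key_act_inv phi x : key_act (iso_inv phi) (key_act phi x) = x.
Proof.
symmetry; apply: key_act_eq => [e b|v|e|e].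
- by rewrite /= !ffunE /= permK.
- by have := order_act phi x ((phi.1.1)^-1%g v); rewrite permKV => ->.
- have := kflow_act phi x ((phi.1.2)^-1%g e); rewrite permKV => ->.
  by rewrite /= ffunE mulrA sgbM addbb mul1r.
- have := kwinding_act phi x ((phi.1.2)^-1%g e); rewrite permKV => ->.
  by rewrite /= ffunE mulrA sgbM addbb mul1r.
Qed.

Lemma iso_comp_inj psi : injective (iso_comp psi).
Proof.
move=> [[s t] f] [[s' t'] f'] [] /= /mulIg -> /mulIg -> /ffunP h.
congr (_, _, _); apply/ffunP => e; have := h e; rewrite !ffunE /=; exact: addIb.
Qed.

Lemma kdegree_act phi x : kdegree (key_act phi x) = kdegree x.
Proof.
rewrite /kdegree /flow_degree (reindex_inj (@perm_inj _ phi.1.2)); apply: eq_bigr => e _.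
rewrite kflow_act kwinding_act /sgb; case: (phi.2 e); rewrite ?mul1r //.
by rewrite !mulN1r mulrNN.
Qed.

Lemma kweight_act phi x : kweight (key_act phi x) = kweight x.
Proof.
rewrite /kweight /flow_weight (reindex_inj (@perm_inj _ phi.1.2)); apply: eq_bigr => e _.
rewrite kflow_act /sgb; case: (phi.2 e); rewrite ?mul1r //.
by rewrite mulN1r abszN.
Qed.

End FixedBox.
End Keys.

(** * Relabelling graphs and flows *)

Section Invariance.
Variables (n : nat) (E : finType).
Local Notation V := 'I_n.
Implicit Types (G : graph V E) (phi psi : iso_data V E).

Lemma adjacent_sym G : symmetric (Defs.adjacent G).
Proof.
suff h u v : Defs.adjacent G u v -> Defs.adjacent G v u by move=> u v; apply/idP/idP; exact: h.
move=> /existsP[e /existsP[b /andP[p q]]]; apply/existsP; exists e; apply/existsP; exists (~~ b).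
by rewrite negbK q p.
Qed.

Lemma adjacent_act phi G u v :
  Defs.adjacent (graph_act phi G) (phi.1.1 u) (phi.1.1 v) = Defs.adjacent G u v.
Proof.
apply/existsP/existsP => -[e /existsP[b /andP[p q]]].
  exists ((phi.1.2)^-1%g e); apply/existsP; exists (b (+) phi.2 ((phi.1.2)^-1%g e)).
  move: p q; rewrite !ffunE /= !(inj_eq perm_inj) => -> /=.
  by rewrite addNb.
exists (phi.1.2 e); apply/existsP; exists (b (+) phi.2 e).
by rewrite -addNb !graph_actE !(inj_eq perm_inj) p q.
Qed.

Lemma connected_act phi G : connected_graph (graph_act phi G) = connected_graph G.
Proof.
rewrite /connected_graph; suff -> : num_components (graph_act phi G) = num_components G by [].
rewrite /num_components.
have cs G' : connect_sym (Defs.adjacent G') by apply: sym_connect_sym; exact: adjacent_sym.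
have cl : fingraph.closed (Defs.adjacent (graph_act phi G)) (mem V) by [].
rewrite (adjunction_n_comp phi.1.1 (cs _) (cs G) cl) //.
apply: strict_adjunction => //; first exact: perm_inj.
  by apply/fintype.subsetP => v _; apply/codomP; exists ((phi.1.1)^-1%g v); rewrite permKV.
by move=> u v _; rewrite -(adjacent_act phi G).
Qed.

Lemma flags_act phi G v :
  #|[pred h | graph_act phi G h == phi.1.1 v]| = #|[pred h | G h == v]|.
Proof.
pose F (p : E * bool) := (phi.1.2 p.1, p.2 (+) phi.2 p.1).
have F_inj : injective F by move=> [e b] [e' b'] [] /perm_inj <- /addIb <-.
rewrite -[RHS](fintype.card_image F_inj); apply: fintype.eq_card => -[e b]; rewrite [LHS]inE; apply/idP/fintype.imageP.
  rewrite ffunE (inj_eq perm_inj) /= => h.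
  exists ((phi.1.2)^-1%g e, b (+) phi.2 ((phi.1.2)^-1%g e)) => //.
  by rewrite /F /= permKV -addbA addbb addbF.
by move=> [[e' b']]; rewrite inE => /eqP <- [-> ->]; rewrite graph_actE.
Qed.

Lemma trivalent_act phi G : trivalent (graph_act phi G) = trivalent G.
Proof.
apply/forallP/forallP => h v; first by rewrite -(flags_act phi).
by rewrite -(permKV phi.1.1 v) flags_act.
Qed.

Lemma has_loop_act phi G : has_loop (graph_act phi G) = has_loop G.
Proof.
apply/existsP/existsP => -[e /eqP he].
  exists ((phi.1.2)^-1%g e); move: he; rewrite !ffunE /= => /perm_inj.
  by case: (phi.2 _) => /= ->.
exists (phi.1.2 e); move: (graph_actE phi G e false) (graph_actE phi G e true).
by case: (phi.2 e) => /= -> ->; rewrite he.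
Qed.

Lemma good_graph_act phi G : good_graph (graph_act phi G) = good_graph G.
Proof. by rewrite /good_graph trivalent_act connected_act has_loop_act. Qed.

Section FixedBox.
Variable N : nat.
Implicit Types x : key n E N.

Lemma ends_act phi G e : phi.2 e = false ->
  graph_act phi G (phi.1.2 e, false) = phi.1.1 (G (e, false)) /\
  graph_act phi G (phi.1.2 e, true) = phi.1.1 (G (e, true)).
Proof.
move=> f0; have := graph_actE phi G e false; have := graph_actE phi G e true.
by rewrite f0.
Qed.

Lemma ends_act_flip phi G e : phi.2 e = true ->
  graph_act phi G (phi.1.2 e, false) = phi.1.1 (G (e, true)) /\
  graph_act phi G (phi.1.2 e, true) = phi.1.1 (G (e, false)).
Proof.
move=> f0; have := graph_actE phi G e false; have := graph_actE phi G e true.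
by rewrite f0.
Qed.

Lemma excess_act phi x v :
  excess (key_act phi x).1.1 (kflow (key_act phi x)) (phi.1.1 v) = excess x.1.1 (kflow x) v.
Proof.
rewrite /excess (reindex_inj (@perm_inj _ phi.1.2)); apply: eq_bigr => e _.
rewrite kflow_act /sgb [(key_act phi x).1.1]/=.
case f : (phi.2 e).
  have [-> ->] := ends_act_flip x.1.1 f; rewrite !(inj_eq perm_inj) mulN1r mulNr -mulrN opprB.
  by [].
by have [-> ->] := ends_act x.1.1 f; rewrite !(inj_eq perm_inj) mul1r.
Qed.

Lemma conserved_act phi x :
  conserved (key_act phi x).1.1 (kflow (key_act phi x)) = conserved x.1.1 (kflow x).
Proof.
apply/forallP/forallP => h v; first by rewrite -(excess_act phi).
by rewrite -(permKV phi.1.1 v) excess_act.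
Qed.

Lemma positive_act phi x :
  positive_edges (key_act phi x).1.1 (key_act phi x).1.2 (kflow (key_act phi x)) (kwinding (key_act phi x)) =
  positive_edges x.1.1 x.1.2 (kflow x) (kwinding x).
Proof.
have edge e : let e' := phi.1.2 e in let x' := key_act phi x in
    kflow x' e' * (n%:Z * kwinding x' e' + (x'.1.2 (x'.1.1 (e', false)))%:Z - (x'.1.2 (x'.1.1 (e', true)))%:Z) =
    kflow x e * (n%:Z * kwinding x e + (x.1.2 (x.1.1 (e, false)))%:Z - (x.1.2 (x.1.1 (e, true)))%:Z).
  move=> e' x'; rewrite /e' /x' kflow_act kwinding_act /sgb; case f : (phi.2 e).
    have [-> ->] := ends_act_flip x.1.1 f; rewrite !order_act; ring.
  by have [-> ->] := ends_act x.1.1 f; rewrite !order_act !mul1r.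
apply/forallP/forallP => h e; first by have := h (phi.1.2 e); rewrite edge.
by have := edge ((phi.1.2)^-1%g e); rewrite /= permKV => ->.
Qed.

Lemma valid_act phi x : valid_key (key_act phi x) = valid_key x.
Proof. by rewrite /valid_key conserved_act positive_act good_graph_act. Qed.

End FixedBox.

Lemma graph_act_inj phi : injective (@graph_act n E phi).
Proof. exact: can_inj (graph_act_inv phi). Qed.

Lemma graph_endsE G e u : (u \in graph_ends G e) = (u == G (e, false)) || (u == G (e, true)).
Proof. by rewrite /graph_ends !inE. Qed.

Lemma graph_ends_act phi G e :
  graph_ends (graph_act phi G) (phi.1.2 e) = (imset phi.1.1 (mem (graph_ends G e))).
Proof.
rewrite /graph_ends imsetU1 imset_set1.
case f : (phi.2 e); last by have [-> ->] := ends_act G f.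
by have [-> ->] := ends_act_flip G f; apply/finset.setP => u; rewrite !inE orbC.
Qed.

(** Two orientations of the same abstract edge differ by a flip. *)
Lemma graph_iso_act G G' (s : {perm V} * {perm E}) : graph_iso G G' s ->
  exists f : {ffun E -> bool}, G' = graph_act (s, f) G.
Proof.
move=> /forallP h; pose f := [ffun e => G' (s.2 e, false) != s.1 (G (e, false))].
exists f; case: s h @f => s t h f; apply: graph_act_eq => e b /=.
have /eqP ends := h e; rewrite /= in ends.
have im u : (u \in imset s (mem (graph_ends G e))) = (u == s (G (e, false))) || (u == s (G (e, true))).
  by rewrite /graph_ends imsetU1 imset_set1 !inE.
have A : G' (t e, false) = s (G (e, false)) \/ G' (t e, false) = s (G (e, true)).
  by apply/pred2P; rewrite -im -ends graph_endsE eqxx.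
have B : G' (t e, true) = s (G (e, false)) \/ G' (t e, true) = s (G (e, true)).
  by apply/pred2P; rewrite -im -ends graph_endsE eqxx orbT.
have D : s (G (e, false)) = G' (t e, false) \/ s (G (e, false)) = G' (t e, true).
  by apply/pred2P; rewrite -graph_endsE ends im eqxx.
have F : s (G (e, true)) = G' (t e, false) \/ s (G (e, true)) = G' (t e, true).
  by apply/pred2P; rewrite -graph_endsE ends im eqxx orbT.
rewrite ffunE /=; case: eqVneq => [e0|/eqP ne0] /=; rewrite ?addbF ?addbT.
  case: b => //; rewrite e0 in F; case: B => // B; case: F => F; last by rewrite -F.
  by rewrite F.
by case: b => /=; [case: A|case: D => // D; rewrite D in ne0].
Qed.

Lemma act_graph_iso phi G : graph_iso G (graph_act phi G) phi.1.
Proof. by apply/forallP => e; rewrite graph_ends_act. Qed.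

Lemma graph_isomorphicP G G' :
  reflect (exists phi, G' = graph_act phi G) (graph_isomorphic G G').
Proof.
apply: (iffP existsP) => [[s /graph_iso_act[f ->]]|[phi ->]]; first by exists (s, f).
by exists phi.1; exact: act_graph_iso.
Qed.

(** Without loops the flips are determined by the effect on the vertices. *)
Lemma card_graph_autE G : ~~ has_loop G ->
  card_graph_aut G = #|[pred phi : iso_data V E | graph_act phi G == G]|.
Proof.
move=> noloop; rewrite /card_graph_aut.
have fst_inj : {in [pred phi : iso_data V E | graph_act phi G == G] &, injective (fun phi : iso_data V E => phi.1)}.
  move=> [st f] [st' f']; rewrite !inE /= => /eqP h /eqP h' e; subst st'; congr (_, _).
  apply/ffunP => e; have := graph_actE (st, f) G e (f e); have := graph_actE (st, f') G e (f e).
  rewrite h h' /= addbb => <- /eqP; apply: contraTeq => ff'.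
  have -> : f e (+) f' e = true by case: (f e) (f' e) ff' => [] [].
  by apply: contra noloop => /eqP e0; apply/existsP; exists (st.2 e); rewrite e0.
rewrite -[RHS](fintype.card_in_image fst_inj); apply: fintype.eq_card => s; rewrite [LHS]inE; apply/idP/fintype.imageP.
  by move=> /graph_iso_act[f hf]; exists (s, f) => //; rewrite inE -hf.
by move=> [phi]; rewrite inE => /eqP h ->; have := act_graph_iso phi G; rewrite h.
Qed.

End Invariance.

(** * Counting points on a circle *)

Section CircleCounting.
Variables (R : realType) (L : R).
Hypothesis L_gt0 : 0 < L.

Lemma circle_refl x : circle_eq L x x.
Proof. by exists 0; rewrite subrr mul0r. Qed.

Lemma circle_sym x y : circle_eq L x y -> circle_eq L y x.
Proof. by move=> [k h]; exists (- k); rewrite -opprB h mulrNz mulNr. Qed.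

Lemma circle_trans y x z : circle_eq L x y -> circle_eq L y z -> circle_eq L x z.
Proof.
by move=> [k h] [k' h']; exists (k + k'); rewrite intrD mulrDl -h -h' addrA subrK.
Qed.

Lemma circleD x y x' y' : circle_eq L x y -> circle_eq L x' y' -> circle_eq L (x + x') (y + y').
Proof.
by move=> [k h] [k' h']; exists (k + k'); rewrite intrD mulrDl -h -h' opprD addrACA.
Qed.

Lemma circle_shift x (k : int) : circle_eq L (x + k%:~R * L) x.
Proof. by exists k; rewrite addrC addKr. Qed.

Lemma circle_inj x y : 0 <= x < L -> 0 <= y < L -> circle_eq L x y -> x = y.
Proof.
move=> /andP[x0 xL] /andP[y0 yL] [k h].
suff k0 : k = 0 by move: h; rewrite k0 mul0r => /subr0_eq.
have h1 : k%:~R * L < 1%:~R * L by rewrite -h mul1r; lra.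
have h2 : (-1)%:~R * L < k%:~R * L by rewrite -h mulN1r; lra.
by move: h1 h2; rewrite !ltr_pM2r // !ltr_int; lia.
Qed.

Lemma circle_normal x : exists2 x', 0 <= x' < L & circle_eq L x x'.
Proof.
pose k := Num.floor (x / L); exists (x - k%:~R * L); last by exists k; rewrite opprB addrC subrK.
have /andP[h1 h2] := floor_itv (x / L).
rewrite ler_pdivlMr // in h1; rewrite ltr_pdivrMr // intrD mulrDl mul1r in h2.
by rewrite subr_ge0 h1 /= ltrBlDr addrC.
Qed.

(** The number of points interior to an edge of length l, mapped to the circle by
    t |-> a + s t, that lie over x. *)
Definition crossings (a s l x : R) : nat :=
  absz (Num.floor ((a + s * l - x) / L) - Num.floor ((a - x) / L)).

(** The least j such that the lift x + j L is reached in the interior of the edge. *)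
Definition first_crossing (a s l x : R) : int :=
  Num.min (Num.floor ((a + s * l - x) / L)) (Num.floor ((a - x) / L)) + 1.

Definition crossing_time (a s l x : R) (i : nat) : R :=
  (x + (first_crossing a s l x + i%:Z)%:~R * L - a) / s.

Lemma between_floors (u v : R) (k : int) : (forall j : int, v != j%:~R) ->
  (u < k%:~R < v) = (Num.floor u + 1 <= k <= Num.floor v).
Proof.
move=> v_nint; rewrite -floor_lt_int -lezD1; congr (_ && _).
by rewrite floor_ge_int lt_neqAle eq_sym v_nint.
Qed.

(** The number of points of an edge over x is a difference of integer parts. *)
Lemma crossingP (a s l x t : R) : s != 0 -> 0 < l ->
  ~ circle_eq L a x -> ~ circle_eq L (a + s * l) x ->
  (0 < t < l /\ circle_eq L (a + s * t) x) <->
  (exists2 i, (i < crossings a s l x)%N & t = crossing_time a s l x i).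
Proof.
move=> s0 l0 ax bx.
have L0 : L != 0 by rewrite gt_eqF.
have nint u (j : int) : ~ circle_eq L u x -> (u - x) / L != j%:~R.
  by move=> ux; apply/eqP => h; apply: ux; exists j; rewrite -h divfK.
pose A := (a - x) / L; pose B := (a + s * l - x) / L.
have A_nint j : A != j%:~R by apply: nint.
have B_nint j : B != j%:~R by apply: nint.
have tE (k : int) : (a + s * t - x = k%:~R * L) <-> (t = (x + k%:~R * L - a) / s).
  split => [<-|->]; first by field.
  by field.
have inside (k : int) : t = (x + k%:~R * L - a) / s ->
    (0 < t < l) = (if 0 < s then A < k%:~R < B else B < k%:~R < A).
  move=> /tE h; have kE : k%:~R = A + s / L * t.
    by apply: (mulIf L0); rewrite -h mulrDl divfK //; rewrite mulrAC divfK //; ring.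
  have BE : B = A + s / L * l by rewrite /B /A; field.
  rewrite kE BE; case: (ltP 0 s) => s_sgn.
    have c0 : 0 < s / L by rewrite divr_gt0.
    by rewrite ltrDl ltrD2l pmulr_rgt0 // ltr_pM2l.
  have c0 : s / L < 0 by rewrite ltr_pdivrMr // mul0r lt_neqAle s0.
  by rewrite gtrDl ltrD2l nmulr_rlt0 // ltr_nM2l // andbC.
have floors (k : int) : (if 0 < s then A < k%:~R < B else B < k%:~R < A) =
   (first_crossing a s l x <= k < first_crossing a s l x + (crossings a s l x)%:Z).
  have AB : if 0 < s then Num.floor A <= Num.floor B else Num.floor B <= Num.floor A.
    have BE : B = A + s / L * l by rewrite /B /A; field.
    case: (ltP 0 s) => s_sgn; apply: le_floor; rewrite BE.
      by rewrite lerDl mulr_ge0 ?divr_ge0 ?(ltW L_gt0) ?(ltW s_sgn) ?(ltW l0).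
    by rewrite gerDl pmulr_lle0 // pmulr_lle0 ?invr_gt0.
  rewrite /first_crossing /crossings -/A -/B; move: AB; case: ifP => _ AB.
    rewrite between_floors // (min_idPr AB).
    by move: (Num.floor A) (Num.floor B) AB => p q pq; apply/idP/idP; lia.
  rewrite between_floors // (min_idPl AB).
  by move: (Num.floor A) (Num.floor B) AB => p q pq; apply/idP/idP; lia.
split=> [[t_in [k /tE tk]]|[i i_lt t_i]].
  have := t_in; rewrite (inside k tk) floors => /andP[k1 k2].
  exists (absz (k - first_crossing a s l x)).
    by move: k1 k2; move: (first_crossing _ _ _ _) (crossings _ _ _ _) => p q; lia.
  rewrite /crossing_time tk; congr ((_ + _%:~R * _ - _) / _).
  by move: k1; move: (first_crossing _ _ _ _) => p; lia.
have tk := t_i; rewrite /crossing_time in tk.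
split; last by exists (first_crossing a s l x + i%:Z); apply/tE.
rewrite (inside _ tk) floors; apply/andP; split; first by rewrite lerDl.
by rewrite ltrD2l ltz_nat.
Qed.

Lemma crossings_mul (a l x : R) (s : int) : 0 < l ->
  ((absz s * crossings a s%:~R l x)%N)%:Z =
  s * (Num.floor ((a + s%:~R * l - x) / L) - Num.floor ((a - x) / L)).
Proof.
move=> l0; rewrite /crossings PoszM.
have [s0|s0|->] := ltgtP s 0; last by rewrite !mul0r.
  have h : Num.floor ((a + s%:~R * l - x) / L) <= Num.floor ((a - x) / L).
    apply: le_floor; rewrite ler_pM2r ?invr_gt0 // lerB // gerDl.
    by rewrite pmulr_lle0 // lerz0 ltW.
  by rewrite (ltz0_abs s0) lez0_abs ?subr_le0 // mulrNN.
have h : Num.floor ((a - x) / L) <= Num.floor ((a + s%:~R * l - x) / L).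
  apply: le_floor; rewrite ler_pM2r ?invr_gt0 // lerB // lerDl.
  by rewrite mulr_ge0 ?ler0z // ltW.
by rewrite !gez0_abs ?subr_ge0 // ltW.
Qed.

Lemma crossing_time_inj (a s l x : R) : s != 0 -> injective (crossing_time a s l x).
Proof.
move=> s0 i j; rewrite /crossing_time => /(mulIf (invr_neq0 s0)) /addIr /addrI.
by move=> /(mulIf (lt0r_neq0 L_gt0)) /intr_inj /addrI [].
Qed.

End CircleCounting.

(** * Covers and their combinatorial data *)

Section CoversAndKeys.
Variables (R : realType) (L : R) (n : nat) (E : finType) (P : 'I_n -> R).
Hypothesis L_gt0 : 0 < L.
Hypothesis P_range : forall i, 0 <= P i < L.
Hypothesis P_mono : forall i j, (P i < P j) = (i < j)%N.
Local Notation V := 'I_n.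
Local Notation cover := (tropical_cover L V E).
Implicit Types (c : cover).

(** The flow is the opposite of the slope, so as to agree with the variable
    z_u - z_v of the propagator of an edge from u to v. *)
Definition has_key (N : nat) c (x : key n E N) : Prop :=
  [/\ curve_graph (cover_curve c) = x.1.1,
      forall v, circle_eq L (vertex_image (cover_map c) v) (P (x.1.2 v)),
      forall e, slope (cover_map c) e = - kflow x e &
      forall e, (kflow x e)%:~R * edge_length (cover_curve c) e =
        P (x.1.2 (x.1.1 (e, false))) - P (x.1.2 (x.1.1 (e, true))) + (kwinding x e)%:~R * L].

Definition branched_over_P c : Prop :=
  branch_points c = [set x | exists i, circle_eq L (P i) x].

Lemma P_inj : injective P.
Proof.
move=> i j ij; apply/val_inj/eqP; rewrite eqn_leq.
by rewrite leqNgt -P_mono ij ltxx leqNgt -P_mono ij ltxx.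
Qed.

Lemma P_circle_inj i j : circle_eq L (P i) (P j) -> i = j.
Proof. by move=> /(circle_inj L_gt0 (P_range i) (P_range j)); exact: P_inj. Qed.

Lemma P_dist i j : `|P i - P j| < L.
Proof.
by move: (P_range i) (P_range j) => /andP[? ?] /andP[? ?]; rewrite ltr_norml; lra.
Qed.

Lemma sum_flags (A : nmodType) (G : graph V E) (v : V) (F : E * bool -> A) :
  \sum_(h | G h == v) F h =
  \sum_e ((if G (e, false) == v then F (e, false) else 0) +
          (if G (e, true) == v then F (e, true) else 0)).
Proof.
transitivity (\sum_e \sum_(b : bool) if G (e, b) == v then F (e, b) else 0).
  by rewrite pair_bigA /= big_mkcond; apply: eq_bigr => -[].
by apply: eq_bigr => e _; rewrite big_bool addrC.
Qed.

Lemma balancedE (C : tropical_curve R V E) (f : affine_map L C) v :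
  balanced_at f v <-> excess (curve_graph C) (slope f) v = 0.
Proof.
have -> : excess (curve_graph C) (slope f) v =
    \sum_(h | curve_graph C h == v) outgoing_slope f h.
  rewrite sum_flags; apply: eq_bigr => e _; rewrite /outgoing_slope /= mulrBr.
  by case: eqP; case: eqP; rewrite ?mulr1 ?mulr0 ?subr0 ?sub0r ?addr0 ?add0r.
rewrite /balanced_at.
set pos := \sum_(_ | _) _; set neg := \sum_(_ | _) _.
have -> : \sum_(h | curve_graph C h == v) outgoing_slope f h = pos%:Z - neg%:Z.
  rewrite (bigID (fun h => 0 < outgoing_slope f h)) /=; congr (_ + _).
    rewrite /pos -natz natr_sum; apply: eq_bigr => h /andP[_ h0]; rewrite natz.
    rewrite /weight -(gtz0_abs h0) /outgoing_slope; case: h.2; rewrite ?abszN //.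
  rewrite (bigID (fun h => outgoing_slope f h < 0)) /= [X in _ + X]big1 ?addr0; last first.
    by move=> h /andP[/andP[_ h1] h2]; apply/eqP; rewrite eq_le !leNgt h1 h2.
  rewrite /neg -natz natr_sum -sumrN; apply: eq_big => h.
    case: (_ == v) => //=; case: ltgtP => //.
  move=> /andP[_ h0]; rewrite natz.
  have -> : weight f h.1 = absz (outgoing_slope f h).
    by rewrite /weight /outgoing_slope; case: h.2; rewrite ?abszN.
  by rewrite ltz0_abs ?opprK.
by split=> [->|/eqP]; [rewrite subrr|rewrite subr_eq0 => /eqP []].
Qed.

Lemma excessN (G : graph V E) (f g : E -> int) v : (forall e, f e = - g e) ->
  excess G f v = - excess G g v.
Proof.
by move=> fg; rewrite /excess -sumrN; apply: eq_bigr => e _; rewrite fg mulNr.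
Qed.

Lemma closing_shift N c (x : key n E N) e : has_key c x ->
  (slope (cover_map c) e)%:~R * edge_length (cover_curve c) e =
  P (x.1.2 (x.1.1 (e, true))) - P (x.1.2 (x.1.1 (e, false))) - (kwinding x e)%:~R * L.
Proof. by case=> _ _ hs hl; rewrite hs mulrNz mulNr hl; ring. Qed.

Lemma affine_valueP N c (x : key n E N) e t : has_key c x ->
  circle_eq L (affine_value (cover_map c) e t)
    (P (x.1.2 (x.1.1 (e, false))) + (slope (cover_map c) e)%:~R * t).
Proof.
case=> hG hv _ _; rewrite /affine_value; apply: circleD; last exact: circle_refl.
by rewrite -hG; exact: hv.
Qed.

(** Counting with multiplicity the points over x gives, edge by edge, the
    difference of two integer parts up to the winding number. The integer parts
    form a potential, whose contribution vanishes by conservation, so that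
    the result does not depend on x. *)
Lemma fibre_sum N c (x : key n E N) (p : R) :
  has_key c x -> conserved x.1.1 (kflow x) ->
  positive_edges x.1.1 x.1.2 (kflow x) (kwinding x) ->
  (forall v, ~ circle_eq L (vertex_image (cover_map c) v) p) ->
  (\sum_(Q \in fibre c p) weight (cover_map c) Q.1)%N = kdegree x.
Proof.
move=> ck cons pos nonbranch; have [hG hv hs hl] := ck.
pose a e := P (x.1.2 (x.1.1 (e, false))).
pose s e := slope (cover_map c) e.
pose l e := edge_length (cover_curve c) e.
have l0 e : 0 < l e := edge_length_gt0 (cover_curve c) e.
have s0 e : s e != 0 by rewrite /s hs oppr_eq0; exact: positive_edges_neq0 pos.
have s0R e : (s e)%:~R != 0 :> R by rewrite intr_eq0.
have Pp v : ~ circle_eq L (P (x.1.2 v)) p.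
  by move=> h; apply: (nonbranch v); exact: circle_trans (hv v) h.
have endE e : a e + (s e)%:~R * l e = P (x.1.2 (x.1.1 (e, true))) - (kwinding x e)%:~R * L.
  by rewrite /s /l (closing_shift e ck) /a; ring.
have bp e : ~ circle_eq L (a e + (s e)%:~R * l e) p.
  move=> h; apply: (Pp (x.1.1 (e, true))); apply: circle_trans h; apply: circle_sym.
  by rewrite endE -mulNr -mulrNz; exact: circle_shift.
pose r := [seq (e, crossing_time L (a e) (s e)%:~R (l e) p i) |
   e <- enum E, i <- iota 0 (crossings L (a e) (s e)%:~R (l e) p)].
have -> : fibre c p = [set` r].
  apply/seteqP; split=> -[e t] /=.
    rewrite /fibre /= => -[t_in tp].
    have : 0 < t < l e /\ circle_eq L (a e + (s e)%:~R * t) p.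
      by split => //; apply: circle_trans tp; apply: circle_sym; exact: affine_valueP.
    move=> /(crossingP L_gt0 t (s0R e) (l0 e) (Pp _) (bp e))[i i_lt ->].
    by apply/allpairsPdep; exists e, i; rewrite mem_enum mem_iota.
  move=> /allpairsPdep[e' [i [_ + [-> ->]]]]; rewrite mem_iota /= => i_lt.
  have [t_in tp] : 0 < crossing_time L (a e') (s e')%:~R (l e') p i < l e' /\
      circle_eq L (a e' + (s e')%:~R * crossing_time L (a e') (s e')%:~R (l e') p i) p.
    by apply/(crossingP L_gt0 _ (s0R e') (l0 e') (Pp _) (bp e')); exists i.
  split => //; apply: circle_trans tp; exact: affine_valueP.
have r_uniq : uniq r.
  apply: allpairs_uniq_dep => [|e _|]; [exact: enum_uniq|exact: iota_uniq|].
  move=> [e i] [e' i'] /= _ _ [ee'] tt'; move: tt'; rewrite -ee' => /(crossing_time_inj L_gt0 (s0R e)) ->.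
  by [].
rewrite -fsbig_seq // /r big_allpairs_dep /=.
apply/eqP; rewrite -eqz_nat; apply/eqP.
have nn e := positive_edge_ge0 (ltn_ord _) (ltn_ord _) (forallP pos e).
transitivity (\sum_e (((absz (s e)) * crossings L (a e) (s e)%:~R (l e) p)%N)%:Z).
  rewrite -natz natr_sum big_enum /=; apply: eq_bigr => e _; rewrite natz big_const_seq.
  by rewrite count_predT size_iota iter_addn_0 /weight.
rewrite (flow_degree_potential (fun v => Num.floor ((P (x.1.2 v) - p) / L)) cons pos).
apply: eq_bigr => e _; rewrite crossings_mul // /a endE.
have -> : (P (x.1.2 (x.1.1 (e, true))) - (kwinding x e)%:~R * L - p) / L =
   (P (x.1.2 (x.1.1 (e, true))) - p) / L + (- kwinding x e)%:~R.
  by rewrite mulrNz; field; rewrite gt_eqF.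
rewrite floorDrz ?intr_int // intrKfloor /s hs; ring.
Qed.

Lemma key_has_degree N c (x : key n E N) : has_key c x -> conserved x.1.1 (kflow x) ->
  positive_edges x.1.1 x.1.2 (kflow x) (kwinding x) -> has_degree c (kdegree x).
Proof. by move=> ck cons pos p; exact: fibre_sum. Qed.

Lemma exists_nonbranch : exists p : R, forall i, ~ circle_eq L (P i) p.
Proof.
have [m m_ge mL] : exists2 m, forall i, P i <= m & 0 <= m < L.
  exists (\big[Num.max/0]_i P i) => [i|]; first exact: (le_bigmax _ P i).
  rewrite bigmax_ge_id /=; apply: bigmax_lt => // i _; by case/andP: (P_range i).
exists ((m + L) / 2) => i /(circle_inj L_gt0 (P_range i)) h.
have := m_ge i; rewrite h; last by case/andP: mL => *; lra.
by case/andP: mL => *; lra.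
Qed.

End CoversAndKeys.

Section KeysOfCovers.
Variables (R : realType) (L : R) (n : nat) (E : finType) (P : 'I_n -> R).
Hypothesis L_gt0 : 0 < L.
Hypothesis P_range : forall i, 0 <= P i < L.
Hypothesis P_mono : forall i j, (P i < P j) = (i < j)%N.
Local Notation V := 'I_n.
Local Notation cover := (tropical_cover L V E).
Implicit Types (c : cover).

(** At a vertex carrying a loop there is exactly one further flag, and by
    conservation its edge has flow zero. *)
Lemma conserved_no_loop (G : graph V E) (f : E -> int) : trivalent G ->
  (forall v, excess G f v = 0) -> (forall e, f e = 0 -> G (e, false) = G (e, true)) ->
  ~~ has_loop G.
Proof.
move=> /forallP tri cons flat; apply/negP => /existsP[e0 /eqP loop].
pose v := G (e0, false); pose A := [set h | G h == v]%SET.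
have cA : #|A| = 3%N by rewrite -(eqP (tri v)); apply: fintype.eq_card => h; rewrite !inE.
have inA h : (h \in A) = (G h == v) by rewrite inE.
have : #|(A :\ (e0, false) :\ (e0, true))%SET| == 1%N.
  have := cardsD1 (e0, false) A; rewrite cA inA eqxx => h1.
  have := cardsD1 (e0, true) (A :\ (e0, false))%SET.
  rewrite in_setD1 inA -loop xpair_eqE !eqxx /= => h2.
  by rewrite h2 in h1; move: h1; move: #|_| => k; lia.
move=> /cards1P[[e1 b] B1].
have inB h : (h == (e1, b)) = [&& h != (e0, true), h != (e0, false) & G h == v].
  by rewrite -inA -!in_setD1 B1 !inE.
have := inB (e1, b); rewrite eqxx => /esym/and3P[n1 n2 Gv].
have e10 : e1 != e0.
  by apply: contraTneq n1 => e1e0; move: n2; rewrite e1e0; case: b {inB B1 Gv} => //; rewrite eqxx.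
have off e b' : e != e0 -> (e, b') != (e1, b) -> (G (e, b') == v) = false.
  move=> ne ne1; have := inB (e, b'); rewrite (negbTE ne1).
  have nt bb : (e, b') != (e0, bb) by apply: contra ne => /eqP[->].
  by rewrite !nt /= => <-.
have := cons v; rewrite /excess (bigD1 e1) //= [X in _ + X]big1 ?addr0; last first.
  move=> e ne1; have [->|ne0] := eqVneq e e0; first by rewrite -loop subrr mulr0.
  have ne b' : (e, b') != (e1, b) by apply: contra ne1 => /eqP[->].
  by rewrite !off // subrr mulr0.
have nb : (e1, ~~ b) != (e1, b) by apply/eqP => -[]; case: b {inB B1 n1 n2 Gv off}.
have Gnb := off _ _ e10 nb.
have f0 : f e1 = 0 -> False.
  by move=> /flat; move: Gv Gnb; case: b {inB B1 n1 n2 off nb} => /= /eqP h h' hh; move: h'; rewrite ?hh ?h -?hh ?h eqxx.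
move: Gv Gnb; case: b {inB B1 n1 n2 off nb} => /= -> ->; rewrite ?mulr1 // mulrN1 => /eqP.
by rewrite oppr_eq0 => /eqP.
Qed.

Lemma int_box (N : nat) (f : E -> int * int) (d : nat) : (d < N)%N ->
  (forall e, (absz (f e).1 <= d)%N /\ (absz (f e).2 <= d)%N) ->
  exists k : box E N, winding k =1 (fun e => (f e).1) /\ flow k =1 (fun e => (f e).2).
Proof.
move=> dN f_le; exists [ffun e => (inord (absz ((f e).1 + N%:Z)), inord (absz ((f e).2 + N%:Z)))].
by split=> e; rewrite /winding /flow ffunE /= inordK; have [] := f_le e; lia.
Qed.

(** The winding number of an edge measures how the lift of its image to the line
    fails to join the chosen representatives of the branch points. *)
Lemma cover_key c (d N : nat) : (d < N)%N -> branched_over_P P c -> has_degree c d ->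
  exists x : key n E N, [/\ has_key P c x, valid_key x & kdegree x = d].
Proof.
move=> dN br deg; set C := cover_curve c; set f := cover_map c.
have /choice[om om_P] : forall v, exists i, circle_eq L (vertex_image f v) (P i).
  move=> v; have : branch_points c (vertex_image f v) by exists v; exact: circle_refl.
  by rewrite br => -[i h]; exists i; exact: circle_sym.
have om_surj i : exists v, om v = i.
  have : branch_points c (P i) by rewrite br; exists i; exact: circle_refl.
  move=> [v h]; exists v; apply: (P_circle_inj L_gt0 P_range P_mono).
  by apply: circle_trans h; apply: circle_sym; exact: om_P.
have om_inj : injective om.
  have /choice[g gK] := om_surj.
  have g_inj : injective g by exact: can_inj gK.
  have [h gh hg] := injF_bij g_inj.
  by move=> u v; rewrite -{1}(hg u) -{1}(hg v) !gK => e; rewrite -(hg u) e hg.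
pose Om := perm om_inj.
have Om_P v : circle_eq L (vertex_image f v) (P (Om v)) by rewrite permE.
pose G := curve_graph C; pose l := edge_length C.
have l0 e : 0 < l e := edge_length_gt0 C e.
pose fl e : int := - slope f e.
have /choice[w w_E] : forall e, exists w : int,
    (fl e)%:~R * l e = P (Om (G (e, false))) - P (Om (G (e, true))) + w%:~R * L.
  move=> e; have [k1 h1] := Om_P (G (e, false)); have [k2 h2] := Om_P (G (e, true)).
  have [k h] := affine_closing f e; exists (k1 - k2 - k).
  rewrite /fl !(intrB, mulrNz) !(mulrBl, mulNr) -h1 -h2 -h -/C -/f -/G -/l; ring.
have cons v : excess G fl v = 0.
  by rewrite (@excessN _ _ G fl (slope f)) // (balancedE f v).1 ?oppr0 //; exact: cover_balanced.
have flat e : fl e = 0 -> G (e, false) = G (e, true).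
  move=> f0; have := w_E e; rewrite f0 mul0r => h; apply: (@perm_inj _ Om).
  apply: (P_circle_inj L_gt0 P_range P_mono); exists (- w e); rewrite mulrNz mulNr.
  by apply/eqP; rewrite -subr_eq0 opprK -h.
have noloop := conserved_no_loop (curve_trivalent C) cons flat.
have fl0 e : fl e != 0.
  by apply: contra noloop => /eqP/flat h; apply/existsP; exists e; apply/eqP.
have pos : positive_edges G Om fl w.
  apply/forallP => e; rewrite -(positive_heights (y := fun v => P (Om v)) (b := L)) //.
  - by rewrite [_ + (_ - _)]addrC -w_E mulrA pmulr_rgt0 // -expr2 exprn_even_gt0 //= intr_eq0.
  - by move=> i j; exact: P_dist.
have cons' : conserved G fl by apply/forallP => v; rewrite cons.
have [p p_P] := exists_nonbranch L_gt0 P_range.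
(* The winding numbers are bounded by the degree of the data, which is the
   degree of the cover: a box large enough for both comes first. *)
pose M := (flow_degree fl w).+1.
have bound e : (absz (w e, fl e).1 <= flow_degree fl w)%N /\ (absz (w e, fl e).2 <= flow_degree fl w)%N.
  split; first exact: winding_le_degree pos.
  exact: flow_le_degree cons' pos.
have mk K : (flow_degree fl w < K)%N -> exists x : key n E K,
    [/\ has_key P c x, valid_key x & kdegree x = flow_degree fl w].
  move=> dK; have [k [kw kf]] := int_box dK bound.
  have {}kw : winding k = w by apply/funext.
  have {}kf : flow k = fl by apply/funext.
  exists (G, Om, k); split.
  - split; rewrite /kflow /kwinding /= ?kw ?kf // => e; by rewrite /fl opprK.
  - rewrite /valid_key /good_graph /kflow /kwinding /= kw kf cons' pos noloop.
    by rewrite (curve_trivalent C) (curve_connected C).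
  - by rewrite /kdegree /kflow /kwinding /= kw kf.
have [x [cx /and3P[_ x_cons x_pos] xd]] := mk M (ltnSn _).
have dE : flow_degree fl w = d.
  have nonbranch v : ~ circle_eq L (vertex_image f v) p.
    by move=> h; apply: (p_P (Om v)); apply: circle_trans h; apply: circle_sym.
  by rewrite -xd -(fibre_sum L_gt0 cx x_cons x_pos nonbranch) deg.
by have := mk N; rewrite dE => /(_ dN).
Qed.

(** Conversely the lengths of the edges can be solved for. *)
Lemma key_cover (N : nat) (x : key n E N) : (0 < n)%N -> valid_key x ->
  exists c, has_key P c x /\ branched_over_P P c.
Proof.
move=> n0 /and3P[/and3P[tri conn noloop] cons pos].
pose G := x.1.1; pose Om := x.1.2; pose fl := kflow x; pose w := kwinding x.
pose D e : R := P (Om (G (e, false))) - P (Om (G (e, true))) + (w e)%:~R * L.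
have fl0 e : (fl e)%:~R != 0 :> R by rewrite intr_eq0; exact: positive_edges_neq0 pos.
have fD e : 0 < (fl e)%:~R * D e.
  rewrite /D addrC (positive_heights (y := fun v => P (Om v)) (Omega := Om)) //.
  - exact: (forallP pos).
  - by move=> i j; exact: P_dist.
have len e : 0 < D e / (fl e)%:~R.
  have -> : D e / (fl e)%:~R = ((fl e)%:~R * D e) / (fl e)%:~R ^+ 2 by field.
  by rewrite divr_gt0 // exprn_even_gt0 //= fl0.
pose C := TropicalCurve len tri conn.
have closing e : circle_eq L (P (Om (G (e, false))) + (- fl e)%:~R * (D e / (fl e)%:~R))
    (P (Om (G (e, true)))).
  exists (- w e); rewrite !mulrNz !mulNr mulrCA divff // mulr1 /D; ring.
pose f := @AffineMap R L V E C (fun v => P (Om v)) (fun e => - fl e) closing.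
have [h0 _] : exists h : E * bool, True.
  have /forallP/(_ (Ordinal n0))/eqP := tri.
  case: (pickP [pred h | x.1.1 h == Ordinal n0]) => [h _ _|h0 c0]; first by exists h.
  by rewrite eq_card0 in c0.
have nonconst : nonconstant f.
  pose e := h0.1; exists e, 0, e, (edge_length C e).
  have le := ltW (edge_length_gt0 C e).
  split; [by rewrite /on_edge lexx le|by rewrite /on_edge lexx le|].
  rewrite /affine_value mulr0 addr0 => h.
  have h' := circle_trans h (closing e).
  have /perm_inj hG := P_circle_inj L_gt0 P_range P_mono h'.
  by move/negP: noloop; apply; apply/existsP; exists e; apply/eqP.
have bal v : balanced_at f v.
  apply/balancedE; rewrite (@excessN _ _ _ _ fl) //.
  by rewrite (eqP (forallP cons v)) oppr0.
exists (TropicalCover nonconst bal); split.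
  split => //= [v|e]; first exact: circle_refl.
  by rewrite mulrCA divff // mulr1.
apply/seteqP; split=> t /= [v h]; first by exists (Om v).
by exists (Om^-1%g v); rewrite /= permKV.
Qed.

Lemma key_valid_neq0 N (x : key n E N) e : valid_key x -> kflow x e != 0.
Proof. by move=> /and3P[_ _ pos]; exact: positive_edges_neq0 pos. Qed.

Lemma trivalent_flag (G : graph V E) v : trivalent G -> exists h, G h = v.
Proof.
move=> /forallP/(_ v)/eqP c3.
case: (pickP [pred h | G h == v]) => [h /eqP <-|h0]; first by exists h.
by rewrite eq_card0 in c3.
Qed.

Lemma affine_end c (h : E * bool) :
  circle_eq L (affine_value (cover_map c) h.1 (if h.2 then edge_length (cover_curve c) h.1 else 0))
    (vertex_image (cover_map c) (curve_graph (cover_curve c) h)).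
Proof.
case: h => e [] /=; rewrite /affine_value; first exact: affine_closing.
by rewrite mulr0 addr0; exact: circle_refl.
Qed.

(** A small step changes the value by less than L, hence not at all. *)
Lemma affine_circle_slope (l a b : R) (k : int) : 0 < l ->
  (forall t, 0 <= t <= l -> circle_eq L (a + k%:~R * t) b) -> k = 0.
Proof.
move=> l0 h; apply/eqP; rewrite -(intr_eq0 R); apply/negPn/negP => k0.
pose m : R := `|k%:~R|; have m0 : 0 < m by rewrite normr_gt0.
pose t := Num.min l (L / (2 * m)).
have Lm : 0 < L / (2 * m) by rewrite divr_gt0 // mulr_gt0.
have t0 : 0 < t by rewrite lt_min l0 Lm.
have tl : t <= l by rewrite ge_min lexx.
have tL : m * t <= L / 2.
  have : t <= L / (2 * m) by rewrite ge_min lexx orbT.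
  rewrite -(ler_pM2l m0) => /le_trans; apply.
  by rewrite le_eqVlt; apply/orP; left; apply/eqP; field; rewrite gt_eqF.
have h1 : circle_eq L (a + k%:~R * t) b by apply: h; rewrite tl (ltW t0).
have h2 : circle_eq L (a + k%:~R * 0) b by apply: h; rewrite lexx (ltW l0).
have [j hj] := circle_trans h1 (circle_sym h2).
have kt : k%:~R * t = j%:~R * L by rewrite -hj; ring.
have j0 : j != 0.
  by apply: contra_neq k0 => j0; move: kt; rewrite j0 mul0r => /eqP; rewrite mulf_eq0 (gt_eqF t0) orbF => /eqP.
have : `|j%:~R * L| <= L / 2 by rewrite -kt normrM (gtr0_norm t0).
rewrite normrM (gtr0_norm L_gt0) -intr_norm.
have : (1 : R) <= `|j|%:~R by rewrite -[1]/((1 : int)%:~R) ler_int -gtz0_ge1 normr_gt0.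
rewrite -(ler_pM2r L_gt0) mul1r; move=> h3 h4; have h5 := le_trans h3 h4.
by move: h5; rewrite leNgt ltr_pdivrMr // ltr_pMr // ltr1n.
Qed.

Lemma key_unique N c (x x' : key n E N) : has_key P c x -> has_key P c x' -> x = x'.
Proof.
move=> [hG hv hs hl] [hG' hv' hs' hl'].
have eG : x.1.1 = x'.1.1 by rewrite -hG -hG'.
have eO : x.1.2 = x'.1.2.
  apply/permP => v; apply: (P_circle_inj L_gt0 P_range P_mono).
  by apply: circle_trans (hv' v); apply: circle_sym; exact: hv.
have ef e : kflow x e = kflow x' e by apply: oppr_inj; rewrite -hs -hs'.
rewrite [x]surjective_pairing [x']surjective_pairing.
rewrite [x.1]surjective_pairing [x'.1]surjective_pairing eG eO; congr (_, _).
apply: box_eq => e; first exact: ef.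
have := hl e; rewrite ef hl' eG eO => /addrI /(mulIf (lt0r_neq0 L_gt0)) /intr_inj h.
exact: esym.
Qed.

Lemma cover_iso_key N c c' (x : key n E N) phi :
  has_key P c x -> cover_iso c c' phi -> has_key P c' (key_act phi x).
Proof.
move=> cx [[isoG isoL] isoF]; have [hG hv hs hl] := cx.
have l0 e := edge_length_gt0 (cover_curve c) e.
have hG' : curve_graph (cover_curve c') = graph_act phi x.1.1.
  by apply: graph_act_eq => e b; rewrite isoG hG.
have vertexE v : circle_eq L (vertex_image (cover_map c') (phi.1.1 v)) (vertex_image (cover_map c) v).
  have [[e b] ev] := trivalent_flag v (curve_trivalent (cover_curve c)).
  have h1 := affine_end c (e, b); have h2 := affine_end c' (phi.1.2 e, b (+) phi.2 e).
  rewrite /= isoG ev in h1 h2.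
  apply: circle_trans (circle_sym h2) _; apply: circle_trans h1.
  have := isoF e (if b then edge_length (cover_curve c) e else 0).
  rewrite /on_edge /iso_coord isoL.
  have -> : (if b (+) phi.2 e then edge_length (cover_curve c) e else 0) =
     (if phi.2 e then edge_length (cover_curve c) e - (if b then edge_length (cover_curve c) e else 0)
      else if b then edge_length (cover_curve c) e else 0).
    by case: b {ev h2}; case: (phi.2 e); rewrite ?subrr ?subr0.
  by apply; case: b {ev h2}; rewrite lexx (ltW (l0 e)).
have slopeE e : slope (cover_map c') (phi.1.2 e) = sgb (phi.2 e) * slope (cover_map c) e.
  suff h0 : sgb (phi.2 e) * slope (cover_map c') (phi.1.2 e) - slope (cover_map c) e = 0.
    move/eqP: h0; rewrite /sgb subr_eq0; case: (phi.2 e); last by rewrite !mul1r => /eqP.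
    by rewrite !mulN1r => /eqP <-; rewrite opprK.
  pose a' := vertex_image (cover_map c') (curve_graph (cover_curve c') (phi.1.2 e, false)) -
    vertex_image (cover_map c) (curve_graph (cover_curve c) (e, false)).
  pose a := a' + (if phi.2 e then (slope (cover_map c') (phi.1.2 e))%:~R * edge_length (cover_curve c) e else 0).
  apply: (affine_circle_slope (a := a) (b := 0) (l0 e)) => t t_in.
  have [k hk] := isoF e t t_in; exists k; rewrite subr0 -hk /affine_value /iso_coord /a /a'.
  by rewrite /sgb; case: (phi.2 e); rewrite intrB ?mulN1r ?mul1r ?mulrNz; ring.
split => // [v|e|e'].
- rewrite -(permKV phi.1.1 v) order_act; apply: circle_trans (hv _); exact: vertexE.
- by rewrite -(permKV phi.1.2 e) kflow_act slopeE hs mulrN.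
- rewrite -(permKV phi.1.2 e') kflow_act kwinding_act isoL [(key_act phi x).1.1]/=.
  move: ((phi.1.2)^-1%g e') => e; have h := hl e; rewrite /sgb; case f : (phi.2 e).
    have [-> ->] := ends_act_flip x.1.1 f; rewrite !order_act !mulN1r !mulrNz !mulNr h; ring.
  by have [-> ->] := ends_act x.1.1 f; rewrite !order_act !mul1r.
Qed.

Lemma act_cover_iso N c c' (x : key n E N) phi : valid_key x ->
  has_key P c x -> has_key P c' (key_act phi x) -> cover_iso c c' phi.
Proof.
move=> vx cx cx'.
have [hG hv hs hl] := cx; have [hG' hv' hs' hl'] := cx'.
have lenE e : edge_length (cover_curve c') (phi.1.2 e) = edge_length (cover_curve c) e.
  have f0 : (kflow x e)%:~R != 0 :> R by rewrite intr_eq0 key_valid_neq0.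
  have := hl' (phi.1.2 e); have := hl e; rewrite kflow_act kwinding_act /sgb.
  rewrite [(key_act phi x).1.1]/=; case f : (phi.2 e).
    have [-> ->] := ends_act_flip x.1.1 f; rewrite !order_act => h1 h2; apply: (mulfI f0).
    by move: h2; rewrite !mulN1r !mulrNz !mulNr h1 => /eqP; rewrite eqr_oppLR => /eqP ->; ring.
  have [-> ->] := ends_act x.1.1 f; rewrite !order_act !mul1r => h1 h2; apply: (mulfI f0).
  by rewrite h1.
split; first by split => // e b; rewrite hG hG' /= graph_actE.
move=> e t t_in.
apply: circle_trans (affine_valueP _ _ cx') _.
apply: circle_trans (circle_sym (affine_valueP _ _ cx)).
rewrite hs' kflow_act /iso_coord /sgb [(key_act phi x).1.1]/=; case f : (phi.2 e).
  have [-> _] := ends_act_flip x.1.1 f; rewrite order_act.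
  have := closing_shift e cx; rewrite hs => h.
  exists (kwinding x e); rewrite mulN1r opprK mulrBr; move: h; rewrite mulrNz mulNr => h.
  have -> : (kflow x e)%:~R * edge_length (cover_curve c) e =
     - (P (x.1.2 (x.1.1 (e, true))) - P (x.1.2 (x.1.1 (e, false))) - (kwinding x e)%:~R * L).
    by rewrite -h opprK.
  by ring.
have [-> _] := ends_act x.1.1 f; rewrite order_act mul1r hs; exact: circle_refl.
Qed.

End KeysOfCovers.

(** * Counting orbits with stabilisers *)

Section OrbitCounting.
Variables (H X : finType) (act : H -> X -> X) (comp : H -> H -> H) (inv : H -> H).
Hypothesis act_comp : forall a b x, act (comp a b) x = act a (act b x).
Hypothesis act_inv : forall a x, act (inv a) (act a x) = x.
Hypothesis comp_inj : forall a, injective (comp a).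
Variable h0 : H.
Implicit Types (a b : H) (x y : X).

Definition orbit_rel : rel X := fun x y => [exists a, y == act a x].
Definition stab x : nat := #|[pred a | act a x == x]|.

Lemma orbit_relP x y : reflect (exists a, y = act a x) (orbit_rel x y).
Proof. by apply: (iffP existsP) => -[a e]; exists a; apply/eqP. Qed.

Lemma orbit_refl x : orbit_rel x x.
Proof. by apply/orbit_relP; exists (comp (inv h0) h0); rewrite act_comp act_inv. Qed.

Lemma orbit_sym x y : orbit_rel x y -> orbit_rel y x.
Proof. by move=> /orbit_relP[a ->]; apply/orbit_relP; exists (inv a); rewrite act_inv. Qed.

Lemma orbit_trans x y z : orbit_rel x y -> orbit_rel y z -> orbit_rel x z.
Proof.
move=> /orbit_relP[a ->] /orbit_relP[b ->]; apply/orbit_relP.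
by exists (comp b a); rewrite act_comp.
Qed.

Lemma orbit_rel_left x y : orbit_rel x y -> orbit_rel x =1 orbit_rel y.
Proof.
move=> xy z; apply/idP/idP; last exact: orbit_trans.
exact: orbit_trans (orbit_sym xy).
Qed.

Lemma card_hom x y : orbit_rel x y -> #|[pred a | act a x == y]| = stab x.
Proof.
move=> /orbit_relP[a ->]; rewrite /stab -!sum1_card (reindex_inj (@comp_inj a)) /=.
apply: eq_bigl => b; rewrite !inE act_comp.
exact: (inj_eq (can_inj (act_inv a))).
Qed.

(** The elements that send x to a given point of its orbit are a translate of the
    stabiliser. *)
Lemma card_orbit x : (#|[pred y | orbit_rel x y]| * stab x)%N = #|H|.
Proof.
rewrite -[RHS]sum1_card (partition_big (fun a => act a x) (orbit_rel x)) /=; last first.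
  by move=> a _; apply/orbit_relP; exists a.
rewrite -sum_nat_const; apply: eq_bigr => y xy.
by rewrite -(card_hom xy) -sum1_card.
Qed.

Lemma stab_gt0 x : (0 < stab x)%N.
Proof.
have : (0 < #|H|)%N by apply/card_gt0P; exists h0.
by rewrite -(card_orbit x) muln_gt0 => /andP[].
Qed.

Lemma stab_orbit x y : orbit_rel x y -> stab x = stab y.
Proof.
move=> xy; have := card_orbit x; rewrite -(card_orbit y).
rewrite (@fintype.eq_card _ [pred z | orbit_rel x z] [pred z | orbit_rel y z]); last first.
  by move=> z; rewrite !inE; exact: orbit_rel_left.
move/eqP; rewrite eqn_pmul2l; first by move/eqP.
by apply/card_gt0P; exists y; rewrite inE orbit_refl.
Qed.

Section InvariantSet.
Variables (D : {set X}) (F : numFieldType) (w : X -> F).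
Hypothesis act_D : forall a x, (act a x \in D) = (x \in D).
Hypothesis act_w : forall a x, w (act a x) = w x.
Let blocks := equivalence_partition orbit_rel D.

Lemma orbit_equivalence : {in D & &, equivalence_rel orbit_rel}.
Proof.
move=> x y z _ _ _; split; first exact: orbit_refl.
by move=> xy; exact: orbit_rel_left.
Qed.

Lemma blocks_partition : finset.partition blocks D.
Proof. exact: equivalence_partitionP orbit_equivalence. Qed.

Lemma mem_block x y : x \in D -> y \in D -> (y \in finset.pblock blocks x) = orbit_rel x y.
Proof. exact: pblock_equivalence_partition orbit_equivalence x y. Qed.

Lemma orbit_transversal_sub : {subset transversal blocks D <= D}.
Proof. by apply/fintype.subsetP; exact: finset.transversal_sub (transversalP blocks_partition). Qed.

Lemma transversal_exists x : x \in D -> exists2 t, t \in transversal blocks D & orbit_rel x t.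
Proof.
move=> xD; have tr := transversalP blocks_partition.
have xc : x \in finset.cover blocks by rewrite (cover_partition blocks_partition).
have Bx : finset.pblock blocks x \in blocks by rewrite pblock_mem.
exists (transversal_repr x (transversal blocks D) (finset.pblock blocks x)).
  exact: (repr_mem_transversal tr x Bx).
rewrite -mem_block //; last by apply: orbit_transversal_sub; exact: (repr_mem_transversal tr x Bx).
exact: (repr_mem_pblock tr x Bx).
Qed.

Lemma transversal_inj x y : x \in transversal blocks D -> y \in transversal blocks D ->
  orbit_rel x y -> x = y.
Proof.
move=> xT yT xy; have tr := transversalP blocks_partition.
apply: (pblock_inj tr) => //; apply/esym/same_pblock.
  by have /and3P[] := blocks_partition.
by rewrite mem_block ?orbit_transversal_sub.
Qed.

(** Weighting each orbit by the inverse of the order of the stabiliser is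
    averaging over the group. *)
Lemma sum_transversal :
  \sum_(x in transversal blocks D) w x / (stab x)%:R = (\sum_(x in D) w x) / #|H|%:R.
Proof.
have H0 : #|H|%:R != 0 :> F.
  by rewrite pnatr_eq0 -lt0n; apply/card_gt0P; exists h0.
have tr := transversalP blocks_partition.
have byblock (G : {set X} -> F) : \sum_(B in blocks) G B =
    \sum_(x in transversal blocks D) G (finset.pblock blocks x).
  rewrite -(big_imset G (pblock_inj tr)) /=; apply: eq_bigl => B.
  by rewrite (pblock_transversal tr).
rewrite (set_partition_big _ blocks_partition) byblock.
rewrite mulr_suml; apply: eq_bigr => x xT; have xD := orbit_transversal_sub xT.
have -> : \sum_(y in finset.pblock blocks x) w y = w x * #|[pred y | orbit_rel x y]|%:R.
  rewrite -sum1_card natr_sum mulr_sumr; apply: eq_big => y.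
    rewrite inE; apply/idP/idP => [yB|xy].
      have yD : y \in D.
        rewrite -(cover_partition blocks_partition); apply/finset.bigcupP.
        by exists (finset.pblock blocks x) => //; rewrite pblock_mem // (cover_partition blocks_partition).
      by rewrite -mem_block.
    rewrite mem_block //; move/orbit_relP: xy => [a ->]; by rewrite act_D.
  rewrite mulr1; have [yD|yD] := boolP (y \in D).
    by rewrite mem_block // => /orbit_relP[a ->].
  move=> yB; case/negP: yD; rewrite -(cover_partition blocks_partition); apply/finset.bigcupP.
  by exists (finset.pblock blocks x) => //; rewrite pblock_mem // (cover_partition blocks_partition).
rewrite -(card_orbit x) natrM; field.
by rewrite !pnatr_eq0 -!lt0n stab_gt0; apply/card_gt0P; exists x; rewrite inE orbit_refl.
Qed.

End InvariantSet.
End OrbitCounting.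

(** * Tropical Hurwitz numbers *)

Section HurwitzNumbers.
Variables (R : realType) (L : R) (n : nat) (E : finType) (P : 'I_n -> R).
Hypothesis L_gt0 : 0 < L.
Hypothesis P_range : forall i, 0 <= P i < L.
Hypothesis P_mono : forall i j, (P i < P j) = (i < j)%N.
Hypothesis n_gt0 : (0 < n)%N.
Local Notation V := 'I_n.
Local Notation cover := (tropical_cover L V E).
Implicit Types (c : cover).

Definition id_iso : iso_data V E := (1%g, 1%g, [ffun=> false]).

Section FixedBox.
Variable N : nat.
Implicit Types (x : key n E N).

Local Notation key_act := (@key_act n E N).
Local Notation same_key := (orbit_rel key_act).
Local Notation aut := (stab key_act).

Lemma card_cover_autE c x : valid_key x -> has_key P c x -> card_cover_aut c = aut x.
Proof.
move=> vx cx; apply: fintype.eq_card => phi; rewrite !inE; apply/asboolP/eqP => [iso|e].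
  apply/esym; apply: (key_unique L_gt0 P_range P_mono cx).
  exact: (cover_iso_key L_gt0 cx iso).
by apply: (act_cover_iso vx cx); rewrite e.
Qed.

Lemma multiplicityE c x : valid_key x -> has_key P c x ->
  multiplicity c = (kweight x)%:R / (aut x)%:R.
Proof.
move=> vx cx; rewrite /multiplicity (card_cover_autE vx cx); congr (_%:R / _).
by case: cx => _ _ hs _; apply: eq_bigr => e _; rewrite /weight hs abszN.
Qed.

Definition key_class x : set cover := [set c | exists2 y, same_key x y & has_key P c y].

Lemma cover_class c x : valid_key x -> has_key P c x ->
  [set c' | cover_isomorphic c c'] = key_class x.
Proof.
move=> vx cx; apply/seteqP; split=> c' /= => [[phi iso]|[y /orbit_relP[phi ->] cy]].
  exists (key_act phi x); last exact: (cover_iso_key L_gt0 cx iso).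
  by apply/orbit_relP; exists phi.
by exists phi; exact: (act_cover_iso vx cx).
Qed.

Let act_compN : forall phi psi x, key_act (iso_comp phi psi) x = key_act phi (key_act psi x) := @key_act_comp n E N.
Let act_invN : forall phi x, key_act (iso_inv phi) (key_act phi x) = x := @key_act_inv n E N.

Lemma valid_orbit x y : same_key x y -> valid_key y = valid_key x.
Proof. by move=> /orbit_relP[phi ->]; rewrite valid_act. Qed.

Lemma class_multiplicity x : valid_key x ->
  get [set multiplicity c | c in key_class x] = (kweight x)%:R / (aut x)%:R :> R.
Proof.
move=> vx.
have -> : [set multiplicity c | c in key_class x] = [set ((kweight x)%:R / (aut x)%:R : R)].
  have val c y : same_key x y -> has_key P c y -> multiplicity c = (kweight x)%:R / (aut x)%:R.
    move=> xy cy; rewrite (multiplicityE _ cy) ?(valid_orbit xy) //.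
    rewrite -(stab_orbit act_compN act_invN (@iso_comp_inj n E) id_iso xy).
    by move/orbit_relP: xy => [phi ->]; rewrite kweight_act.
  apply/seteqP; split=> r /=; first by move=> [c [y xy cy] <-]; exact: val xy cy.
  move=> ->; have [c [cx _]] := key_cover L_gt0 P_range P_mono n_gt0 vx.
  have xx : same_key x x by exact: (orbit_refl act_compN act_invN id_iso).
  by exists c; [exists x|exact: val xx cx].
have : [set ((kweight x)%:R / (aut x)%:R : R)] (get [set ((kweight x)%:R / (aut x)%:R : R)]).
  by apply: getPex; exists ((kweight x)%:R / (aut x)%:R).
by [].
Qed.

Definition degree_keys (d : nat) : {set key n E N} :=
  [set x | valid_key x && (kdegree x == d)]%SET.

(** Orbits of labelled keys are isomorphism classes of covers, and the
    automorphisms of a cover are the stabiliser of its key. *)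
Lemma class_sum (A : set cover) (d : nat) : (d < N)%N ->
  (forall c, A c <-> branched_over_P P c /\ has_degree c d) ->
  \sum_(K \in [set [set c' | cover_isomorphic c c'] | c in A]) get [set multiplicity c | c in K] =
  (\sum_(x in degree_keys d) (kweight x)%:R) / #|iso_data V E|%:R :> R.
Proof.
move=> dN AE; pose D := degree_keys d.
have DE x : (x \in D) = valid_key x && (kdegree x == d) by rewrite inE.
have act_D phi x : (key_act phi x \in D) = (x \in D) by rewrite !DE valid_act kdegree_act.
have act_w phi x : (kweight (key_act phi x))%:R = (kweight x)%:R :> R by rewrite kweight_act.
rewrite -(sum_transversal act_compN act_invN (@iso_comp_inj n E) id_iso act_D act_w).
set T := transversal _ _.
have TD x : x \in T -> x \in D.
  exact: (orbit_transversal_sub act_compN act_invN id_iso).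
have cls : [set [set c' | cover_isomorphic c c'] | c in A] = key_class @` [set` T].
  apply/seteqP; split=> K /=.
    move=> [c /AE[br dg] <-].
    have [x [cx vx xd]] := cover_key L_gt0 P_range P_mono dN br dg.
    have xD : x \in D by rewrite DE vx xd eqxx.
    have [t tT xt] := transversal_exists act_compN act_invN id_iso xD.
    exists t => //; rewrite (cover_class vx cx); apply/seteqP; split=> c' /= [y h cy]; exists y => //.
      exact: (orbit_trans act_compN xt).
    exact: (orbit_trans act_compN (orbit_sym act_invN xt)).
  move=> [t tT <-]; have := TD _ tT; rewrite DE => /andP[vt /eqP td].
  have [c [ct br]] := key_cover L_gt0 P_range P_mono n_gt0 vt.
  exists c; last exact: cover_class.
  apply/AE; split => //; rewrite -td; have /and3P[_ cons pos] := vt.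
  exact: (key_has_degree L_gt0 ct cons pos).
rewrite cls (reindex_fsbig key_class [set` T]); last first.
  split => //= t t'; rewrite !inE => tT t'T same.
  have := TD _ tT; rewrite DE => /andP[vt _].
  have [c [ct _]] := key_cover L_gt0 P_range P_mono n_gt0 vt.
  have : key_class t c by exists t => //; exact: (orbit_refl act_compN act_invN id_iso).
  rewrite same => -[y t'y cy].
  have yt := key_unique L_gt0 P_range P_mono cy ct; subst y.
  apply/esym; exact: (transversal_inj act_compN act_invN id_iso (D := D)).
rewrite -(bigfs _ (r := index_enum (key n E N))) ?index_enum_uniq //=; last first.
  by move=> x _; rewrite mem_index_enum.
apply: eq_bigr => t tT; have := TD _ tT; rewrite DE => /andP[vt _].
exact: class_multiplicity.
Qed.

End FixedBox.
End HurwitzNumbers.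

Section SortedPoints.
Variables (R : realType) (L : R) (n : nat) (p : 'I_n -> R).
Hypothesis L_gt0 : 0 < L.
Hypothesis p_distinct : forall i j, i != j -> ~ circle_eq L (p i) (p j).

(** The representatives in [0, L) are ranked by the number of those below them. *)
Lemma sorted_points : exists P : 'I_n -> R,
  [/\ forall i, 0 <= P i < L, forall i j, (P i < P j) = (i < j)%N &
      [set x | exists i, circle_eq L (p i) x] = [set x | exists i, circle_eq L (P i) x]].
Proof.
have /choice[q qP] : forall i, exists x, 0 <= x < L /\ circle_eq L (p i) x.
  by move=> i; have [x x1 x2] := circle_normal L_gt0 (p i); exists x.
have q_inj : injective q.
  move=> i j ij; apply/eqP/negPn/negP => /p_distinct; apply.
  have [_ hi] := qP i; have [_ hj] := qP j.
  by apply: circle_trans hi _; rewrite ij; exact: circle_sym.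
pose below i : {set 'I_n} := [set j | q j < q i]%SET.
have below_lt i : (#|below i| < n)%N.
  rewrite -[X in (_ < X)%N]card_ord -cardsT; apply: proper_card.
  by apply/properP; split; [exact: finset.subsetT|exists i; rewrite ?inE ?ltxx].
pose rk i : 'I_n := Ordinal (below_lt i).
have rk_mono i j : q i < q j -> (rk i < rk j)%N.
  move=> ij; apply: proper_card; apply/properP; split.
    by apply/fintype.subsetP => k; rewrite !inE => /lt_trans; apply.
  by exists i; rewrite !inE ?ltxx.
have rk_lt i j : (q i < q j) = (rk i < rk j)%N.
  apply/idP/idP; first exact: rk_mono.
  have [ij|ij|/q_inj ->] := ltgtP (q i) (q j) => //; last by rewrite ltnn.
  by move=> h; have := rk_mono _ _ ij; rewrite ltnNge ltnW.
have rk_inj : injective rk.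
  move=> i j ij; have := rk_lt i j; have := rk_lt j i; rewrite ij ltnn.
  by case: ltgtP => // /q_inj.
pose s := perm rk_inj.
exists (fun i => q (s^-1%g i)); split => [i|i j|].
- by case: (qP (s^-1%g i)).
- by rewrite rk_lt -{2}(permKV s i) -{2}(permKV s j) !permE.
- apply/seteqP; split=> x /= [i h].
    exists (s i); rewrite permK; apply: circle_trans h; apply: circle_sym.
    by case: (qP i).
  by exists (s^-1%g i); apply: circle_trans h; case: (qP (s^-1%g i)).
Qed.

End SortedPoints.

(** * The two generating series *)

Section GeneratingSeries.
Variables (R : realType) (n : nat) (E : finType) (q : R[i]).
Local Notation V := 'I_n.
Local Notation C := R[i].
Implicit Types (G : graph V E).

Definition key_term (N : nat) (x : key n E N) : C :=
  if valid_key x && (kdegree x < N)%N then flow_term q (kflow x) (kwinding x) else 0.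

Definition graph_series (N : nat) G : C := \sum_(x : key n E N | x.1.1 == G) key_term x.

Lemma key_term_act N (phi : iso_data V E) (x : key n E N) : key_term (key_act phi x) = key_term x.
Proof.
rewrite /key_term valid_act kdegree_act; case: ifP => // _.
by rewrite /flow_term -!/(kweight _) -!/(kdegree _) kweight_act kdegree_act.
Qed.

Lemma graph_series_act N (phi : iso_data V E) G : graph_series N (graph_act phi G) = graph_series N G.
Proof.
rewrite /graph_series (reindex_inj (can_inj (@key_act_inv n E N phi))) /=.
apply: eq_big => x; last by rewrite key_term_act.
by rewrite (inj_eq (@graph_act_inj n E phi)).
Qed.

Lemma graph_seriesE N G : graph_series N G =
  \sum_(Omega : {perm V}) \sum_(k : box E N) key_term ((G, Omega, k) : key n E N).
Proof.
rewrite pair_bigA /= /graph_series (reindex_onto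
  (fun y : {perm V} * box E N => (G, y.1, y.2) : key n E N)
  (fun x => (x.1.2, x.2))) /=; last by move=> [[G' Om] k] /= /eqP ->.
by apply: eq_bigl => -[Om k] /=; rewrite !eqxx.
Qed.

Lemma graph_series_bad N G : ~~ good_graph G -> graph_series N G = 0.
Proof.
move=> bad; rewrite /graph_series big1 // => x /eqP xG; rewrite /key_term /valid_key xG.
by rewrite (negbTE bad).
Qed.

End GeneratingSeries.

Lemma graph_series_lim (R : realType) (n : nat) (E : finType) (tau : R[i])
    (G : graph 'I_n E) (y : {perm 'I_n} -> 'I_n -> R) :
  0 < complex.Im tau -> (forall Omega, admissible_heights tau Omega (y Omega)) ->
  trivalent G -> connected_graph G ->
  clim (fun N => graph_series (e2pi tau) N G) (feynman_integral G tau y).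
Proof.
move=> tau0 y_adm tri conn; case: (boolP (has_loop G)) => [loop|noloop].
  have -> : feynman_integral G tau y = 0.
    by rewrite /feynman_integral big1 // => Om _; rewrite /feynman_integral_at loop.
  under eq_fun do rewrite graph_series_bad ?/good_graph ?loop ?andbF //.
  exact: clim_cst.
have good : good_graph G by rewrite /good_graph tri conn.
under eq_fun do rewrite graph_seriesE.
apply: clim_sum => Om _.
have := feynman_degree_lim tau0 (y_adm Om) noloop; congr clim; apply/funext => N.
rewrite big_mkcond; apply: eq_bigr => k _.
by rewrite /key_term /valid_key /= good /= -andbA.
Qed.

(** The degree bounds the flow of every edge, which is not zero. *)
Lemma valid_degree_gt0 (n : nat) (E : finType) (N : nat) (x : key n E N) :
  (0 < n)%N -> valid_key x -> (0 < kdegree x)%N.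
Proof.
move=> n0 /and3P[/and3P[tri _ _] cons pos].
have [h _] := trivalent_flag (Ordinal n0) tri.
apply: leq_trans (flow_le_degree h.1 cons pos).
by rewrite absz_gt0; exact: positive_edges_neq0 pos.
Qed.

Lemma genus_trivalent (g : nat) (G : graph 'I_(2 * g - 2) 'I_(3 * g - 3)) :
  (1 < g)%N -> connected_graph G -> genus G = g.
Proof.
by move=> g1 /eqP conn; rewrite /genus conn !card_ord; lia.
Qed.

Theorem theorem2p14 (R : realType) (g : nat) (g_gt1 : (1 < g)%N)
    (L : R) (L_gt0 : 0 < L)
    (p : 'I_(2 * g - 2) -> R)
    (p_distinct : forall i j, i != j -> ~ circle_eq L (p i) (p j))
    (tau : R[i]) (tau_gt0 : 0 < complex.Im tau)
    (y : graph 'I_(2 * g - 2) 'I_(3 * g - 3) ->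
         {perm 'I_(2 * g - 2)} -> 'I_(2 * g - 2) -> R)
    (y_admissible : forall G Omega, admissible_heights tau Omega (y G Omega)) :
  (fun n : nat => (\sum_(1 <= d < n)
     (tropical_hurwitz L p d)%:C * nome tau ^+ (2 * d)) : R[i]^o) @ \oo -->
  ((\sum_(G in feynman_graphs g)
     (card_graph_aut G)%:R^-1 * feynman_integral G tau (y G)) : R[i]^o).
Proof.
apply: clim_cvg.
set n := (2 * g - 2)%N in p p_distinct y y_admissible *.
set E := 'I_(3 * g - 3) in y y_admissible *.
have n0 : (0 < n)%N by rewrite /n; lia.
have [P [P_range P_mono branchE]] := sorted_points L_gt0 p_distinct.
pose H := #|iso_data 'I_n E|.
pose q := e2pi tau.
have hurwitzE N d : (d < N)%N -> tropical_hurwitz L p d =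
    (\sum_(x in @degree_keys n E N d) (kweight x)%:R) / H%:R.
  move=> dN; rewrite /tropical_hurwitz; apply: (class_sum L_gt0 P_range P_mono n0 dN) => c.
  rewrite /hurwitz_covers /= /branched_over_P -branchE; split; first by case.
  by move=> [br dg]; split => //; apply: genus_trivalent => //; exact: curve_connected.
have labelledE (G : graph 'I_n E) : (G \in labelled_feynman_graphs g) = trivalent G && connected_graph G.
  rewrite inE; case: (trivalent G) => //=; case conn: (connected_graph G) => //=.
  by rewrite (genus_trivalent g_gt1 conn) eqxx.
have relE : @graph_isomorphic 'I_n E = orbit_rel (@graph_act n E).
  apply/funext => G; apply/funext => G'.
  by apply/graph_isomorphicP/orbit_relP.
pose D := labelled_feynman_graphs g.
have act_D phi (G : graph 'I_n E) : (graph_act phi G \in D) = (G \in D).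
  by rewrite !labelledE trivalent_act connected_act.
have actC := @graph_act_comp n E; have actV := @graph_act_inv n E.
have graphsE : feynman_graphs g = transversal (equivalence_partition (orbit_rel (@graph_act n E)) D) D.
  by rewrite /feynman_graphs relE.
have partial N : \sum_(1 <= d < N) (tropical_hurwitz L p d)%:C * nome tau ^+ (2 * d) =
    \sum_(G in feynman_graphs g) (card_graph_aut G)%:R^-1 * graph_series q N G.
  transitivity ((\sum_(x : key n E N) key_term q x) / H%:R).
    transitivity (\sum_(1 <= d < N) (\sum_(x : key n E N)
        if valid_key x && (kdegree x == d) then flow_term q (kflow x) (kwinding x) else 0) / H%:R).
      apply: eq_big_nat => d /andP[_ dN].
      rewrite (hurwitzE N d dN) exprM nome_sqr rmorphM fmorphV rmorph_nat rmorph_sum /=.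
      rewrite mulrAC; congr (_ / _); rewrite mulr_suml -big_mkcond /=.
      apply: eq_big => x; first by rewrite inE.
      by rewrite inE => /andP[_ /eqP <-]; rewrite rmorph_nat.
    rewrite -mulr_suml exchange_big /=; congr (_ / _); apply: eq_bigr => x _.
    rewrite /key_term; case: (boolP (valid_key x)) => [vx|_] /=; last by rewrite big1.
    rewrite -big_mkcond /=; have d0 := valid_degree_gt0 n0 vx.
    under eq_bigl do rewrite eq_sym.
    by rewrite big_nat1_eq d0.
  rewrite graphsE.
  transitivity (\sum_(G in transversal (equivalence_partition (orbit_rel (@graph_act n E)) D) D)
      graph_series q N G / (stab (@graph_act n E) G)%:R); last first.
    apply: eq_bigr => G _; rewrite mulrC; have [good|bad] := boolP (good_graph G).
      by move: good => /and3P[_ _ noloop]; rewrite (card_graph_autE noloop).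
    by rewrite graph_series_bad // !mulr0.
  rewrite (sum_transversal actC actV (@iso_comp_inj n E) (id_iso n E) act_D
     (fun phi G => graph_series_act q N phi G)).
  congr (_ / _); rewrite (partition_big (fun x : key n E N => x.1.1) predT) //= [RHS]big_mkcond /=.
  apply: eq_bigr => G _; case: ifP => // /negbT; rewrite labelledE => notD.
  apply: graph_series_bad; apply: contra notD; by case/and3P => -> ->.
have -> : (fun N => \sum_(1 <= d < N) (tropical_hurwitz L p d)%:C * nome tau ^+ (2 * d)) =
  (fun N => \sum_(G in feynman_graphs g) (card_graph_aut G)%:R^-1 * graph_series q N G).
  by apply/funext => N; exact: partial.
apply: clim_sum => G GF; apply: climZ.
have GD : G \in labelled_feynman_graphs g.
  by move: GF; rewrite graphsE; exact: (orbit_transversal_sub actC actV (id_iso n E)).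
move: GD; rewrite labelledE => /andP[tri conn].
exact: graph_series_lim.
Qed.
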